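(* Let $\Omega\subset\mathbb{R}^2$ be an analytic non-convex domain, and let $T_0>0$, $\varepsilon\ll1$, $N\gg1$, with $\mathfrak{IB}$ the associated infinite-bounces set. Then $$\mathfrak{N}^*_{\varepsilon,N,T_0}:=\sup_{(x,v)\in\{cl(\Omega)\times\mathbb{V}^N\}\setminus\mathfrak{IB}}\mathfrak{N}(x,v,NT_0)\ \le\ C_{\varepsilon,NT_0}$$ for some finite constant $C_{\varepsilon,NT_0}$ (the $\varepsilon$-dependence coming from the sets $\mathcal{O}_i^{IB}$ used to define $\mathfrak{IB}$).
   Context: Analytic non-convex domain: $\Omega\subset\mathbb{R}^2$ is an open connected bounded set for which there are simply connected subsets $\Omega_i\subset\mathbb{R}^2$, $i=0,1,\dots,M<\infty$, with $\Omega=\Omega_0\setminus\{\Omega_1\cup\dots\cup\Omega_M\}$, such that: (1) $\Omega_i\subset\subset\Omega_0$ for $i=1,\dots,M$ and $\partial\Omega_i\cap\partial\Omega_j=\emptyset$ for all $i\ne j$; (2) each $\partial\Omega_i$ is the image of a closed regular analytic curve $\alpha_i:[a_i,b_i]\to\mathbb{R}^2$; (3) $\partial\Omega=\bigsqcup_{i=0}^M\partial\Omega_i$. $cl$ denotes closure; $\mathbf{n}$ is the outward unit normal; $\mathbb{V}^N=\{v\in\mathbb{R}^2:\frac2N\le|v|\le\frac N2\}$; $\mathfrak{m}_2$ is Lebesgue measure on $\mathbb{R}^2$. Specular cycles: $t_{\mathbf b}(x,v)=\sup\{s\ge0:\ x-\tau v\in\Omega\ \text{for all }\tau\in(0,s)\}$.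 Set $(t^0,x^0,v^0)=(t,x,v)$ and, when $t_{\mathbf b}>0$, inductively $t^k=t^{k-1}-t_{\mathbf b}(x^{k-1},v^{k-1})$, $x^k=x^{k-1}-t_{\mathbf b}(x^{k-1},v^{k-1})v^{k-1}$, $v^k=v^{k-1}-2(\mathbf{n}(x^k)\cdot v^{k-1})\mathbf{n}(x^k)$. The specular characteristics are $X(s;t,x,v)=x^k+(s-t^k)v^k$, $V(s;t,x,v)=v^k$ for $s\in(t^{k+1},t^k]$. Grazing sets: parametrize each $\alpha_i=(\alpha_{i,1},\alpha_{i,3})$ by arc length with $\mathbf{n}(\alpha_i)=(\dot\alpha_{i,3},-\dot\alpha_{i,1})$ outward, and let $\kappa=\ddot\alpha_i\cdot\mathbf{n}(\alpha_i)$. The closure of $\{\tau\in[a_i,b_i]:\kappa(\tau)>0\}$ is a finite disjoint union of closed intervals $[a_{i,j},b_{i,j}]$, $j=1,\dots,N_i$; $\partial\Omega^I=\bigsqcup_{i=0}^M\bigsqcup_{j=1}^{N_i}\{\alpha_i(a_{i,j}),\alpha_i(b_{i,j})\}$. $\gamma_0=\{(x,v):x\in\partial\Omega,\mathbf{n}(x)\cdot v=0\}$, $\gamma_0^I=\{(x,v)\in\gamma_0:x\in\partial\Omega^I\}$, and $\gamma_0^{I_-}=\{(x,v)\in\gamma_0:\ t_{\mathbf b}(x,v)=0,\ t_{\mathbf b}(x,-v)\ne0,\ \exists\,\delta>0\text{ with }x-\tau v\in\mathbb{R}^2\setminus cl(\Omega)\text{ for }\tau\in(0,\delta)\}$. Infinite-bounces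 set: for $\varepsilon\ll1$, $N\gg1$ fix (such data exist) finitely many points $x_i^{IB}\in cl(\Omega)$, open balls $B(x_i^{IB},r_i^{IB})$ and open sets $\mathcal{O}_i^{IB}\subset\mathbb{V}^N$ ($i=1,\dots,l_{IB}$) with $\mathfrak{m}_2(\mathcal{O}_i^{IB})<C\varepsilon$ ($C$ uniform) such that for every $x\in cl(\Omega)$ there is $i$ with $x\in B(x_i^{IB},r_i^{IB})$ and, for all $v\in\mathbb{V}^N\setminus\mathcal{O}_i^{IB}$: $|v\cdot\mathbf{n}(y)|>\varepsilon/N^4$ for all $y\in\partial\Omega\cap B(x_i^{IB},r_i^{IB})$, and $(X(t_k;T_0,x,v),V(t_k;T_0,x,v))\notin\gamma_0^I$ for all bouncing times $t_k\in[0,T_0]$. Then $\mathfrak{IB}=\{(x,v)\in cl(\Omega)\times\mathbb{V}^N:\ v\in\mathcal{O}_i^{IB}\text{ for some }i\text{ with }x\in B(x_i^{IB},r_i^{IB})\}$. Bounce number: for $L>0$, if $\{k\in\mathbb{N}:\sum_{j=1}^k|x^{j-1}(x,v)-x^j(x,v)|>L\}$ is nonempty, $\mathfrak{N}(x,v,L)$ is its infimum; otherwise (backward trajectory trapped in $\gamma_0^{I_-}$) $\mathfrak{N}(x,v,L)=\inf\{i\in\mathbb{N}:(x^i(x,v),v^{i-1}(x,v))\in\gamma_0^{I_-}\}$.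
   Formalization: The sets O_i are open relative to V^N (no R²-open choice exists), and the bound is proved for suitably chosen infinite-bounces data with all listed properties, whose existence is part of the claim; for arbitrary data it fails near inflection tangents, as grazing is excluded only on [0,T_0]. *)

(* Defs.v *)
From HB Require Import structures.
From mathcomp Require Import all_boot all_order all_algebra.
From mathcomp Require Import all_classical all_reals all_analysis.

Set Implicit Arguments.
Unset Strict Implicit.
Unset Printing Implicit Defensive.

Import Order.TTheory GRing.Theory Num.Theory.
Import numFieldNormedType.Exports.

Local Open Scope classical_set_scope.
Local Open Scope ring_scope.

(* The library norm on [R * R] is the sup norm, so the Euclidean norm and balls
   are defined here (the topologies, hence [open], [closure], [compact],
   coincide). *)
Notation plane R := (R * R)%type.

Section Euclidean.
Context {R : realType}.
Implicit Types (x u v : plane R) (A B : set (plane R)).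

Definition dot u v : R := u.1 * v.1 + u.2 * v.2.
Definition enorm v : R := Num.sqrt (dot v v).
Definition eball x (r : R) : set (plane R) := [set y | enorm (y - x) < r].

Definition boundary A : set (plane R) := closure A `\` A°.

Definition compactly_inside A B := compact (closure A) /\ closure A `<=` B°.

Definition path_in A (c : R -> plane R) :=
  {within `[0, 1], continuous c} /\ (forall t, 0 <= t <= 1 -> A (c t)).

Definition simply_connected A :=
  [/\ A !=set0,
      forall x y, A x -> A y ->
        exists c, [/\ path_in A c, c 0 = x & c 1 = y]
    & forall c, path_in A c -> c 0 = c 1 ->
        exists H : R * R -> plane R,
          [/\ {within `[0, 1] `*` `[0, 1], continuous H},
              forall s t, 0 <= s <= 1 -> 0 <= t <= 1 -> A (H (s, t)),
              forall t, 0 <= t <= 1 -> H (0, t) = c t /\ H (1, t) = c 0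
            & forall s, 0 <= s <= 1 -> H (s, 0) = c 0 /\ H (s, 1) = c 0]].

Definition leb2 : set (plane R) -> \bar R :=
  (@lebesgue_measure R \x @lebesgue_measure R)%E.

End Euclidean.

Section Curves.
Context {R : realType}.
Implicit Types (a b t : R) (al : R -> plane R).

Definition analytic_at (f : R -> R) t :=
  exists (c : nat -> R) (r : R), 0 < r /\
    forall h, `|h| < r -> series (fun n => c n * h ^+ n) @ \oo --> f (t + h).

Definition nderiv (n : nat) al t : plane R :=
  (derive1n n (fun s => (al s).1) t, derive1n n (fun s => (al s).2) t).

(* [al] is total; analyticity at every point of [a, b] makes it analytic on a
   neighbourhood of [a, b], and its values elsewhere are irrelevant.  A closed
   regular curve is one for which all derivatives agree at the two ends. *)
Definition closed_regular_analytic_curve a b al :=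
  [/\ a < b,
      forall t, a <= t <= b ->
        analytic_at (fun s => (al s).1) t /\ analytic_at (fun s => (al s).2) t,
      forall n, nderiv n al a = nderiv n al b
    & forall t, a <= t <= b -> nderiv 1 al t <> 0].

Definition right_normal al t : plane R :=
  ((nderiv 1 al t).2, - (nderiv 1 al t).1).

Definition curvature al t : R := dot (nderiv 2 al t) (right_normal al t).

Definition finite_disjoint_intervals (K : set R) (n : nat)
    (cd : 'I_n -> R * R) :=
  [/\ forall j, (cd j).1 <= (cd j).2,
      forall j j', j != j' ->
        [set` `[(cd j).1, (cd j).2]] `&` [set` `[(cd j').1, (cd j').2]] = set0
    & K = \bigcup_(j in setT) [set` `[(cd j).1, (cd j).2]]].

End Curves.

Section Domain.
Context {R : realType}.
Implicit Types (Om : set (plane R)) (x v nu : plane R) (M : nat).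

Definition analytic_nonconvex_domain M Om (Omi : 'I_M.+1 -> set (plane R)) :=
  [/\ [/\ open Om, connected Om & bounded_set Om],
      (forall i, simply_connected (Omi i)) /\
        Om = Omi ord0 `\` \bigcup_(i in [set i | i != ord0]) Omi i,
      (forall i, i != ord0 -> compactly_inside (Omi i) (Omi ord0)) /\
        (forall i j, i != j -> boundary (Omi i) `&` boundary (Omi j) = set0),
      forall i, exists (a b : R) (al : R -> plane R),
        closed_regular_analytic_curve a b al /\
        boundary (Omi i) = al @` `[a, b]
    & boundary Om = \bigcup_i boundary (Omi i)].

(* First-order description of the exterior normal: directions making an obtuse
   angle with [nu] enter Om, those making an acute angle leave cl(Om).  There
   is at most one such unit vector. *)
Definition is_outward_unit_normal Om x nu :=
  enorm nu = 1 /\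
  forall u,
    (dot u nu < 0 ->
       exists2 d : R, 0 < d & forall s, 0 < s < d -> Om (x + s *: u)) /\
    (0 < dot u nu ->
       exists2 d : R, 0 < d &
         forall s, 0 < s < d -> ~ closure Om (x + s *: u)).

Definition normal Om x : plane R :=
  xget 0 [set nu | is_outward_unit_normal Om x nu].

Definition arclength_boundary M Om (Omi : 'I_M.+1 -> set (plane R))
    (a b : 'I_M.+1 -> R) (al : 'I_M.+1 -> R -> plane R) :=
  forall i,
    [/\ closed_regular_analytic_curve (a i) (b i) (al i),
        boundary (Omi i) = al i @` `[a i, b i],
        forall t, a i <= t <= b i -> enorm (nderiv 1 (al i) t) = 1
      & forall t, a i <= t <= b i ->
          is_outward_unit_normal Om (al i t) (right_normal (al i) t)].

(* The endpoints of the intervals making up the closure of {kappa > 0}; such a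
   decomposition is unique up to order. *)
Definition inflection_boundary M (a b : 'I_M.+1 -> R)
    (al : 'I_M.+1 -> R -> plane R) : set (plane R) :=
  [set p | exists i n (cd : 'I_n -> R * R),
    finite_disjoint_intervals
      (closure [set t | a i <= t <= b i /\ 0 < curvature (al i) t]) cd /\
    exists j, p = al i (cd j).1 \/ p = al i (cd j).2].

End Domain.

Section Billiard.
Context {R : realType}.
Variable Om : set (plane R).
Implicit Types (x v : plane R) (t s L : R) (k : nat).

(* For v <> 0 and Om bounded the set is bounded; it always contains 0. *)
Definition t_b x v : R :=
  sup [set s | 0 <= s /\ forall tau, 0 < tau < s -> Om (x - tau *: v)].

Definition reflect x v : plane R :=
  v - (2 * dot (normal Om x) v) *: normal Om x.

Definition bounce (p : R * plane R * plane R) : R * plane R * plane R :=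
  let: (t, x, v) := p in
  let x' := x - t_b x v *: v in
  (t - t_b x v, x', reflect x' v).

(* When x is on the boundary and -v points out of Om, t_b(x,v) = 0 and the
   first step is the reflection at x; at a grazing point with t_b = 0 the cycle
   is stationary. *)
Definition cycle t x v k : R * plane R * plane R := iter k bounce (t, x, v).
Definition tc t x v k : R := (cycle t x v k).1.1.
Definition xc t x v k : plane R := (cycle t x v k).1.2.
Definition vc t x v k : plane R := (cycle t x v k).2.

(* The index k with s in (t^(k+1), t^k].  If the cycle is stationary from k on,
   all these intervals are empty and the time s = t^k is attributed to k. *)
Definition char_index s t x v : nat :=
  xget 0%N [set k | tc t x v k.+1 < s <= tc t x v k \/
                    (s = tc t x v k /\
                     forall j, (k <= j)%N -> tc t x v j = tc t x v k)].
Definition Xchar s t x v : plane R :=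
  let k := char_index s t x v in xc t x v k + (s - tc t x v k) *: vc t x v k.
Definition Vchar s t x v : plane R := vc t x v (char_index s t x v).

Definition gamma0 : set (plane R * plane R) :=
  [set p | boundary Om p.1 /\ dot (normal Om p.1) p.2 = 0].

Definition gamma0I (dI : set (plane R)) : set (plane R * plane R) :=
  [set p | gamma0 p /\ dI p.1].

Definition gamma0Im : set (plane R * plane R) :=
  [set p | [/\ gamma0 p, t_b p.1 p.2 = 0, t_b p.1 (- p.2) <> 0
    & exists2 d : R, 0 < d &
        forall tau, 0 < tau < d -> ~ closure Om (p.1 - tau *: p.2)]].

(* The initial time plays no role in x^k and v^k, so it is set to 0. *)
Definition longer_than x v L : set nat :=
  [set k | L < \sum_(1 <= j < k.+1) enorm (xc 0 x v j.-1 - xc 0 x v j)].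

Definition trapped_at x v : set nat :=
  [set i | (0 < i)%N /\ gamma0Im (xc 0 x v i, vc 0 x v i.-1)].

(* Extended-real valued, the infimum of the empty set being +oo. *)
Definition bounce_number x v L : \bar R :=
  if `[< longer_than x v L !=set0 >]
  then ereal_inf [set (k%:R)%:E | k in longer_than x v L]
  else ereal_inf [set (i%:R)%:E | i in trapped_at x v].

End Billiard.

Section InfiniteBounces.
Context {R : realType}.

Definition VN (N : R) : set (plane R) :=
  [set v | 2 / N <= enorm v <= N / 2].

Record IB_data := IBData {
  ib_num : nat;
  ib_ctr : 'I_ib_num -> plane R;
  ib_rad : 'I_ib_num -> R;
  ib_dir : 'I_ib_num -> set (plane R) }.

Definition ib_ball (D : IB_data) (i : 'I_(ib_num D)) : set (plane R) :=
  eball (ib_ctr i) (ib_rad i).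

(* The sets O_i are open relatively to the closed annulus V^N. *)
Definition is_IB_data (Om dI : set (plane R)) (C T0 eps N : R) (D : IB_data) :=
  [/\ forall i : 'I_(ib_num D), closure Om (ib_ctr i) /\ 0 < ib_rad i,
      forall i : 'I_(ib_num D),
        exists2 U : set (plane R), open U & ib_dir i = U `&` VN N,
      forall i : 'I_(ib_num D), (leb2 (ib_dir i) < (C * eps)%:E)%E
    & forall x, closure Om x -> exists i : 'I_(ib_num D),
        ib_ball i x /\
        forall v, VN N v -> ~ ib_dir i v ->
          (forall y, boundary Om y -> ib_ball i y ->
             eps / N ^+ 4 < `|dot v (normal Om y)|) /\
          (forall k, (0 < k)%N ->
             let tk := tc Om T0 x v k in
             0 <= tk <= T0 ->
             ~ gamma0I Om dI (Xchar Om tk T0 x v, Vchar Om tk T0 x v))].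

Definition IB (Om : set (plane R)) (N : R) (D : IB_data) :
    set (plane R * plane R) :=
  [set p | [/\ closure Om p.1, VN N p.2
    & exists i : 'I_(ib_num D), ib_dir i p.2 /\ ib_ball i p.1]].

Definition bounce_sup (Om : set (plane R)) (T0 N : R) (D : IB_data) : \bar R :=
  ereal_sup [set bounce_number Om p.1 p.2 (N * T0)
            | p in (closure Om `*` VN N) `\` IB Om N D].

End InfiniteBounces.

(* Main.v *)
(** A backward trajectory is a sequence of states under the bounce map [bstep].
    The directions discarded in a small ball of base points are those nearly
    tangent to the boundary in that ball, together with thin strips around
    countably many directions: those of the trajectories which at some bounce
    graze the boundary at a zero of the curvature (finitely many by analyticity,
    since a closed curve is not flat) or at a parameter endpoint.  Reversing
    time, such a trajectory is determined by the grazing point, the sense of the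
    tangent and the number of bounces.  All endpoints of the components of the
    closure of {kappa > 0} are among these points, so every other trajectory can
    only graze the boundary where kappa > 0, and then it leaves it again.

    The bounce points of such a trajectory cannot accumulate: near a limit point
    the boundary is one arc along which |kappa| is a monotone function times a
    function of bounded logarithm, and a monotonicity argument along the chords
    excludes tangential accumulation.  Hence its length is infinite.

    Although bounce points do not depend continuously on the initial state when
    a grazing bounce appears or disappears, the number of bounces needed to
    exceed a given length is locally bounded, and compactness of the set of
    admissible states gives the uniform bound. *)

From HB Require Import structures.
Require Import Defs.
From mathcomp Require Import all_boot all_order all_algebra.
From mathcomp Require Import all_classical all_reals all_analysis.
From mathcomp Require Import ring lra measurable_realfun.

Set Implicit Arguments.
Unset Strict Implicit.
Unset Printing Implicit Defensive.

Import Order.TTheory GRing.Theory Num.Theory.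
Import numFieldNormedType.Exports.

Local Open Scope classical_set_scope.
Local Open Scope ring_scope.

(** * Calculus and power series *)

Section Calculus.
Context {R : realType}.
Implicit Types (f df : R -> R) (a b t : R).

(** With the outward normal, kappa is negative on the circle bounding a disc. Where it is positive,
    the tangent line near its contact point lies in the domain, so a grazing trajectory passes on;
    where it is negative, no tangential arrival through the domain is possible.

    Accumulation is excluded for each trajectory separately and without a rate; uniformity comes
    from compactness alone. Hence the discarded direction sets have to be relatively open: the
    countably many exceptional directions are thickened to strips of summable measure, because
    dropping a null set would not leave a compact set. The strips do not depend on [T0], since they
    deal with all bounces at once.

    The local bound is an induction on the length covered. Near a limit trajectory a step may be
    preceded by one additional bounce, or a grazing bounce may be replaced by a flight past the
    boundary; the sequence of bounces then changes, while the length changes little. *)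

Lemma is_derive_mvt f df a b : a < b ->
  (forall t, a <= t <= b -> is_derive t 1 f (df t)) ->
  exists2 c, a < c < b & f b - f a = df c * (b - a).
Proof.
move=> ab dfE.
have [||c cab E] := @MVT R f df a b ab.
- by move=> t; rewrite in_itv/= => /andP[/ltW ? /ltW ?]; apply: dfE; apply/andP.
- apply: derivable_within_continuous => t; rewrite in_itv/= => tab.
  by have [] := dfE _ tab.
- by exists c => //; move: cab; rewrite in_itv.
Qed.

Lemma is_derive_ge0_le f df a b : a <= b ->
  (forall t, a <= t <= b -> is_derive t 1 f (df t)) ->
  (forall t, a <= t <= b -> 0 <= df t) -> f a <= f b.
Proof.
rewrite le_eqVlt => /predU1P[->//|ab] dfE df0.
have [c /andP[ac cb] E] := is_derive_mvt ab dfE.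
rewrite -subr_ge0 E mulr_ge0 ?subr_ge0 ?(ltW ab)// df0//.
by rewrite (ltW ac) (ltW cb).
Qed.

Lemma is_derive_gt0_lt f df a b : a < b ->
  (forall t, a <= t <= b -> is_derive t 1 f (df t)) ->
  (forall t, a < t < b -> 0 < df t) -> f a < f b.
Proof.
move=> ab dfE df0.
have [c cab E] := is_derive_mvt ab dfE.
by rewrite -subr_gt0 E mulr_gt0 ?subr_gt0// df0.
Qed.

Lemma is_derive_translate f d a t :
  is_derive (a + t) 1 f d -> is_derive t 1 (fun h => f (a + h)) d.
Proof.
move=> dfE.
have dg : is_derive t 1 (fun h : R => a + h) 1.
  have := is_deriveD (is_derive_cst a t (1:R)) (is_derive_id t (1:R)).
  by rewrite add0r.
apply: (is_derive_eq (is_derive1_comp (f:=f) dfE dg)).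
by rewrite mulr1.
Qed.

Lemma near_is_derive f g d t : is_derive t 1 f d ->
  (\forall s \near t, f s = g s) -> is_derive t 1 g d.
Proof. by move=> fd fg; exact: near_eq_is_derive fd. Qed.

Lemma pos_lt2 (x y : R) : 0 < x -> 0 < y -> exists2 d : R, 0 < d & d < x /\ d < y.
Proof.
move=> x0 y0; have m0 : 0 < Num.min x y by rewrite lt_min x0.
exists (Num.min x y / 2); first by rewrite divr_gt0.
have [m1 m2] : Num.min x y <= x /\ Num.min x y <= y by rewrite !ge_min !lexx orbT.
move: (Num.min x y) m0 m1 m2 => m *; lra.
Qed.

Lemma near_dist (x e : R) : 0 < e -> \forall s \near x, `|s - x| < e.
Proof.
move=> e0; have := nbhsx_ballx x _ e0; apply: filterS => s.
by rewrite /ball/= distrC.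
Qed.

Lemma near_distP (x : R) (P : R -> Prop) : (\forall s \near x, P s) ->
  exists2 e : R, 0 < e & forall s, `|s - x| < e -> P s.
Proof.
move=> /nbhs_ballP[e e0 eP]; exists e => // s se.
by apply: eP; rewrite /ball/= distrC.
Qed.

End Calculus.

Section PowerSeries.
Context {R : realType}.
Implicit Types (c : nat -> R) (h r : R).

Definition pscvg c r := forall h, `|h| < r -> cvgn (pseries c h).
Definition psum c h : R := limn (pseries c h).

(** Between [|h|] and [r] there is room for a ratio [1 + e]; by Bernoulli's inequality
    [(1 + e) ^+ n.+1] dominates, up to the constant [e], the factor [n.+1] produced by
    differentiation. *)
Lemma pscvg_diffs c r : pscvg c r -> pscvg (pseries_diffs c) r.
Proof.
move=> cr h hr.
pose K : R := (`|h| + r) / 2.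
have r0 : 0 < r by apply: le_lt_trans hr.
have hK : `|h| < K by rewrite /K; lra.
have Kr : K < r by rewrite /K; lra.
have K0 : 0 < K by rewrite (le_lt_trans _ hK).
have K2 : 0 < (K + r) / 2 by lra.
have K2r : (K + r) / 2 < r by lra.
have KK2 : K < (K + r) / 2 by lra.
pose K' : R := (`|h| + K) / 2.
have hK' : `|h| < K' by rewrite /K'; lra.
have K'K : K' < K by rewrite /K'; lra.
have K'0 : 0 < K' by rewrite (le_lt_trans _ hK').
pose e : R := K / K' - 1.
have e0 : 0 < e by rewrite subr_gt0 ltr_pdivlMr// mul1r.
have Ke : K = (1 + e) * K' by rewrite /e addrC subrK divfK// gt_eqF.
have bern n : n%:R * e <= (1 + e) ^+ n.
  elim: n => [|n IH]; first by rewrite mul0r expr0.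
  rewrite exprS mulrDl mul1r -natr1 mulrDl mul1r lerD//.
  rewrite -[leLHS]mulr1 ler_wpM2l ?(ltW e0)//.
  by rewrite exprn_ege1// lerDl ltW.
have /is_cvg_pseries_inside_norm cK : cvgn (pseries c ((K + r) / 2)).
  by apply: cr; rewrite gtr0_norm.
have {}cK : cvgn (pseries (fun i => `|c i|) K).
  apply: cK; by rewrite (gtr0_norm K0) gtr0_norm.
apply: normed_cvg.
apply: (@series_le_cvg _ _ (fun n => (e * K')^-1 * (`|c n.+1| * K ^+ n.+1))).
- by move=> n /=; rewrite normr_ge0.
- move=> n; apply: mulr_ge0.
    by rewrite invr_ge0 mulr_ge0// ltW.
  by rewrite mulr_ge0// exprn_ge0// ltW.
- move=> n /=; rewrite /pseries_diffs !normrM normrX normr_nat.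
  rewrite [leRHS]mulrC ler_pdivlMr; last exact: mulr_gt0.
  rewrite [leLHS](_ : _ = `|c n.+1| * ((n.+1%:R * e) * (`|h| ^+ n * K'))); last by ring.
  rewrite ler_wpM2l// Ke exprMn; apply: ler_pM => //.
  - by rewrite mulr_ge0// ltW.
  - by rewrite mulr_ge0 ?exprn_ge0// ltW.
  rewrite exprSr ler_wpM2r ?(ltW K'0)//.
  by apply: lerXn2r; rewrite ?nnegrE// ltW.
- have S := @is_cvg_seriesZ R (fun n => `|c n.+1| * K ^+ n.+1) (e * K')^-1.
  apply: S.
  have -> : [series `|c n.+1| * K ^+ n.+1]_n =
     (fun n => series (fun n => `|c n| * K ^+ n) n.+1 - `|c 0%N| * K ^+ 0).
    apply/funext => n; rewrite /series/= big_nat_recl//=.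
    by rewrite addrAC subrr add0r.
  apply: is_cvgB; last exact: is_cvg_cst.
  apply/cvg_ex; exists (limn (pseries (fun n => `|c n|) K)).
  by rewrite cvg_shiftS.
Qed.

Lemma is_derive_psum c r h : pscvg c r -> `|h| < r ->
  is_derive h 1 (psum c) (psum (pseries_diffs c) h).
Proof.
move=> cr hr; have r0 : 0 < r by apply: le_lt_trans hr.
pose K : R := (`|h| + r) / 2.
have K0 : 0 <= K by rewrite divr_ge0// addr_ge0// ltW.
have [hK Kr] : `|h| < K /\ K < r by rewrite /K; split; lra.
rewrite -(ger0_norm K0) in hK Kr.
apply: pseries_snd_diffs hK; first exact: cr.
  exact: pscvg_diffs Kr.
exact: (pscvg_diffs (pscvg_diffs cr)) Kr.
Qed.

Lemma psum0 c : psum c 0 = c 0%N.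
Proof.
rewrite /psum; apply: (@cvg_lim R^o) => //.
apply: (cvg_near_cst (c 0%N)); exists 1%N => // n /= n0.
case: n n0 => // n _.
rewrite /pseries/series/= big_nat_recl//= expr0 mulr1.
rewrite big_nat big1 ?addr0// => i _.
by rewrite expr0n/= mulr0.
Qed.

Lemma iter_pseries_diffs0 n c : iter n (@pseries_diffs R) c 0%N = n`!%:R * c n.
Proof.
suff H : forall k, iter n (@pseries_diffs R) c k = ((n + k)`!%:R / k`!%:R) * c (n + k)%N.
  by rewrite H addn0 fact0 divr1.
elim: n c => [|n IH] c k; first by rewrite add0n divff ?mul1r// pnatr_eq0 -lt0n fact_gt0.
rewrite iterSr IH /pseries_diffs addSn factS natrM.
by rewrite mulrA; congr (_ * _); rewrite mulrC mulrA.
Qed.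

Lemma pscvg_iter n c r : pscvg c r -> pscvg (iter n (@pseries_diffs R) c) r.
Proof. by elim: n => //= n IH /IH; exact: pscvg_diffs. Qed.

Section Expansion.
Variables (f : R -> R) (t r : R) (c : nat -> R).
Hypotheses (cr : pscvg c r) (fE : forall h, `|h| < r -> f (t + h) = psum c h).

Lemma psum_derive1n n h : `|h| < r ->
  derive1n n f (t + h) = psum (iter n (@pseries_diffs R) c) h /\
  is_derive (t + h) 1 (derive1n n f) (psum (iter n.+1 (@pseries_diffs R) c) h).
Proof.
suff H : forall n, (forall h, `|h| < r ->
    derive1n n f (t + h) = psum (iter n (@pseries_diffs R) c) h) ->
  forall h, `|h| < r ->
  is_derive (t + h) 1 (derive1n n f) (psum (iter n.+1 (@pseries_diffs R) c) h).
  have E : forall n h, `|h| < r -> derive1n n f (t + h) = psum (iter n (@pseries_diffs R) c) h.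
    elim=> [|m IH] {}h hr; first by rewrite derive1n0 fE.
    rewrite derive1nS derive1E.
    by have := H m IH _ hr => mD; rewrite derive_val.
  by move=> hr; split; [exact: E|exact: H (E n) _ hr].
move=> m mE {}h hr.
have D := is_derive_psum (pscvg_iter (n := m) cr) hr.
apply: (@near_is_derive _ (fun s => psum (iter m (@pseries_diffs R) c) (- t + s))).
  by apply: is_derive_translate; rewrite addKr.
have : \forall s \near t + h, `|- t + s| < r.
  have e0 : 0 < r - `|h| by rewrite subr_gt0.
  apply: filterS (near_dist (t + h) e0) => s sh.
  have -> : - t + s = h + (s - (t + h)) by ring.
  by rewrite (le_lt_trans (ler_normD _ _))// -ltrBrDl.
by apply: filterS => s /mE; rewrite addNKr => ->.
Qed.
End Expansion.
End PowerSeries.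

(** * Zeros, signs and growth of quotients of power series *)

Section PowerSeriesQuotient.
Context {R : realType}.
Implicit Types (c d q : nat -> R) (h r t : R).

Lemma analytic_psum (f : R -> R) t : analytic_at f t ->
  exists c (r : R), [/\ 0 < r, pscvg c r & forall h, `|h| < r -> f (t + h) = psum c h].
Proof.
move=> [c [r [r0 cE]]]; exists c, r; split=> // h /cE ch.
  by apply/cvg_ex; exists (f (t + h)).
by rewrite /psum; apply/esym; apply: (@cvg_lim R^o).
Qed.

Lemma psum_recl c r : pscvg c r ->
  pscvg (fun n => c n.+1) r /\
  forall h, `|h| < r -> psum c h = c 0%N + h * psum (fun n => c n.+1) h.
Proof.
move=> cr.
have S h n : pseries c h n.+1 = c 0%N + h * pseries (fun n => c n.+1) h n.
  rewrite /pseries/series/= big_nat_recl//= expr0 mulr1; congr (_ + _).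
  rewrite mulr_sumr; apply: eq_bigr => i _; rewrite exprS; ring.
have C h : `|h| < r -> h != 0 -> cvgn (pseries (fun n => c n.+1) h).
  move=> hr h0.
  have -> : pseries (fun n => c n.+1) h = (fun n => h^-1 * (pseries c h n.+1 - c 0%N)).
    by apply/funext => n; rewrite S addrAC subrr add0r mulKf.
  apply: is_cvgM; first exact: is_cvg_cst.
  apply: is_cvgB; last exact: is_cvg_cst.
  by apply/cvg_ex; exists (psum c h); rewrite cvg_shiftS; exact: cr.
have D : pscvg (fun n => c n.+1) r.
  move=> h hr; have [h0|/(C _ hr)//] := eqVneq h 0.
  have r0 : 0 < r by rewrite (le_lt_trans _ hr).
  have e0 : 0 < r / 2 by rewrite divr_gt0.
  apply: (@is_cvg_pseries_inside _ _ (r / 2)).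
    by apply: C; [rewrite gtr0_norm//; lra|rewrite gt_eqF].
  by rewrite h0 normr0 gtr0_norm.
split=> // h hr.
rewrite /psum; apply: (@cvg_lim R^o) => //.
rewrite -cvg_shiftS.
rewrite (_ : [sequence _]_n = (fun n => c 0%N + h * pseries (fun n => c n.+1) h n));
  last by apply/funext => n; exact: S.
by apply: cvgD; [exact: cvg_cst|apply: cvgM; [exact: cvg_cst|exact: D]].
Qed.

Lemma psum_drop c r n : pscvg c r -> (forall i, (i < n)%N -> c i = 0) ->
  pscvg (fun m => c (n + m)%N) r /\
  forall h, `|h| < r -> psum c h = h ^+ n * psum (fun m => c (n + m)%N) h.
Proof.
elim: n c => [|n IH] c cr c0.
  by split=> // h _; rewrite expr0 mul1r.
have [cr' cE] := psum_recl cr.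
have [|cr'' cE'] := IH _ cr'; first by move=> i im; exact: (c0 i.+1).
split=> // h hr; rewrite cE// c0// add0r cE'// exprS mulrA.
by congr (_ * _); congr psum.
Qed.

Lemma psum_factor c r : pscvg c r ->
  (forall h, psum c h = 0) \/
  exists n q, [/\ pscvg q r, q 0%N != 0 &
    forall h, `|h| < r -> psum c h = h ^+ n * psum q h].
Proof.
move=> cr; have [[n cn]|c0] := pselect (exists n, c n != 0); last first.
  left=> h; rewrite /psum; apply: (@cvg_lim R^o) => //.
  apply: cvg_near_cst; exists 0%N => // n _ /=.
  rewrite /pseries/series/= big1// => i _.
  have [->|ci] := eqVneq (c i) 0; first by rewrite mul0r.
  by exfalso; apply: c0; exists i.
have /ex_minnP[m cm mmin] : exists n, c n != 0 by exists n.
right; exists m, (fun k => c (m + k)%N).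
have [|cr' cE] := @psum_drop c r m cr; last by split=> //; rewrite addn0.
by move=> i im; apply/eqP/negPn/negP => /mmin; rewrite leqNgt im.
Qed.

Lemma psum_opp c h : psum c (- h) = psum (fun n => (-1) ^+ n * c n) h.
Proof.
rewrite /psum; congr (lim (_ @ \oo)); apply/funext => n; rewrite /pseries/series/=.
by apply: eq_bigr => i _; rewrite (exprNn h i) mulrCA mulrA.
Qed.

Lemma pscvg_opp c r : pscvg c r -> pscvg (fun n => (-1) ^+ n * c n) r.
Proof.
move=> cr h hr; have : cvgn (pseries c (- h)) by apply: cr; rewrite normrN.
rewrite (_ : pseries c (- h) = pseries (fun n => (-1) ^+ n * c n) h)//; apply/funext => n; rewrite /pseries/series/=.
by apply: eq_bigr => i _; rewrite (exprNn h i) mulrCA mulrA.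
Qed.

Lemma psum_continuous c r h : pscvg c r -> `|h| < r -> {for h, continuous (psum c)}.
Proof.
move=> cr hr; have [D _] := is_derive_psum cr hr.
exact/differentiable_continuous/derivable1_diffP.
Qed.

(** A bound on the logarithmic derivative, stated without logarithms. [C] is a bound of the
    derivative divided by the lower bound [|q 0| / 2] of the sum, and [1 + x <= expR x] makes the
    linear estimate multiplicative. *)
Lemma psum_log_lipschitz q r : 0 < r -> pscvg q r -> q 0%N != 0 ->
  exists e C : R, [/\ 0 < e, e <= r, 0 < C,
    forall h, `|h| < e -> 0 < psum q h / q 0%N &
    forall h h', `|h| < e -> `|h'| < e ->
      `|psum q h'| <= `|psum q h| * expR (C * `|h' - h|)].
Proof.
move=> r0 qr q0.
have h0 : `|0 : R| < r by rewrite normr0.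
have cq := psum_continuous qr h0.
have cdq := psum_continuous (pscvg_diffs qr) h0.
have q0p : 0 < `|q 0%N| by rewrite normr_gt0.
have N1 : \forall h \near (0 : R), `|psum q h - q 0%N| < `|q 0%N| / 2.
  have := cq; rewrite -(psum0 q) => /cvgr_dist_lt /(_ (`|q 0%N| / 2)).
  rewrite divr_gt0// => /(_ isT); apply: filterS => h.
  by rewrite distrC psum0.
have N2 : \forall h \near (0 : R), `|psum (pseries_diffs q) h| < `|psum (pseries_diffs q) 0| + 1.
  have := cdq => /cvgr_dist_lt /(_ 1); rewrite ltr01 => /(_ isT); apply: filterS => h.
  move=> H; rewrite -[X in `|X| < _](subrK (psum (pseries_diffs q) 0)).
  by rewrite (le_lt_trans (ler_normD _ _))// addrC ltrD2l distrC.
have [e1 e10 H1] := near_distP N1.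
have [e2 e20 H2] := near_distP N2.
pose e := Num.min r (Num.min e1 e2).
pose B := `|psum (pseries_diffs q) 0| + 1.
have B0 : 0 < B by rewrite ltr_wpDl.
have eP h : `|h| < e -> [/\ `|h| < r, `|psum q h - q 0%N| < `|q 0%N| / 2 & `|psum (pseries_diffs q) h| < B].
  rewrite !lt_min => /and3P[? ? ?]; split=> //; [apply: H1|apply: H2]; rewrite subr0//.
have lb h : `|h| < e -> `|q 0%N| / 2 <= `|psum q h|.
  move=> /eP[_ H _]; have := ler_normB (psum q h) (psum q h - q 0%N).
  rewrite opprB addrC subrK; lra.
exists e, (B / (`|q 0%N| / 2)); split.
- by rewrite !lt_min r0 e10 e20.
- by rewrite ge_min lexx.
- by rewrite !divr_gt0.
- move=> h /eP[_ + _]; have [qp|qn] := ltrP 0 (q 0%N).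
    rewrite (gtr0_norm qp) ltr_distl => /andP[? ?]; rewrite divr_gt0//; lra.
  have {}qn : q 0%N < 0 by rewrite lt_neqAle q0.
  rewrite (ltr0_norm qn) ltr_distl => /andP[? ?].
  by rewrite -mulrNN -invrN divr_gt0//; lra.
suff H : forall h h', `|h| < e -> `|h'| < e -> h < h' ->
   `|psum q h' - psum q h| <= B * `|h' - h|.
  move=> h h' he he'.
  have {H} H : `|psum q h' - psum q h| <= B * `|h' - h|.
    have [hh|] := ltP h h'; first exact: H.
    rewrite le_eqVlt => /predU1P[->|hh]; first by rewrite !subrr normr0 mulr0.
    by rewrite distrC (distrC h'); apply: H.
  have := expR_ge1Dx (B / (`|q 0%N| / 2) * `|h' - h|).
  move=> /(ler_wpM2l (normr_ge0 (psum q h))); apply: le_trans.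
  rewrite mulrDr mulr1 -lerBlDl.
  apply: le_trans (lerB_dist _ _) _; apply: le_trans H _.
  rewrite mulrA ler_wpM2r// mulrCA ler_peMr ?(ltW B0)//.
  by rewrite ler_pdivlMr ?divr_gt0// mul1r lb.
move=> h h' he he' hh.
have [|c /andP[hc ch'] E] := @is_derive_mvt _ (psum q) (psum (pseries_diffs q)) h h' hh.
  move=> t /andP[ht th']; apply: is_derive_psum qr _.
  have [|//] := eP t.
  move: he he'; rewrite !ltr_norml => /andP[? ?] /andP[? ?]; lra.
rewrite E normrM ler_wpM2r//.
have [|_ _ /ltW//] := eP c.
move: he he'; rewrite !ltr_norml => /andP[? ?] /andP[? ?]; lra.
Qed.

(* On the left of [t], [k] vanishes or has a constant sign and absolute value
   [m * E] with [m] nonincreasing and [E] nondecreasing and bounded: for analytic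
   [k], [E] is exponential and absorbs the variation of the nonvanishing factor. *)
Definition left_tame (k : R -> R) t e :=
  (forall s, t - e < s < t -> k s = 0) \/
  exists sg (m E : R -> R) B, [/\ sg = 1 \/ sg = -1,
    forall s, t - e < s < t -> [/\ sg * k s = m s * E s, 0 < m s, 0 < E s & E s <= B],
    forall s s', t - e < s < t -> t - e < s' < t -> s <= s' -> m s' <= m s &
    forall s s', t - e < s < t -> t - e < s' < t -> s <= s' -> E s <= E s'].

Section Quotient.
Variables (c d : nat -> R) (r t : R) (k : R -> R).
Hypotheses (r0 : 0 < r) (cr : pscvg c r) (dr : pscvg d r) (d0 : d 0%N != 0).
Hypothesis kE : forall h, `|h| < r -> k (t + h) = psum c h / psum d h.

Lemma quotient_dichotomy :
  (\forall s \near t, k s = 0) \/ (\forall s \near t, s != t -> k s != 0).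
Proof.
have [c0|[n [q [qr q0 cE]]]] := psum_factor cr.
  left; apply: filterS (near_dist t r0) => s sr.
  by rewrite -(subrKC t s) kE// c0 mul0r.
right.
have [e1 [C1 [e10 e1r _ qp _]]] := psum_log_lipschitz r0 qr q0.
have [e2 [C2 [e20 e2r _ dp _]]] := psum_log_lipschitz r0 dr d0.
have e0 : 0 < Num.min e1 e2 by rewrite lt_min e10 e20.
apply: filterS (near_dist t e0) => s; rewrite lt_min => /andP[se1 se2] st.
have sr : `|s - t| < r by apply: lt_le_trans e1r.
rewrite -(subrKC t s) kE// cE// !mulf_neq0 ?invr_neq0 ?expf_neq0 ?subr_eq0//.
  by have := qp _ se1; rewrite lt_neqAle eq_sym mulf_eq0 negb_or => /andP[/andP[]].
by have := dp _ se2; rewrite lt_neqAle eq_sym mulf_eq0 negb_or => /andP[/andP[]].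
Qed.

Lemma quotient_left_tame : exists2 e : R, 0 < e & forall e', 0 < e' <= e -> left_tame k t e'.
Proof.
have [c0|[n [q [qr q0 cE]]]] := psum_factor cr.
  exists r => // e' /andP[e'0 e'r]; left=> s /andP[s1 s2].
  rewrite -(subrKC t s) kE ?c0 ?mul0r// ltr_norml; lra.
have [e1 [C1 [e10 e1r C10 qp qL]]] := psum_log_lipschitz r0 qr q0.
have [e2 [C2 [e20 e2r C20 dp dL]]] := psum_log_lipschitz r0 dr d0.
exists (Num.min e1 e2); first by rewrite lt_min e10 e20.
move=> e' /andP[e'0]; rewrite le_min => /andP[e'1 e'2]; right.
(* The sign of [k] on the left of [t]: the power contributes [(-1) ^+ n], and both nonvanishing
   factors keep the sign of their constant term. *)
pose x0 := (-1) ^+ n * q 0%N / d 0%N.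
have x00 : x0 != 0 by rewrite !mulf_neq0 ?invr_neq0 ?signr_eq0.
(* On the left [|s - t| ^+ n] decreases, while numerator and denominator change at logarithmic rates
   at most [C1] and [C2]; dividing [|k|] by this exponential leaves a nonincreasing function. As
   [s < t], [E] stays below 1. *)
pose E s := expR ((C1 + C2) * (s - t)).
exists (Num.sg x0), (fun s => `|k s| / E s), E, 1.
have sP s : t - e' < s < t -> [/\ `|s - t| < r, `|s - t| < e1, `|s - t| < e2 & s - t < 0].
  by move=> /andP[? ?]; split; rewrite ?ltr_norml; lra.
split.
- by move: x00; rewrite neq_lt => /orP[/ltr0_sg->|/gtr0_sg->]; [right|left].
- move=> s sI; have [sr se1 se2 s0] := sP _ sI.
  have kE' : k s = x0 * ((t - s) ^+ n * (psum q (s - t) / q 0%N) / (psum d (s - t) / d 0%N)).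
    rewrite -{1}(subrKC t s) kE// cE// -(opprB t s) exprNn /x0.
    have := dp _ se2; rewrite opprB => /lt0r_neq0; rewrite mulf_eq0 negb_or => /andP[dn _].
    by field; rewrite d0 q0 dn.
  set y := (t - s) ^+ n * _ / _ in kE'.
  have y0 : 0 < y by rewrite divr_gt0 ?dp// mulr_gt0 ?qp// exprn_gt0// subr_gt0 -subr_lt0.
  have sk : Num.sg x0 * k s = `|k s|.
    by rewrite kE' mulrA -normrEsg (normrM x0 y) (gtr0_norm y0).
  have k0 : 0 < `|k s| by rewrite normr_gt0 kE' mulf_neq0// gt_eqF.
  have E0 : 0 < E s by rewrite expR_gt0.
  split=> //; first by rewrite sk divfK// gt_eqF.
    by rewrite divr_gt0.
  by rewrite -expR0 ler_expR pmulr_rle0 ?addr_gt0// ltW.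
- move=> s s' sI sI' ss'.
  have [sr se1 se2 s0] := sP _ sI; have [sr' se1' se2' s0'] := sP _ sI'.
  rewrite ler_pdivrMr ?expR_gt0// mulrAC -mulrA -expRN -expRD.
  have -> : (C1 + C2) * (s' - t) - (C1 + C2) * (s - t) = C1 * (s' - s) + C2 * (s' - s) by ring.
  rewrite expRD -(subrKC t s) -(subrKC t s') !kE// !cE// !normrM !normfV.
  have dn h : `|h| < e2 -> 0 < `|psum d h|.
    move=> /dp /lt0r_neq0; rewrite mulf_eq0 negb_or normr_gt0 => /andP[dn _] //.
  have := qL _ _ se1 se1'; have := dL _ _ se2' se2.
  have -> : s' - t - (s - t) = s' - s by ring.
  have -> : s - t - (s' - t) = - (s' - s) by ring.
  have ss0 : 0 <= s' - s by rewrite subr_ge0.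
  rewrite normrN (ger0_norm ss0).
  have -> : t + (s' - t) - (t + (s - t)) = s' - s by ring.
  set A := `|psum d _|; set A' := `|psum d _|; set Q := `|psum q _|; set Q' := `|psum q _|.
  set X := expR _; set Y := expR _.
  move=> HA HQ.
  have A0 : 0 < A by exact: dn. have A'0 : 0 < A' by exact: dn.
  rewrite ler_pdivrMr// -!mulrA; apply: ler_pM => //; first by rewrite /Q.
    rewrite !normrX lerXn2r ?nnegrE//.
    rewrite (ler0_norm (ltW s0)) (ler0_norm (ltW s0')); lra.
  apply: (le_trans HQ); apply: ler_wpM2l; first by rewrite /Q'.
  rewrite mulrCA ler_peMr ?expR_ge0//.
  by rewrite ler_pdivlMl// mulr1 mulrC.
- move=> s s' _ _ ss'; rewrite ler_expR ler_wpM2l ?lerB//.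
  exact/ltW/addr_gt0.
Qed.

End Quotient.
End PowerSeriesQuotient.

Lemma near_norm {R : numFieldType} {V : normedModType R} (x : V) (e : R) : 0 < e -> \forall y \near x, `|y - x| < e.
Proof.
move=> e0; have := nbhsx_ballx x _ e0; apply: filterS => s.
by rewrite -ball_normE/= distrC.
Qed.

Lemma near_normP {R : numFieldType} {V : normedModType R} (x : V) (P : V -> Prop) : (\forall y \near x, P y) ->
  exists2 e : R, 0 < e & forall y, `|y - x| < e -> P y.
Proof.
move=> /nbhs_ballP[e e0 eP]; exists e => // s se.
by apply: eP; rewrite -ball_normE/= distrC.
Qed.

(** * Plane geometry and exit times *)

Section Plane.
Context {R : realType}.
Implicit Types (x y u v w : plane R).

Lemma dotC u v : dot u v = dot v u. Proof. rewrite /dot; ring. Qed.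
Lemma dotDl u v w : dot (u + v) w = dot u w + dot v w.
Proof. by rewrite /dot/=; ring. Qed.
Lemma dotBl u v w : dot (u - v) w = dot u w - dot v w.
Proof. by rewrite /dot/=; ring. Qed.
Lemma dotNl u w : dot (- u) w = - dot u w.
Proof. by rewrite /dot/=; ring. Qed.
Lemma dotNr u w : dot u (- w) = - dot u w.
Proof. by rewrite /dot/=; ring. Qed.
Lemma dotBr u v w : dot w (u - v) = dot w u - dot w v.
Proof. by rewrite /dot/=; ring. Qed.
Lemma dotZl (k : R) u w : dot (k *: u) w = k * dot u w.
Proof. rewrite /dot/= /GRing.scale/=; ring. Qed.
Lemma dotZr (k : R) u w : dot u (k *: w) = k * dot u w.
Proof. by rewrite dotC dotZl dotC. Qed.
Lemma dot0l u : dot 0 u = 0. Proof. by rewrite /dot/= !mul0r addr0. Qed.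
Lemma dotvv_ge0 u : 0 <= dot u u.
Proof. by rewrite /dot -!expr2 addr_ge0 ?sqr_ge0. Qed.
Lemma dotvv_eq0 u : (dot u u == 0) = (u == 0).
Proof.
case: u => a b; rewrite /dot/= -!expr2 paddr_eq0 ?sqr_ge0// !sqrf_eq0.
by rewrite -[RHS]/((a == 0) && (b == 0)).
Qed.

Lemma enorm_ge0 u : 0 <= enorm u. Proof. exact: sqrtr_ge0. Qed.
Lemma enorm_sqr u : enorm u ^+ 2 = dot u u.
Proof. by rewrite /enorm sqr_sqrtr ?dotvv_ge0. Qed.
Lemma enorm_eq0 u : (enorm u == 0) = (u == 0).
Proof. by rewrite -sqrf_eq0 enorm_sqr dotvv_eq0. Qed.
Lemma enorm0 : enorm (0 : plane R) = 0.
Proof. by apply/eqP; rewrite enorm_eq0. Qed.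
Lemma enorm_eq u v : dot u u = dot v v -> enorm u = enorm v.
Proof. by rewrite /enorm => ->. Qed.
Lemma enormZ (k : R) u : enorm (k *: u) = `|k| * enorm u.
Proof.
by rewrite /enorm dotZl dotZr mulrA -expr2 sqrtrM ?sqr_ge0// sqrtr_sqr.
Qed.
Lemma enormN u : enorm (- u) = enorm u.
Proof. by apply: enorm_eq; rewrite dotNl dotNr opprK. Qed.

Lemma normr_le_enorm u : `|u| <= enorm u.
Proof.
rewrite prod_normE/= ge_max -!sqrtr_sqr; apply/andP.
by split; rewrite ler_wsqrtr// /dot -!expr2 ?lerDl ?lerDr sqr_ge0.
Qed.

Lemma enorm_le_normr u : enorm u <= 2 * `|u|.
Proof.
rewrite -(@ger0_norm _ (2 * `|u|)) ?mulr_ge0// -sqrtr_sqr ler_wsqrtr// /dot.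
have H1 : `|u.1| <= `|u| by rewrite prod_normE/= le_max lexx.
have H2 : `|u.2| <= `|u| by rewrite prod_normE/= le_max lexx orbT.
rewrite -!expr2 -(real_normK (num_real u.1)) -(real_normK (num_real u.2)).
have := normr_ge0 u.1; have := normr_ge0 u.2.
move: (`|u.1|) (`|u.2|) (`|u|) H1 H2 => a b c; nra.
Qed.

Lemma dot_le_enorm u v : `|dot u v| <= enorm u * enorm v.
Proof.
rewrite -(ger0_norm (mulr_ge0 (enorm_ge0 u) (enorm_ge0 v))) -!sqrtr_sqr.
rewrite ler_wsqrtr// exprMn !enorm_sqr /dot.
have := sqr_ge0 (u.1 * v.2 - u.2 * v.1); nra.
Qed.

Lemma fst_continuous : continuous (fst : plane R -> R).
Proof. by move=> x; apply: cvg_fst. Qed.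
Lemma snd_continuous : continuous (snd : plane R -> R).
Proof. by move=> x; apply: cvg_snd. Qed.

Lemma cvg_dot {T : Type} (F : set_system T) {FF : Filter F}
    (f g : T -> plane R) u v : f @ F --> u -> g @ F --> v -> dot (f x) (g x) @[x --> F] --> dot u v.
Proof.
move=> fu gv; apply: cvgD; apply: cvgM.
- exact: (cvg_comp _ _ fu (@fst_continuous u)).
- exact: (cvg_comp _ _ gv (@fst_continuous v)).
- exact: (cvg_comp _ _ fu (@snd_continuous u)).
- exact: (cvg_comp _ _ gv (@snd_continuous v)).
Qed.

Lemma cvg_enorm {T : Type} (F : set_system T) {FF : Filter F}
    (f : T -> plane R) u : f @ F --> u -> enorm (f x) @[x --> F] --> enorm u.
Proof.
move=> fu; exact: (continuous_cvg _ (@sqrt_continuous _ _) (cvg_dot fu fu)).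
Qed.

Lemma cvg_ray {T : Type} (F : set_system T) {FF : Filter F}
    (f : T -> plane R) (s : T -> R) (g : T -> plane R) x (t : R) v :
  f @ F --> x -> s @ F --> t -> g @ F --> v ->
  f z - s z *: g z @[z --> F] --> x - t *: v.
Proof. by move=> fx st gv; apply: cvgB => //; exact: cvgZ. Qed.

Lemma near_plane x (e : R) : 0 < e -> \forall y \near x, `|y - x| < e.
Proof. exact: near_norm. Qed.

Lemma near_planeP x (P : plane R -> Prop) : (\forall y \near x, P y) ->
  exists2 e : R, 0 < e & forall y, `|y - x| < e -> P y.
Proof. exact: near_normP. Qed.

End Plane.

Section Hitting.
Context {R : realType}.
Variable Om : set (plane R).
Hypotheses (oOm : open Om) (bOm : bounded_set Om).
Implicit Types (x v : plane R) (t s : R).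

Let flight x v := [set s | 0 <= s /\ forall tau, 0 < tau < s -> Om (x - tau *: v)].

Lemma flight_sup x v : v != 0 -> has_sup (flight x v).
Proof.
move=> v0; split; first by exists 0; split=> // t /andP[t0 /(lt_trans t0)]; rewrite ltxx.
have [M [Mr MP]] := bOm; have {}MP := MP (`|M| + 1).
have nv : 0 < `|v| by rewrite normr_gt0.
exists ((`|M| + 1 + `|x|) / `|v| * 2) => s [s0 sP].
have M1 : M < `|M| + 1 by rewrite (le_lt_trans (ler_norm _))// ltrDl.
have [|s1] := lerP s 0; first by move=> /le_trans; apply; rewrite mulr_ge0// divr_ge0// !addr_ge0.
have /sP/(MP M1) : 0 < s / 2 < s by rewrite divr_gt0//=; lra.
move=> H; rewrite -ler_pdivrMr// ler_pdivlMr//.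
have -> : s / 2 * `|v| = `|x - (x - (s / 2) *: v)|.
  by rewrite opprB addrC subrK normrZ gtr0_norm// divr_gt0.
by apply: le_trans (ler_normB _ _) _; rewrite addrC lerD2r.
Qed.

Lemma t_b_ge0 x v : v != 0 -> 0 <= t_b Om x v.
Proof.
move=> v0; apply: ub_le_sup; first by have [] := flight_sup x v0.
by split=> // t /andP[t0 /(lt_trans t0)]; rewrite ltxx.
Qed.

Lemma t_b_ge x v s : v != 0 -> 0 <= s ->
  (forall tau, 0 < tau < s -> Om (x - tau *: v)) -> s <= t_b Om x v.
Proof.
by move=> v0 s0 sP; apply: ub_le_sup; first by have [] := flight_sup x v0.
Qed.

Lemma t_b_in x v tau : v != 0 -> 0 < tau < t_b Om x v -> Om (x - tau *: v).
Proof.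
move=> v0 /andP[tau0]; rewrite -subr_gt0 => ttb.
have [s [s0 sP]] := sup_adherent ttb (flight_sup x v0).
by rewrite /t_b subKr => ts; apply: sP; rewrite tau0.
Qed.

Lemma t_b_le x v s : v != 0 -> 0 < s -> ~ Om (x - s *: v) -> t_b Om x v <= s.
Proof.
by move=> v0 s0 H; rewrite leNgt; apply/negP => st; apply: H; apply: t_b_in => //; rewrite s0.
Qed.

Lemma boundaryE x : boundary Om x <-> closure Om x /\ ~ Om x.
Proof. by rewrite /boundary /setD/= (iffLR (interior_id _) oOm). Qed.

Lemma ray_near (x v : plane R) t (P : plane R -> Prop) :
  (\forall y \near x - t *: v, P y) -> \forall s \near t, P (x - s *: v).
Proof.
have : (fun s : R => x - s *: v) @ t --> x - t *: v.
  by apply: cvg_ray; [exact: cvg_cst|exact: cvg_id|exact: cvg_cst].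
by move=> H ?; exact: H.
Qed.

Lemma t_b_boundary x v : closure Om x -> v != 0 -> boundary Om (x - t_b Om x v *: v).
Proof.
move=> clx v0; apply/boundaryE; set t := t_b Om x v.
have t0 : 0 <= t := t_b_ge0 x v0.
split.
  have [te|tn] := eqVneq t 0; first by rewrite te scale0r subr0.
  move=> B /ray_near/near_distP[e e0 eB].
  have tp : 0 < t by rewrite lt_neqAle eq_sym tn.
  pose s := t - Num.min (e / 2) (t / 2).
  have [s1 [s2 s3]] : 0 < s /\ s < t /\ `|s - t| < e.
    have m0 : 0 < Num.min (e / 2) (t / 2) by rewrite lt_min !divr_gt0.
    have m1 : Num.min (e / 2) (t / 2) <= t / 2 by rewrite ge_min lexx orbT.
    have m2 : Num.min (e / 2) (t / 2) <= e / 2 by rewrite ge_min lexx.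
    rewrite /s; move: (Num.min (e / 2) (t / 2)) m0 m1 m2 => m m0 m1 m2.
    split; [lra|split; [lra|]]; rewrite ltr_norml; lra.
  exists (x - s *: v); split; last exact: eB.
  by apply: t_b_in => //; rewrite s1.
move=> Omt; have /ray_near/near_distP[e e0 eB] := open_nbhs_nbhs (conj oOm Omt).
have : t + e / 2 <= t.
  apply: t_b_ge => //; first by rewrite addr_ge0// divr_ge0// ltW.
  move=> tau /andP[tau0 tau1]; have [taut|taut] := ltP tau t.
    by apply: t_b_in => //; rewrite tau0.
  by apply: eB; rewrite ger0_norm ?subr_ge0//; lra.
by rewrite gerDl leNgt divr_gt0.
Qed.

End Hitting.

(** * Analytic curves *)

Section Curve.
Context {R : realType}.
Implicit Types (p T al : R -> plane R) (k : R -> R) (a b t h : R).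

(** The Frenet equations with an orientation sign. Reversing the parameter flips both [sg] and [T],
    hence preserves [frame_normal] and the sign of [k], so that one argument serves both directions
    of travel along an arc. *)
Definition arc_frame p T k (sg lo hi : R) :=
  sg ^+ 2 = 1 /\
  forall t, lo < t < hi ->
    [/\ is_derive t 1 (fun s => (p s).1) (T t).1,
        is_derive t 1 (fun s => (p s).2) (T t).2,
        is_derive t 1 (fun s => (T s).1) (sg * k t * (T t).2),
        is_derive t 1 (fun s => (T s).2) (- (sg * k t * (T t).1))
      & dot (T t) (T t) = 1].

Definition frame_normal (sg : R) T t : plane R := (sg * (T t).2, - (sg * (T t).1)).

Lemma is_derive_reverse (f : R -> R) d t :
  is_derive (- t) 1 f d -> is_derive t 1 (fun s => f (- s)) (- d).
Proof.
move=> fd; have dn : is_derive t 1 (fun s : R => - s) (- 1).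
  exact: is_deriveN (is_derive_id t (1 : R)).
apply: (is_derive_eq (is_derive1_comp (f := f) fd dn)).
by rewrite mulrN1.
Qed.

Lemma arc_frame_reverse p T k sg lo hi : arc_frame p T k sg lo hi ->
  arc_frame (fun s => p (- s)) (fun s => - T (- s)) (fun s => k (- s)) (- sg) (- hi) (- lo).
Proof.
move=> [sg1 H]; split=> [|t /andP[t1 t2]]; first by rewrite sqrrN.
have [|p1 p2 T1 T2 TT] := H (- t); first by rewrite ltrNr t2/= ltrNl.
split; rewrite /=.
- exact: is_derive_reverse p1.
- exact: is_derive_reverse p2.
- apply: (is_derive_eq (is_deriveN (is_derive_reverse T1))).
  by rewrite /=; ring.
- apply: (is_derive_eq (is_deriveN (is_derive_reverse T2))); ring.
- by rewrite dotNl dotNr opprK.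
Qed.

Lemma nderiv0 al t : nderiv 0 al t = al t.
Proof. by rewrite /nderiv !derive1n0; case: (al t). Qed.

Lemma pscvg_le c (r r' : R) : r' <= r -> pscvg c r -> pscvg c r'.
Proof. by move=> rr cr h hr; apply: cr; rewrite (lt_le_trans hr). Qed.

(** The derivatives at the two ends determine the two power series, so these have the same
    coefficients. *)
Lemma periodic_coordinate (f : R -> R) a b :
  analytic_at f a -> analytic_at f b ->
  (forall n, derive1n n f a = derive1n n f b) ->
  exists2 e : R, 0 < e & forall n h, `|h| < e -> derive1n n f (a + h) = derive1n n f (b + h).
Proof.
move=> /analytic_psum[c [r [r0 cr cE]]] /analytic_psum[d [s [s0 ds dE]]] ab.
exists (Num.min r s); first by rewrite lt_min r0.
have cd : c = d.
  apply/funext => n.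
  have [] := @psum_derive1n _ f a r c cr cE n 0; first by rewrite normr0.
  have [] := @psum_derive1n _ f b s d ds dE n 0; first by rewrite normr0.
  rewrite !addr0 ab !psum0 !iter_pseries_diffs0 => -> _ /mulfI + _.
  by move=> ->//; rewrite pnatr_eq0 -lt0n fact_gt0.
move=> n h; rewrite lt_min => /andP[hr hs].
have [-> _] := @psum_derive1n _ f a r c cr cE n h hr.
have [-> _] := @psum_derive1n _ f b s d ds dE n h hs.
by rewrite cd.
Qed.

(** Turns the parameter endpoints into ordinary points of the curve: a parameter slightly outside
    [[a, b]] is shifted by [b - a] back inside. *)
Lemma closed_curve_extension a b al t0 : closed_regular_analytic_curve a b al ->
  a <= t0 <= b ->
  exists2 e : R, 0 < e & forall t, `|t - t0| < e ->
    exists2 t', a <= t' <= b & forall n, nderiv n al t = nderiv n al t'.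
Proof.
move=> [ab ana per _] /andP[at0 t0b].
have [||n|e1 e10 H1] := @periodic_coordinate (fun s => (al s).1) a b.
- by have [] := ana a _; rewrite // lexx ltW.
- by have [] := ana b _; rewrite // lexx ltW.
- by have [] := per n.
have [||n|e2 e20 H2] := @periodic_coordinate (fun s => (al s).2) a b.
- by have [] := ana a _; rewrite // lexx ltW.
- by have [] := ana b _; rewrite // lexx ltW.
- by have [] := per n.
pose e := Num.min (b - a) (Num.min e1 e2).
have e0 : 0 < e by rewrite !lt_min subr_gt0 ab e10 e20.
have H n h : `|h| < e -> nderiv n al (a + h) = nderiv n al (b + h).
  by rewrite !lt_min => /and3P[_ h1 h2]; rewrite /nderiv H1// H2.
have eba : e <= b - a by rewrite ge_min lexx.
exists e => // t; rewrite ltr_distl => /andP[t1 t2].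
have [ta|ta] := ltP t a.
  exists (t + (b - a)); first by lra.
  move=> n; have -> : t = a + (t - a) by ring.
  rewrite H; first by congr nderiv; ring.
  rewrite ltr_norml; lra.
have [tb|tb] := ltP b t.
  exists (t - (b - a)); first by lra.
  move=> n; have {1}-> : t = b + (t - b) by ring.
  rewrite -H; first by congr nderiv; ring.
  rewrite ltr_norml; lra.
by exists t => //; rewrite ta.
Qed.

Lemma curvatureE al t : curvature al t =
  (nderiv 2 al t).1 * (nderiv 1 al t).2 - (nderiv 2 al t).2 * (nderiv 1 al t).1.
Proof.
rewrite /curvature /right_normal /dot.
by move: (nderiv 2 al t) (nderiv 1 al t) => x y; rewrite mulrN.
Qed.

Lemma unit_orthogonal (u v : R -> R) du dv t :
  is_derive t 1 u du -> is_derive t 1 v dv ->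
  (\forall s \near t, u s * u s + v s * v s = 1) -> u t * du + v t * dv = 0.
Proof.
move=> ud vd uv1.
have D := is_deriveD (is_deriveM ud ud) (is_deriveM vd vd).
have D0 : is_derive t 1 (u * u + v * v) 0.
  by apply: near_is_derive (is_derive_cst (1 : R) _ _) _; apply: filterS uv1 => s E; exact: esym.
have := @derive_val _ _ _ _ _ _ _ D; rewrite (@derive_val _ _ _ _ _ _ _ D0).
rewrite /GRing.scale/=; lra.
Qed.

Lemma frenet (x y u v : R) : x * x + y * y = 1 -> x * u + y * v = 0 ->
  u = (u * y - v * x) * y /\ v = - ((u * y - v * x) * x).
Proof.
move=> U O; split.
  transitivity (u * (x * x + y * y)); first by rewrite U mulr1.
  transitivity (x * (x * u + y * v) + (u * y - v * x) * y); first by ring.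
  by rewrite O mulr0 add0r.
transitivity (v * (x * x + y * y)); first by rewrite U mulr1.
transitivity (y * (x * u + y * v) - (u * y - v * x) * x); first by ring.
by rewrite O mulr0 sub0r.
Qed.

Lemma pseries_oppE (c : nat -> R) h : pseries (fun n => - c n) h = - pseries c h.
Proof.
apply/funext => n; rewrite /pseries/series/= -[RHS]/(- (\sum_(0 <= k < n) c k * h ^+ k)) -sumrN.
by apply: eq_bigr => i _; rewrite mulNr.
Qed.

Section UnitSpeed.
Variables (a b : R) (al : R -> plane R).
Hypothesis Hc : closed_regular_analytic_curve a b al.
Hypothesis unit_speed : forall t, a <= t <= b -> enorm (nderiv 1 al t) = 1.

Lemma curve_expansion t0 : a <= t0 <= b ->
  exists c d (r : R), [/\ 0 < r, pscvg c r, pscvg d r &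
    forall h, `|h| < r -> forall n,
     [/\ nderiv n al (t0 + h) = (psum (iter n (@pseries_diffs R) c) h, psum (iter n (@pseries_diffs R) d) h),
      is_derive (t0 + h) 1 (derive1n n (fun s => (al s).1)) (nderiv n.+1 al (t0 + h)).1,
      is_derive (t0 + h) 1 (derive1n n (fun s => (al s).2)) (nderiv n.+1 al (t0 + h)).2 &
      dot (nderiv 1 al (t0 + h)) (nderiv 1 al (t0 + h)) = 1]].
Proof.
move=> t0ab; have [ab ana _ _] := Hc.
have [/analytic_psum[c [r1 [r10 cr cE]]] /analytic_psum[d [r2 [r20 dr dE]]]] := ana _ t0ab.
have [e e0 eP] := closed_curve_extension Hc t0ab.
exists c, d, (Num.min e (Num.min r1 r2)); split.
- by rewrite !lt_min e0 r10.
- by apply: pscvg_le cr; rewrite !ge_min lexx orbT.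
- by apply: pscvg_le dr; rewrite !ge_min lexx !orbT.
move=> h; rewrite !lt_min => /and3P[he h1 h2] n.
have [A1 A2] := psum_derive1n (f := fun s => (al s).1) cr cE n h1.
have [B1 B2] := psum_derive1n (f := fun s => (al s).2) dr dE n h2.
have [A3 _] := psum_derive1n (f := fun s => (al s).1) cr cE n.+1 h1.
have [B3 _] := psum_derive1n (f := fun s => (al s).2) dr dE n.+1 h2.
split; first by rewrite /nderiv A1 B1.
- by move: A2; rewrite -A3.
- by move: B2; rewrite -B3.
have [|t' t'ab ->] := eP (t0 + h); first by rewrite addrAC subrr add0r.
by rewrite -enorm_sqr unit_speed// expr1n.
Qed.

Lemma curvature_cvg t0 : a <= t0 <= b -> {for t0, continuous (curvature al)}.
Proof.
move=> /curve_expansion[c [d [r [r0 _ _ H]]]].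
have C n : {for t0, continuous (derive1n n (fun s => (al s).1))} /\
           {for t0, continuous (derive1n n (fun s => (al s).2))}.
  have [|_ [D1 _] [D2 _] _] := H 0 _ n; first by rewrite normr0.
  rewrite addr0 in D1 D2.
  by split; apply/differentiable_continuous/derivable1_diffP.
have [[C11 C12] [C21 C22]] := (C 1%N, C 2%N).
have -> : curvature al = (fun t => (nderiv 2 al t).1 * (nderiv 1 al t).2 -
    (nderiv 2 al t).2 * (nderiv 1 al t).1).
  by apply/funext => t; exact: curvatureE.
exact: (cvgB (cvgM C21 C12) (cvgM C22 C11)).
Qed.

Lemma curve_frenet t0 : a <= t0 <= b -> exists c d (r : R),
  [/\ 0 < r, pscvg c r, pscvg d r,
    arc_frame al (nderiv 1 al) (curvature al) 1 (t0 - r) (t0 + r) &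
    forall h, `|h| < r ->
      [/\ nderiv 1 al (t0 + h) = (psum (pseries_diffs c) h, psum (pseries_diffs d) h),
        psum (iter 2 (@pseries_diffs R) c) h = curvature al (t0 + h) * psum (pseries_diffs d) h &
        psum (iter 2 (@pseries_diffs R) d) h = - (curvature al (t0 + h) * psum (pseries_diffs c) h)]].
Proof.
move=> t0ab; have [c [d [r [r0 cr dr H]]]] := curve_expansion t0ab.
have F h : `|h| < r ->
  [/\ (nderiv 2 al (t0 + h)).1 = curvature al (t0 + h) * (nderiv 1 al (t0 + h)).2 &
   (nderiv 2 al (t0 + h)).2 = - (curvature al (t0 + h) * (nderiv 1 al (t0 + h)).1)].
  move=> hr; have [_ D1 D2 U] := H _ hr 1%N.
  have O : (nderiv 1 al (t0 + h)).1 * (nderiv 2 al (t0 + h)).1 +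
           (nderiv 1 al (t0 + h)).2 * (nderiv 2 al (t0 + h)).2 = 0.
    apply: (unit_orthogonal D1 D2).
    have e0 : 0 < r - `|h| by rewrite subr_gt0.
    apply: filterS (near_dist (t0 + h) e0) => s sh.
    have [|_ _ _ <-] := H (s - t0) _ 0%N; last by rewrite subrKC.
    have -> : s - t0 = h + (s - (t0 + h)) by ring.
    by rewrite (le_lt_trans (ler_normD _ _))// -ltrBrDl.
  by rewrite curvatureE; exact: frenet U O.
exists c, d, r; split; [exact: r0|exact: cr|exact: dr| |].
  split=> [|t tI]; first by rewrite expr1n.
  have tr : `|t - t0| < r by rewrite ltr_distl; lra.
  have [_ p1 p2 _] := H _ tr 0%N; have [_ T1 T2 U] := H _ tr 1%N.
  have [F1 F2] := F _ tr.
  rewrite subrKC in p1 p2 T1 T2 U F1 F2.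
  split; [exact: p1|exact: p2|rewrite mul1r -F1; exact: T1|rewrite mul1r -F2; exact: T2|exact: U].
move=> h hr; have [F1 F2] := F _ hr.
have [E2 _ _ _] := H h hr 2%N; have [E1 _ _ _] := H h hr 1%N.
by rewrite E1 E2 in F1 F2; split; [exact: E1|exact: F1|exact: F2].
Qed.

(* Where [y'] vanishes, the equation [x'' = kappa y'] is replaced by
   [y'' = - kappa x']. *)
Lemma curvature_quotient t0 : a <= t0 <= b -> exists c d (r : R),
  [/\ 0 < r, pscvg c r, pscvg d r, d 0%N != 0 &
    forall h, `|h| < r -> curvature al (t0 + h) = psum c h / psum d h].
Proof.
move=> t0ab; have [c [d [r [r0 cr dr [_ FU] H]]]] := curve_frenet t0ab.
have h0 : `|0 : R| < r by rewrite normr0.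
have [|_ _ _ _ U0] := FU t0; first by rewrite ltrBlDr ltrDl r0.
have [E0 _ _] := H 0 h0; rewrite addr0 in E0.
have Q c1 d1 : pscvg c1 r -> pscvg d1 r -> d1 0%N != 0 ->
    (forall h, `|h| < r -> psum c1 h = curvature al (t0 + h) * psum d1 h) ->
  exists c d (r : R), [/\ 0 < r, pscvg c r, pscvg d r, d 0%N != 0 &
    forall h, `|h| < r -> curvature al (t0 + h) = psum c h / psum d h].
  move=> c1r d1r d10 kE.
  have [e [C [e0 er C0 dp _]]] := psum_log_lipschitz r0 d1r d10.
  exists c1, d1, e; split; [exact: e0|exact: pscvg_le er c1r|exact: pscvg_le er d1r|exact: d10|].
  move=> h he; rewrite kE ?(lt_le_trans he)// mulfK//.
  by apply/eqP => z; have := dp _ he; rewrite z mul0r ltxx.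
have [d0|d0] := eqVneq (pseries_diffs d 0%N) 0; last first.
  apply: (Q (iter 2 (@pseries_diffs R) c) (pseries_diffs d)) => //.
  - exact: (pscvg_iter (n := 2)).
  - exact: pscvg_diffs.
  by move=> h /H[].
have c0 : - pseries_diffs c 0%N != 0.
  rewrite oppr_eq0; apply/eqP => c0; move: U0; rewrite E0 /dot/= !psum0 c0 d0 !mulr0 addr0.
  by move=> /eqP; rewrite eq_sym oner_eq0.
apply: (Q (iter 2 (@pseries_diffs R) d) (fun n => - pseries_diffs c n)) => //.
- exact: (pscvg_iter (n := 2)).
- by move=> h hr; rewrite pseries_oppE; apply: is_cvgN; exact: pscvg_diffs hr.
move=> h hr; have [_ _ ->] := H h hr.
rewrite /psum pseries_oppE limN ?mulrN//.
exact: pscvg_diffs hr.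
Qed.

Lemma unit_speed_frame t0 : a <= t0 <= b -> exists2 e : R, 0 < e &
  forall e', 0 < e' <= e ->
  [/\ arc_frame al (nderiv 1 al) (curvature al) 1 (t0 - e') (t0 + e'),
      left_tame (curvature al) t0 e'
    & left_tame (fun s => curvature al (- s)) (- t0) e'].
Proof.
move=> t0ab; have [_ [_ [r [r0 _ _ [_ F] _]]]] := curve_frenet t0ab.
have [c [d [e [e0 ce de d0 kE]]]] := curvature_quotient t0ab.
have [e1 e10 H1] := quotient_left_tame e0 ce de d0 kE.
have [||e2 e20 H2] := @quotient_left_tame _ _ _ _ (- t0) (fun s => curvature al (- s)) e0 (pscvg_opp ce) (pscvg_opp de).
- by rewrite expr0 mul1r.
- by move=> h he; rewrite opprD opprK kE ?normrN// !psum_opp.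
exists (Num.min r (Num.min e1 e2)); first by rewrite !lt_min r0 e10.
move=> e' /andP[e'0]; rewrite !le_min => /and3P[e'r e'1 e'2]; split.
- split=> [|t tI]; first by rewrite expr1n.
  have /andP[t1 t2] := tI; apply: F.
  by rewrite (le_lt_trans _ t1) ?(lt_le_trans t2)// ?lerD2l ?lerN2.
- by apply: H1; rewrite e'0.
- by apply: H2; rewrite e'0.
Qed.

Lemma curvature_dichotomy t0 : a <= t0 <= b ->
  (\forall s \near t0, curvature al s = 0) \/ (\forall s \near t0, s != t0 -> curvature al s != 0).
Proof.
move=> /curvature_quotient[c [d [r [r0 cr dr d0 kE]]]].
exact: (quotient_dichotomy r0 cr dr d0 kE).
Qed.

(* Zero curvature near one point propagates by connectedness, and a closed curve is not a segment. *)
Lemma curvature_not_flat t0 : a <= t0 <= b ->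
  \forall s \near t0, s != t0 -> curvature al s != 0.
Proof.
move=> t0ab; have [|//] := curvature_dichotomy t0ab => flat; exfalso.
have [ab _ per _] := Hc.
pose I : set R := `[a, b]%classic.
pose B : set R := [set t | I t /\ \forall s \near t, curvature al s = 0].
have BI : B = I.
  apply: (@segment_connected R a b).
  - by exists t0; split=> //; rewrite /I/= in_itv.
  - exists (interior [set t | curvature al t = 0]); first exact: open_interior.
    by apply/seteqP; split=> t [].
  exists (closure B); first exact: closed_closure.
  apply/seteqP; split=> t /=.
    by move=> Bt; split; [case: Bt|exact: subset_closure].
  move=> [tI clt]; split=> //; have [|//|nz] := @curvature_dichotomy t; first by rewrite /I/= in_itv in tI.
  have [e e0 eP] := near_distP nz.
  have [s [[sI ks] st]] := clt _ (near_dist t e0).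
  have [d d0 dP] := near_distP ks.
  have e'0 : 0 < e - `|s - t| by rewrite subr_gt0.
  have [h h0 [hd he]] := pos_lt2 d0 e'0.
  have [s' [s't s's s'e]] : exists s', [/\ s' != t, curvature al s' = 0 & `|s' - t| < e].
    have [E|E] := eqVneq (s + h) t.
      exists s; split; [|by apply: dP; rewrite subrr normr0|exact: st].
      by rewrite -E eq_sym -subr_eq0 addrAC subrr add0r gt_eqF.
    exists (s + h); split=> //; first by apply: dP; rewrite addrAC subrr add0r gtr0_norm.
    by rewrite addrAC (le_lt_trans (ler_normD _ _))// (gtr0_norm h0) -ltrBrDl.
  by have := eP _ s'e s't; rewrite s's eqxx.
have k0 t : a <= t <= b -> curvature al t = 0.
  by move=> tI; have : B t by [rewrite BI /I/= in_itv]; case=> _ /nbhs_singleton.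
have D t : a <= t <= b -> [/\ is_derive t 1 (fun s => (al s).1) (nderiv 1 al t).1,
    is_derive t 1 (fun s => (al s).2) (nderiv 1 al t).2,
    is_derive t 1 (fun s => (nderiv 1 al s).1) 0 & is_derive t 1 (fun s => (nderiv 1 al s).2) 0].
  move=> tI; have [_ [_ [r [r0 _ _ [_ F] _]]]] := curve_frenet tI.
  have [|D1 D2 D3 D4 _] := F t; first by rewrite ltrBlDr ltrDl r0.
  by split=> //; [apply: (is_derive_eq D3)|apply: (is_derive_eq D4)]; rewrite k0// mulr0 mul0r ?oppr0.
have const (f : R -> R) : (forall t, a <= t <= b -> is_derive t 1 f 0) -> forall t, a <= t <= b -> f t = f a.
  move=> fD t /andP[]; rewrite le_eqVlt => /predU1P[->//|at_ tb].
  have [|c _] := @is_derive_mvt _ f (fun=> 0) a t at_.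
    by move=> s /andP[s1 s2]; apply: fD; rewrite s1 (le_trans s2).
  by rewrite mul0r => /eqP; rewrite subr_eq0 => /eqP.
have T1 := const _ (fun t tI => let: And4 _ _ D3 _ := D t tI in D3).
have T2 := const _ (fun t tI => let: And4 _ _ _ D4 := D t tI in D4).
have aI : a <= a <= b by rewrite lexx ltW.
(* Zero curvature makes the unit tangent constant, but the closing of the curve forces each constant
   component to vanish by the mean value theorem. *)
have zero (f g : R -> R) : f a = f b -> (forall t, a <= t <= b -> is_derive t 1 f (g t)) ->
    (forall t, a <= t <= b -> g t = g a) -> g a = 0.
  move=> fab fD gE; have [c /andP[c1 c2]] := is_derive_mvt ab fD.
  rewrite fab subrr gE ?(ltW c1) ?(ltW c2)// => /esym/eqP.
  by rewrite mulf_eq0 => /orP[/eqP//|]; rewrite subr_eq0 gt_eqF.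
have alE : al a = al b by have := per 0; rewrite !nderiv0.
have z1 := zero (fun s => (al s).1) (fun s => (nderiv 1 al s).1) (congr1 fst alE) (fun t tI => let: And4 D1 _ _ _ := D t tI in D1) T1.
have z2 := zero (fun s => (al s).2) (fun s => (nderiv 1 al s).2) (congr1 snd alE) (fun t tI => let: And4 _ D2 _ _ := D t tI in D2) T2.
have := unit_speed aI => /eqP; rewrite /enorm /dot z1 z2 !mul0r addr0 sqrtr0.
by rewrite eq_sym oner_eq0.
Qed.

Lemma finite_curvature_zeros : exists s : seq R, forall t, a <= t <= b -> curvature al t = 0 -> t \in s.
Proof.
have := @segment_compact R a b; rewrite compact_cover => cc.
pose U t := interior [set s | s != t -> curvature al s != 0].
have [||s _ sP] := cc R `[a, b]%classic U.
- by move=> t _; exact: open_interior.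
- move=> t; rewrite /= in_itv/= => tI; exists t; first by rewrite /= in_itv.
  exact: curvature_not_flat.
exists (finmap.enum_fset s) => t tI kt; have [|u us /interior_subset Ut] := sP t; first by rewrite /= in_itv.
have [->|/Ut] := eqVneq t u; first exact: us.
by rewrite kt eqxx.
Qed.

End UnitSpeed.
End Curve.

(** * The boundary near one of its points *)

Section Normals.
Context {R : realType}.
Implicit Types (x y u v z nu : plane R).

(** The direction [nu' - nu] would enter the domain according to [nu] and leave its closure
    according to [nu']. *)
Lemma outward_normal_uniq (Om : set (plane R)) x nu nu' :
  is_outward_unit_normal Om x nu -> is_outward_unit_normal Om x nu' -> nu = nu'.
Proof.
move=> [nu1 H] [nu'1 H']; apply/eqP; rewrite -subr_eq0 -dotvv_eq0.
apply/negPn/negP => D0.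
have n1 : dot nu nu = 1 by rewrite -enorm_sqr nu1 expr1n.
have n1' : dot nu' nu' = 1 by rewrite -enorm_sqr nu'1 expr1n.
have D : 0 < 1 - dot nu nu'.
  have : 0 < dot (nu - nu') (nu - nu') by rewrite lt_neqAle eq_sym D0 dotvv_ge0.
  rewrite dotBl !dotBr n1 n1' (dotC nu' nu); lra.
have A : dot (nu' - nu) nu < 0 by rewrite dotBl n1 dotC; lra.
have B : 0 < dot (nu' - nu) nu' by rewrite dotBl n1'; lra.
have [d d0 dP] := (H _).1 A; have [d' d'0 d'P] := (H' _).2 B.
have [s s0 [sd sd']] := pos_lt2 d0 d'0.
apply: (d'P s); first by rewrite s0.
by apply: subset_closure; apply: dP; rewrite s0.
Qed.

Lemma normalE (Om : set (plane R)) x nu : is_outward_unit_normal Om x nu -> normal Om x = nu.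
Proof.
move=> H; apply: (@outward_normal_uniq Om x) => //.
exact: (@xgetPex _ 0 [set nu | is_outward_unit_normal Om x nu] (ex_intro _ nu H)).
Qed.

Lemma plane_eq u v : u.1 = v.1 -> u.2 = v.2 -> u = v.
Proof. by case: u v => ? ? [? ?] /= -> ->. Qed.

Lemma cvg_plane {T : Type} (F : set_system T) {FF : Filter F} (f : T -> plane R) u :
  (f z).1 @[z --> F] --> u.1 -> (f z).2 @[z --> F] --> u.2 -> f @ F --> u.
Proof.
move=> /cvgr_dist_lt f1 /cvgr_dist_lt f2; apply/cvgrPdist_lt => e e0.
near=> z; rewrite prod_normE/= gt_max; apply/andP; split.
  by near: z; exact: f1.
by near: z; exact: f2.
Unshelve. all: by end_near. Qed.

Lemma scale_fst (k : R) u : (k *: u).1 = k * u.1. Proof. by []. Qed.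
Lemma scale_snd (k : R) u : (k *: u).2 = k * u.2. Proof. by []. Qed.

Lemma ray_close (p q u0 u : plane R) (rho d s : R) : 0 < rho -> 0 < d ->
  `|q - p| < rho / 2 -> `|u - u0| < d -> 0 <= s -> s < rho / 2 / (`|u0| + d) ->
  `|q + s *: u - p| < rho.
Proof.
move=> rho0 d0 qp ud s0 sr.
have nd : 0 < `|u0| + d by rewrite ltr_wpDl.
have nu : `|u| <= `|u0| + d.
  by rewrite -(subrK u0 u) addrC (le_trans (ler_normD _ _))// lerD2l ltW.
rewrite addrAC (le_lt_trans (ler_normD _ _))// normrZ (ger0_norm s0) (splitr rho) ltr_leD//.
apply: le_trans (ler_wpM2l s0 nu) _.
by rewrite -ler_pdivlMr// ltW.
Qed.

Lemma frame_decomposition (T v : plane R) (nu := (T.2, - T.1)) :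
  dot T T = 1 -> v = dot v T *: T + dot v nu *: nu.
Proof.
case: T v @nu => [x y] [z w]; rewrite /dot/= => U.
apply: plane_eq.
  transitivity (z * (x * x + y * y)); first by rewrite U mulr1.
  by transitivity ((z * x + w * y) * x + (z * y + w * - x) * y); first by ring.
transitivity (w * (x * x + y * y)); first by rewrite U mulr1.
by transitivity ((z * x + w * y) * y + (z * y + w * - x) * - x); first by ring.
Qed.

End Normals.

Section DomainGeometry.
Context {R : realType} (M : nat).
Variables (Om : set (plane R)) (Omi : 'I_M.+1 -> set (plane R)).
Variables (a b : 'I_M.+1 -> R) (al : 'I_M.+1 -> R -> plane R).
Hypothesis HOm : analytic_nonconvex_domain Om Omi.
Hypothesis Hal : arclength_boundary Om Omi a b al.
Implicit Types (x y u v z q p nu : plane R) (i : 'I_M.+1) (t s : R).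

Lemma open_domain : open Om.
Proof. by have [[]] := HOm. Qed.

Lemma bounded_domain : bounded_set Om.
Proof. by have [[]] := HOm. Qed.

Let oOm := open_domain.
Let bOm := bounded_domain.

Lemma boundaryP y : boundary Om y <-> exists i t, a i <= t <= b i /\ y = al i t.
Proof.
have [_ _ _ _ ->] := HOm; split.
  move=> [i _]; have [_ -> _ _] := Hal i => -[t]; rewrite /= in_itv/= => tI <-.
  by exists i, t.
move=> [i [t [tI ->]]]; exists i => //; have [_ -> _ _] := Hal i.
by exists t => //=; rewrite in_itv.
Qed.

Lemma normal_arc i t : a i <= t <= b i -> normal Om (al i t) = right_normal (al i) t.
Proof. by move=> tI; apply: normalE; have [_ _ _] := Hal i; apply. Qed.

Lemma normal_spec y : boundary Om y -> is_outward_unit_normal Om y (normal Om y).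
Proof.
move=> /boundaryP[i [t [tI ->]]]; rewrite normal_arc//.
by have [_ _ _] := Hal i; apply.
Qed.

Lemma normal_unit y : boundary Om y -> dot (normal Om y) (normal Om y) = 1.
Proof. by move=> /normal_spec[e _]; rewrite -enorm_sqr e expr1n. Qed.

Lemma normal_in y u : boundary Om y -> dot u (normal Om y) < 0 ->
  exists2 d : R, 0 < d & forall s, 0 < s < d -> Om (y + s *: u).
Proof. by move=> /normal_spec[_ /(_ u)[+ _]]; apply. Qed.

Lemma normal_out y u : boundary Om y -> 0 < dot u (normal Om y) ->
  exists2 d : R, 0 < d & forall s, 0 < s < d -> ~ closure Om (y + s *: u).
Proof. by move=> /normal_spec[_ /(_ u)[_ +]]; apply. Qed.

Lemma boundary_closure y : boundary Om y -> closure Om y.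
Proof. by case. Qed.

Lemma local_frame i t0 : a i <= t0 <= b i -> exists2 e : R, 0 < e &
  forall e', 0 < e' <= e ->
  [/\ arc_frame (al i) (nderiv 1 (al i)) (curvature (al i)) 1 (t0 - e') (t0 + e'),
      left_tame (curvature (al i)) t0 e',
      left_tame (fun s => curvature (al i) (- s)) (- t0) e'
    & forall t, t0 - e' < t < t0 + e' ->
        [/\ boundary Om (al i t), normal Om (al i t) = right_normal (al i) t &
         exists2 t', a i <= t' <= b i &
           al i t = al i t' /\ curvature (al i) t = curvature (al i) t']].
Proof.
move=> tI; have [C _ S N] := Hal i.
have [e1 e10 H1] := unit_speed_frame C S tI.
have [e2 e20 H2] := closed_curve_extension C tI.
exists (Num.min e1 e2); first by rewrite lt_min e10.
move=> e' /andP[e'0]; rewrite le_min => /andP[e'1 e'2].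
have [|F L1 L2] := H1 e'; first by rewrite e'0.
split=> // t te; have [|t' t'I E] := H2 t; first by rewrite ltr_distl; lra.
have E0 := E 0; rewrite !nderiv0 in E0.
split; [|by rewrite E0 /right_normal E; exact: normal_arc|].
  by apply/boundaryP; exists i, t'.
by exists t' => //; split=> //; rewrite !curvatureE !E.
Qed.

Lemma arc_continuous i t0 : a i <= t0 <= b i -> {for t0, continuous (al i)} /\
  {for t0, continuous (nderiv 1 (al i))}.
Proof.
move=> /local_frame[e e0 /(_ e)]; rewrite e0 lexx => /(_ isT)[[_ F] _ _ _].
have [|D1 D2 D3 D4 _] := F t0; first by lra.
have C (f : R -> R) d : is_derive t0 1 f d -> {for t0, continuous f}.
  by move=> [D _]; exact/differentiable_continuous/derivable1_diffP.
by split; apply: cvg_plane; apply: C.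
Qed.

(** Nearby boundary points need not have nearby parameters, so all parameters are examined: those of
    [p] itself by continuity of the normal, the others because their points stay away from [p].
    Compactness of the parameter intervals makes the neighbourhood uniform. *)
Lemma normal_cvg p : boundary Om p -> normal Om @ within (boundary Om) (nbhs p) --> normal Om p.
Proof.
move=> bp; apply/cvgrPdist_lt => /= e e0.
suff : \forall y \near p, forall i, `[a i, b i]%classic `<=`
    (fun t => al i t = y -> `|normal Om p - right_normal (al i) t| < e).
  rewrite near_withinE; apply: filterS => y Hy /boundaryP[i [t [tI E]]].
  by rewrite E normal_arc//; apply: (Hy i) => //=; rewrite in_itv.
apply: (@filter_forall _ _ (fun i y => `[a i, b i]%classic `<=`
    (fun t => al i t = y -> `|normal Om p - right_normal (al i) t| < e)) (nbhs p) _) => i.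
have := @segment_compact _ (a i) (b i) => /compact_near_coveringP; apply => t /=.
rewrite in_itv/= => tI; have [C1 C2] := arc_continuous tI.
have C3 : {for t, continuous (right_normal (al i))}.
  apply: cvg_plane; first exact: (cvg_comp _ _ C2 (@snd_continuous _ _)).
  by apply: cvgN; exact: (cvg_comp _ _ C2 (@fst_continuous _ _)).
have [E|E] := eqVneq (al i t) p.
  have : \forall t' \near t & y \near p, `|normal Om p - right_normal (al i) t'| < e.
    have : \forall t' \near t, `|normal Om p - right_normal (al i) t'| < e.
      rewrite -E normal_arc//; exact: (cvgr_dist_lt _ _ C3 _ e0).
    by move=> H; exists ([set t' | `|normal Om p - right_normal (al i) t'| < e], setT); [split; [exact: H|exact: filterT]|by move=> [t' y] []].
  by apply: filterS => -[t' y] /=.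
have d0 : 0 < `|al i t - p| / 2 by rewrite divr_gt0// normr_gt0 subr_eq0.
exists ([set t' | `|al i t - al i t'| < `|al i t - p| / 2], [set y | `|y - p| < `|al i t - p| / 2]).
  by split; [exact: (cvgr_dist_lt _ _ C1 _ d0)|exact: near_plane].
move=> [t' y] /= [H1 H2] E'; exfalso.
have := ler_distD (al i t') (al i t) p; rewrite E' in H1 *; lra.
Qed.

Lemma near_normal_dot p u : boundary Om p -> forall e : R, 0 < e ->
  \forall z \near (p, u), boundary Om z.1 -> `|dot z.2 (normal Om z.1) - dot u (normal Om p)| < e.
Proof.
move=> bp e e0.
have N := normal_cvg bp.
pose F := filter_prod (within (boundary Om) (nbhs p)) (nbhs u).
have c1 : (fun z : plane R * plane R => normal Om z.1) @ F --> normal Om p.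
  exact: (cvg_comp _ _ (@cvg_fst _ _ _ _ _) N).
have c2 : (fun z : plane R * plane R => z.2) @ F --> u by exact: cvg_snd.
have := cvgr_distC_lt _ _ (cvg_dot c2 c1) _ e0.
case=> -[A B] /= [A1 B1] AB; exists ([set z | boundary Om z -> A z], B).
  by split.
move=> [z w] /= [zA wB] bz; apply: (AB (z, w)); split=> //=; exact: zA.
Qed.

(** The definition of the normal gives a length depending on the point and the direction; here it is
    uniform. If the ray left the domain early, its exit point would be a boundary point near [p],
    where [- u] points outward by continuity of the normal; the points just before the exit would
    then lie outside the closure. *)
Lemma cone_inward p u0 : boundary Om p -> dot u0 (normal Om p) < 0 ->
  exists2 r : R, 0 < r & \forall z \near (p, u0), closure Om z.1 ->
    forall s, 0 < s < r -> Om (z.1 + s *: z.2).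
Proof.
move=> bp u0n; have u00 : u0 != 0 by apply/eqP => u00; move: u0n; rewrite u00 dot0l ltxx.
have e0 : 0 < - dot u0 (normal Om p) by rewrite oppr_gt0.
have N := near_normal_dot u0 bp e0.
have /nbhs_ballP[rho rho0 H] : \forall z \near (p, u0), z.2 != 0 /\
    (boundary Om z.1 -> dot z.2 (normal Om z.1) < 0).
  have N2 : \forall z \near (p, u0), z.2 != 0.
    have : \forall u \near u0, u != 0.
      by have := near_plane u0 (ltac:(by rewrite normr_gt0) : 0 < `|u0|); apply: filterS => u; apply: contraTneq => ->; rewrite sub0r normrN ltxx.
    by move=> H; exists (setT, [set u | u != 0]); [split; [exact: filterT|exact: H]|move=> [] ? ? []].
  move: N2 N; apply: filterS2 => z z0 zN; split; first exact: z0.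
  by move=> /zN; rewrite ltr_distl => /andP[_]; rewrite subrr.
have {}H z w : `|z - p| < rho -> `|w - u0| < rho -> w != 0 /\ (boundary Om z -> dot w (normal Om z) < 0).
  by move=> zp wu; apply: (H (z, w)); split; rewrite -ball_normE/= distrC.
pose r := rho / 2 / (`|u0| + rho).
have r0 : 0 < r by rewrite !divr_gt0// ltr_wpDl.
exists r => //.
have rho20 : 0 < rho / 2 by rewrite divr_gt0.
exists ([set z | `|z - p| < rho / 2], [set w | `|w - u0| < rho]).
  by split; exact: near_plane.
move=> [y u] /= [yp uu0] cly s /andP[s0 sr].
have ray s' : 0 <= s' -> s' < r -> `|y + s' *: u - p| < rho.
  exact: ray_close.
have yp' : `|y - p| < rho by lra.
have [u_neq0 _] := H y u yp' uu0.
have mu0 : - u != 0 by rewrite oppr_eq0.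
apply: contrapT => nOm.
set t := t_b Om y (- u).
have ts : t <= s by apply: t_b_le => //; rewrite scalerN opprK.
have tge0 : 0 <= t := t_b_ge0 bOm y mu0.
have t0 : 0 < t.
  have [Oy|nOy] := pselect (Om y).
    have : \forall s \near (0 : R), Om (y - s *: (- u)).
      by apply: ray_near; rewrite scale0r subr0; exact: open_nbhs_nbhs (conj oOm Oy).
    move=> /near_distP[e e_0 eP]; apply: lt_le_trans (_ : e / 2 <= _); first by rewrite divr_gt0.
    apply: t_b_ge => //; first by rewrite divr_ge0// ltW.
    by move=> tau /andP[t1 t2]; apply: eP; rewrite subr0 gtr0_norm//; lra.
  have by_ : boundary Om y by apply/(boundaryE oOm).
  have [_ /(_ by_)/(normal_in by_)[d d0 dP]] := H y u yp' uu0.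
  apply: (lt_le_trans d0); apply: t_b_ge => //; first exact: ltW.
  by move=> tau tI; rewrite scalerN opprK; exact: dP.
have bq := t_b_boundary oOm bOm cly mu0; rewrite -/t scalerN opprK in bq.
have [_ /(_ bq) qn] := H _ u (ray t tge0 (le_lt_trans ts sr)) uu0.
have [|d d0 dP] := normal_out (u := - u) bq; first by rewrite dotNl oppr_gt0.
have [d' d'0 [d'd d't]] := pos_lt2 d0 t0.
apply: (dP d'); first by rewrite d'0.
apply: subset_closure; rewrite scalerN -addrA -scalerBl.
have := @t_b_in _ Om bOm y (- u) (t - d') mu0.
by rewrite scalerN opprK; apply; rewrite -/t subr_gt0 d't gtrBl.
Qed.

Lemma arc_tangent_near i t0 : a i <= t0 <= b i -> exists2 e : R, 0 < e &
  forall t s, `|t - t0| < e -> `|s - t0| < e ->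
    2^-1 < dot (nderiv 1 (al i) t) (nderiv 1 (al i) s).
Proof.
move=> tI; have [C1 C2] := arc_continuous tI.
have [_ _ S _] := Hal i.
have T1 : dot (nderiv 1 (al i) t0) (nderiv 1 (al i) t0) = 1.
  by rewrite -enorm_sqr S// expr1n.
have c1 : (fun z : R * R => nderiv 1 (al i) z.1) @ filter_prod (nbhs t0) (nbhs t0)
    --> nderiv 1 (al i) t0.
  exact: (cvg_comp (fun z : R * R => z.1) (nderiv 1 (al i)) (@cvg_fst _ _ (nbhs t0) (nbhs t0) _) C2).
have c2 : (fun z : R * R => nderiv 1 (al i) z.2) @ filter_prod (nbhs t0) (nbhs t0)
    --> nderiv 1 (al i) t0.
  exact: (cvg_comp (fun z : R * R => z.2) (nderiv 1 (al i)) (@cvg_snd _ _ (nbhs t0) (nbhs t0) _) C2).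
have h0 : 0 < (2 : R)^-1 by rewrite invr_gt0.
have := cvgr_dist_lt _ _ (cvg_dot c1 c2) _ h0.
case=> -[A B] /= [/near_distP[e1 e10 H1] /near_distP[e2 e20 H2]] AB.
exists (Num.min e1 e2); first by rewrite lt_min e10.
move=> t s; rewrite !lt_min => /andP[t1 _] /andP[_ s2].
have := AB (t, s) (conj (H1 _ t1) (H2 _ s2)).
rewrite /= T1 ltr_distl => /andP[]; lra.
Qed.

Lemma is_derive_dot_arc i t u : is_derive t 1 (fun s => (al i s).1) (nderiv 1 (al i) t).1 ->
  is_derive t 1 (fun s => (al i s).2) (nderiv 1 (al i) t).2 ->
  is_derive t 1 (fun s => dot (al i s) u) (dot (nderiv 1 (al i) t) u).
Proof.
move=> D1 D2.
have c (w : R) := is_derive_cst w t (1 : R).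
apply: (is_derive_eq (is_deriveD (is_deriveM D1 (c u.1)) (is_deriveM D2 (c u.2)))).
by move: (nderiv 1 (al i) t) (al i t) => T x; rewrite /GRing.scale/= /dot; ring.
Qed.

End DomainGeometry.

Local Opaque nderiv curvature normal.

(** * The boundary as a graph; grazing at positive and at negative curvature *)

Section LocalGraph.
Context {R : realType} (M : nat).
Variables (Om : set (plane R)) (Omi : 'I_M.+1 -> set (plane R)).
Variables (a b : 'I_M.+1 -> R) (al : 'I_M.+1 -> R -> plane R).
Hypothesis HOm : analytic_nonconvex_domain Om Omi.
Hypothesis Hal : arclength_boundary Om Omi a b al.
Implicit Types (x y u v z q p nu : plane R) (i : 'I_M.+1) (t s : R).

Let oOm := open_domain HOm.
Let bOm := bounded_domain HOm.
Local Notation T i t := (nderiv 1 (al i) t).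

Lemma frame_facts i t : dot (T i t) (T i t) = 1 -> [/\
  dot (right_normal (al i) t) (right_normal (al i) t) = 1,
  dot (T i t) (right_normal (al i) t) = 0 &
  forall v, v = dot v (T i t) *: T i t + dot v (right_normal (al i) t) *: right_normal (al i) t].
Proof.
move=> U; split; last by move=> v; exact: frame_decomposition.
  by move: U; rewrite /right_normal /dot; move: (T i t) => w /= <-; rewrite mulrNN addrC.
by rewrite /right_normal /dot; move: (T i t) => w /=; rewrite mulrN mulrC subrr.
Qed.

(** The offset [sg] is taken along the fixed normal at [t0], so that the arc is a graph with the
    domain on the side [sg < 0] and no other piece of the boundary is near. Tangents in the chart
    make angles below 60 degrees, which compares parameters with lengths. Tameness on the right of
    [t0] is expressed as left tameness of the reversed curvature. *)
Definition graph_chart i t0 (e : R) :=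
  [/\ 0 < e,
      arc_frame (al i) (nderiv 1 (al i)) (curvature (al i)) 1 (t0 - e) (t0 + e),
      left_tame (curvature (al i)) t0 e,
      left_tame (fun s => curvature (al i) (- s)) (- t0) e &
   [/\ forall t, t0 - e < t < t0 + e ->
        [/\ boundary Om (al i t), normal Om (al i t) = right_normal (al i) t &
         exists2 t', a i <= t' <= b i &
           al i t = al i t' /\ curvature (al i) t = curvature (al i) t'],
      forall t s, `|t - t0| < e -> `|s - t0| < e -> 2^-1 < dot (T i t) (T i s) &
      \forall z \near al i t0, exists t sg, [/\ `|t - t0| < e,
        z = al i t + sg *: right_normal (al i) t0,
        Om z <-> sg < 0 & boundary Om z <-> sg = 0]]].

(** The parameter [t] comes from the intermediate value theorem for the tangential coordinate. By
    [cone_inward], moving from a point of the closure against the normal enters the domain: hence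
    points below the arc are in the domain, and a point of the closure above the arc would put an
    arc point into the domain. *)
Lemma graph_chart_exists i t0 : a i <= t0 <= b i ->
  exists2 e : R, 0 < e & forall e', 0 < e' <= e -> graph_chart i t0 e'.
Proof.
move=> tI; have [e1 e10 H1] := local_frame HOm Hal tI.
have [e2 e20 H2] := arc_tangent_near HOm Hal tI.
have [C1 _] := arc_continuous HOm Hal tI.
have [|F0 _ _ B0] := H1 e1; first by rewrite e10 lexx.
have [|bp np _] := B0 t0; first lra.
have U0 : dot (T i t0) (T i t0) = 1 by have [_ /(_ t0)[]] := F0; first by lra.
have [NN TN dec] := frame_facts U0.
set nu := right_normal (al i) t0 in NN TN dec np *.
have [|r r0 [[A B]/= [An Bn] AB]] := @cone_inward _ _ _ _ _ _ _ HOm Hal (al i t0) (- nu) bp.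
  by rewrite np dotNl NN oppr_lt0.
have [rho rho0 Hrho] := near_planeP An.
have {A B An Bn AB Hrho} cone y s : `|y - al i t0| < rho -> closure Om y -> 0 < s < r -> Om (y - s *: nu).
  move=> yp cly sI; rewrite -scalerN; apply: (AB (y, - nu)) => //.
  by split; [exact: Hrho|exact: nbhs_singleton].
have r20 : 0 < r / 2 by rewrite divr_gt0.
have dnu : dot (al i t) nu @[t --> t0] --> dot (al i t0) nu by apply: cvg_dot => //; exact: cvg_cst.
have [e3 e30 H3] := near_distP (cvgr_dist_lt _ _ C1 _ rho0).
have [e4 e40 H4] := near_distP (cvgr_dist_lt _ _ dnu _ r20).
exists (Num.min (Num.min e1 e2) (Num.min e3 e4)); first by rewrite !lt_min e10 e20 e30.
move=> e /andP[e0]; rewrite !le_min => /andP[/andP[ee1 ee2] /andP[ee3 ee4]].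
have [|F L1 L2 B] := H1 e; first by rewrite e0.
split; [exact: e0|exact: F|exact: L1|exact: L2|split; [exact: B| |]].
  by move=> t s te se; apply: H2; [exact: lt_le_trans te _|exact: lt_le_trans se _].
(* Since tangential speed exceeds 1/2, the tangential coordinate changes by more than [e / 4] over
   half of the chart on either side; [e / 8] keeps the target value within this range. *)
have e80 : 0 < e / 8 by rewrite divr_gt0.
have cT : dot z (T i t0) @[z --> al i t0] --> dot (al i t0) (T i t0) by apply: cvg_dot; [exact: cvg_id|exact: cvg_cst].
have cN : dot z nu @[z --> al i t0] --> dot (al i t0) nu by apply: cvg_dot; [exact: cvg_id|exact: cvg_cst].
have nT := cvgr_dist_lt _ _ cT _ e80; have nN := cvgr_dist_lt _ _ cN _ r20.
apply: filterS3 (near_plane (al i t0) rho0) (nN _) (nT _) => z zp zN zT.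
pose f t := dot (al i t) (T i t0).
have fD t : t0 - e < t < t0 + e -> is_derive t 1 f (dot (T i t) (T i t0)).
  by move=> te; have [D1 D2 _ _ _] := F.2 t te; exact: is_derive_dot_arc.
have Tpos t : t0 - e < t < t0 + e -> 2^-1 < dot (T i t) (T i t0).
  by move=> te; apply: H2; rewrite ?subrr ?normr0//; rewrite ltr_distl; lra.
have fmono t s : t0 - e < t -> t < s -> s < t0 + e -> (s - t) / 2 < f s - f t.
  move=> te ts se; have [|c /andP[c1 c2] ->] := @is_derive_mvt _ f (fun t => dot (T i t) (T i t0)) t s ts.
    by move=> u uI; apply: fD; lra.
  by rewrite mulrC ltr_pM2r ?subr_gt0//; apply: Tpos; lra.
have [|||t tI' ft] := @IVT _ f (t0 - e / 2) (t0 + e / 2) (dot z (T i t0)).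
- lra.
- apply: derivable_within_continuous => t; rewrite in_itv/= => tt.
  by have [] := fD t _; first lra.
- have h1 := fmono (t0 - e / 2) t0 ltac:(lra) ltac:(lra) ltac:(lra).
  have h2 := fmono t0 (t0 + e / 2) ltac:(lra) ltac:(lra) ltac:(lra).
  move: zT; rewrite ltr_distl -/(f t0) => /andP[z1 z2].
  rewrite ge_min le_max; apply/andP; split; apply/orP; [left|right]; lra.
move: tI'; rewrite in_itv/= => /andP[t1 t2].
have te : t0 - e < t < t0 + e by lra.
have td : `|t - t0| < e by rewrite ltr_distl; lra.
pose sg := dot (z - al i t) nu.
have zE : z = al i t + sg *: nu.
  rewrite -[LHS](subrK (al i t)) addrC; congr (_ + _).
  by rewrite {1}(dec (z - al i t)) [X in X *: T i t0](_ : _ = 0) ?scale0r ?add0r// dotBl -/(f t) ft subrr.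
have sgr : `|sg| < r.
  have := H4 t (lt_le_trans td ee4).
  rewrite /sg dotBl => h4.
  rewrite -(subrK (dot (al i t0) nu) (dot z nu)) -addrA.
  rewrite (le_lt_trans (ler_normD _ _))// (splitr r) ltrD// distrC//.
have [bt nt _] := B t te.
have tp : `|al i t - al i t0| < rho by rewrite distrC; apply: H3; exact: lt_le_trans td _.
have bnO y : boundary Om y -> ~ Om y by move=> /(boundaryE oOm)[].
exists t, sg; split=> //.
  split=> [Oz|sg0]; last first.
    rewrite zE -[sg]opprK scaleNr; apply: cone => //; first by case: bt.
    by rewrite oppr_gt0 sg0 -(ltr0_norm sg0).
  rewrite ltNge; apply/negP => sg0; apply: (bnO _ bt).
  move: sg0; rewrite le_eqVlt => /predU1P[sg0|sg0].
    by move: Oz; rewrite zE -sg0 scale0r addr0.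
  have -> : al i t = z - sg *: nu by rewrite {1}zE addrK.
  by apply: cone => //; [exact: subset_closure|rewrite sg0 -(gtr0_norm sg0)].
split=> [bz|sg0]; last by rewrite zE sg0 scale0r addr0.
have [sg0|sg0|//] := ltrgtP sg 0.
  exfalso; apply: (bnO _ bz); rewrite zE -[sg]opprK scaleNr; apply: cone => //; first by case: bt.
  by rewrite oppr_gt0 sg0 -(ltr0_norm sg0).
exfalso; apply: (bnO _ bt).
have -> : al i t = z - sg *: nu by rewrite {1}zE addrK.
by apply: cone => //; [case: bz|rewrite sg0 -(gtr0_norm sg0)].
Qed.

Lemma chart_derive i t0 e u t : graph_chart i t0 e -> t0 - e < t < t0 + e ->
  [/\ is_derive t 1 (fun s => dot (al i s) u) (dot (T i t) u),
      is_derive t 1 (fun s => dot (T i s) u) (curvature (al i) t * dot (right_normal (al i) t) u),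
      is_derive t 1 (fun s => dot u (right_normal (al i) s)) (- (curvature (al i) t * dot (T i t) u)) &
      dot (T i t) (T i t) = 1].
Proof.
move=> [_ F _ _ _] te; have [D1 D2 D3 D4 U] := F.2 t te.
have c (w : R) := is_derive_cst w t (1 : R).
split=> //; first exact: is_derive_dot_arc.
  apply: (is_derive_eq (is_deriveD (is_deriveM D3 (c u.1)) (is_deriveM D4 (c u.2)))).
  rewrite /right_normal; move: (T i t) (curvature (al i) t) (nderiv 1 (al i)) => w k W.
  rewrite /GRing.scale/= /dot/=; ring.
apply: (is_derive_eq (is_deriveD (is_deriveM (c u.1) D4) (is_deriveM (c u.2) (is_deriveN D3)))).
move: (T i t) (curvature (al i) t) (nderiv 1 (al i)) => w k W.
rewrite /GRing.scale/= /dot/=; ring.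
Qed.

Lemma chart_chord i t0 e t s r : graph_chart i t0 e -> t0 - e < t -> t < s -> s < t0 + e ->
  t0 - e < r < t0 + e -> (s - t) / 2 < dot (al i s - al i t) (T i r).
Proof.
move=> C te ts se re; rewrite dotBl.
have [|c /andP[c1 c2] ->] := @is_derive_mvt _ (fun t => dot (al i t) (T i r)) (fun t => dot (T i t) (T i r)) t s ts.
  by move=> w wI; have [|D _ _ _] := @chart_derive i t0 e (T i r) w C; [lra|exact: D].
have [_ _ _ _ [_ H _]] := C.
rewrite mulrC ltr_pM2r ?subr_gt0//; apply: H; rewrite ltr_distl; lra.
Qed.

Lemma chart_center i t0 e : graph_chart i t0 e -> [/\
  boundary Om (al i t0), normal Om (al i t0) = right_normal (al i) t0 &
  dot (T i t0) (T i t0) = 1].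
Proof.
move=> [e0 F _ _ [B _ _]]; have te : t0 - e < t0 < t0 + e by lra.
have [bp np _] := B _ te; have [_ _ _ _ U] := F.2 _ te; split; [exact: bp|exact: np|exact: U].
Qed.

Lemma concave_chart i t0 u0 : a i <= t0 <= b i -> 0 < curvature (al i) t0 ->
  u0 != 0 -> dot u0 (normal Om (al i t0)) = 0 ->
  exists e rho c : R, [/\ graph_chart i t0 e, 0 < rho, c = 1 \/ c = -1,
    forall w, t0 - e < w < t0 + e -> 0 < curvature (al i) w &
    forall w u, t0 - e < w < t0 + e -> `|u - u0| < rho -> 0 < c * dot u (T i w)].
Proof.
move=> tI k0 u00 un0; have [CC _ S _] := Hal i.
have [e1 e10 H1] := graph_chart_exists tI.
have kc := curvature_cvg CC S tI.
have [e2 e20 H2] := near_distP (cvgr_dist_lt _ _ kc _ k0).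
have U0 : dot (T i t0) (T i t0) = 1 by rewrite -enorm_sqr S// expr1n.
have [_ _ dec] := frame_facts U0.
have uT0 : dot u0 (T i t0) != 0.
  apply: contraNneq u00 => uT; rewrite (dec u0) uT -(normal_arc Hal)// un0.
  by rewrite !scale0r addr0.
pose c := Num.sg (dot u0 (T i t0)).
have c0 : 0 < c * dot u0 (T i t0) by rewrite -normrEsg normr_gt0.
have c1 : c = 1 \/ c = -1.
  by move: uT0; rewrite neq_lt /c => /orP[/ltr0_sg->|/gtr0_sg->]; [right|left].
have [_ C2] := arc_continuous HOm Hal tI.
have g1 : (fun z : plane R * R => z.1) @ filter_prod (nbhs u0) (nbhs t0) --> u0 by exact: cvg_fst.
have g2 : (fun z : plane R * R => nderiv 1 (al i) z.2) @ filter_prod (nbhs u0) (nbhs t0) --> T i t0.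
  exact: (cvg_comp (fun z : plane R * R => z.2) (nderiv 1 (al i)) (@cvg_snd _ _ (nbhs u0) (nbhs t0) _) C2).
have := cvgr_dist_lt _ _ (cvgM (cvg_cst c) (cvg_dot g1 g2)) _ c0.
case=> -[A B] /= [/near_planeP[rho rho0 K1] /near_distP[e3 e30 K2]] AB.
have [e' e'0 [e'1 e'2]] := pos_lt2 e10 e20.
have [e e0 [ee' ee3]] := pos_lt2 e'0 e30.
have eI w : t0 - e < w < t0 + e -> `|w - t0| < e by rewrite -ltr_distl.
exists e, rho, c; split; [|exact: rho0|exact: c1| |].
- by apply: H1; rewrite e0 ltW// (lt_trans ee').
- move=> w /eI we; have := H2 w (lt_trans we (lt_trans ee' e'2)).
  by rewrite ltr_distl => /andP[_]; rewrite -ltrBlDr subrr.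
- move=> w u /eI we ur; have := AB (u, w) (conj (K1 _ ur) (K2 _ (lt_trans we ee3))).
  by rewrite /= ltr_distl => /andP[_]; rewrite -ltrBlDr subrr.
Qed.

(** [G] is the component of the arc along [u] rotated by a right angle, and its derivative is minus
    the normal component [w] of [u]. Positive curvature makes [w] decrease in the direction of
    travel, so from [w <= 0] on the arc bends to the outer side of the ray, and the end of the ray
    is left on the inner side. The sign [c] tells whether [u] runs with or against the parameter. *)
Lemma concave_chart_below i t0 e c u t t' s sg : graph_chart i t0 e -> c = 1 \/ c = -1 ->
  (forall w, t0 - e < w < t0 + e -> 0 < curvature (al i) w) ->
  (forall w, t0 - e < w < t0 + e -> 0 < c * dot u (T i w)) ->
  t0 - e < t < t0 + e -> t0 - e < t' < t0 + e -> 0 < s ->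
  al i t' - al i t = s *: u - sg *: right_normal (al i) t0 ->
  dot u (right_normal (al i) t) <= 0 -> sg < 0.
Proof.
move=> C c1 kp uT tI tI' s0 dE un.
have e0 : 0 < e by case: C.
have t0I : t0 - e < t0 < t0 + e by lra.
have [_ _ U0] := chart_center C.
have [NN TN _] := frame_facts U0.
have dT : dot (al i t' - al i t) (T i t0) = s * dot u (T i t0).
  by rewrite dE dotBl !dotZl (dotC (right_normal _ _)) TN mulr0 subr0.
pose w (x : R) := dot u (right_normal (al i) x).
have wD (x : R) : t0 - e < x < t0 + e -> is_derive x 1 w (- (curvature (al i) x * dot (T i x) u)).
  by move=> xI; have [_ _ D _] := chart_derive u C xI.
pose G (x : R) := dot (al i x) (u.2, - u.1).
have GD (x : R) : t0 - e < x < t0 + e -> is_derive x 1 G (- w x).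
  move=> xI; have [D _ _ _] := chart_derive (u.2, - u.1) C xI; apply: (is_derive_eq D).
  by rewrite /w /right_normal /dot; move: (T i x) => y /=; ring.
have GE : G t' - G t = - (sg * dot u (T i t0)).
  rewrite /G -dotBl dE /right_normal; move: (T i t0) => y.
  transitivity ((s * u.1 - sg * y.2) * u.2 + (s * u.2 - sg * - y.1) * - u.1); first by [].
  by rewrite /dot; ring.
have {}un : w t <= 0 := un.
have CH (x y : R) : t0 - e < x -> x < y -> y < t0 + e -> 0 < dot (al i y - al i x) (T i t0).
  move=> x1 xy y2; apply: lt_trans (chart_chord C x1 xy y2 t0I).
  by rewrite divr_gt0// subr_gt0.
clear NN TN U0 dE.
have [l1 l2] := andP tI; have [l1' l2'] := andP tI'.
case: c1 => cE.
- have {}uT (x : R) : t0 - e < x < t0 + e -> 0 < dot u (T i x).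
    by move=> /uT; rewrite cE mul1r.
  have su : 0 < s * dot u (T i t0) by rewrite mulr_gt0// uT.
  have tt' : t < t'.
    rewrite ltNge; apply/negP; rewrite le_eqVlt => /predU1P[E|t't].
      by move: su; rewrite -dT E subrr dot0l ltxx.
    have := CH t' t l1' t't l2; rewrite -(opprB (al i t')) dotNl dT oppr_gt0.
    by rewrite ltNge (ltW su).
  have wneg (x : R) : t < x -> x <= t' -> w x < 0.
    move=> tx xt'; apply: lt_le_trans un; rewrite -ltrN2.
    apply: (@is_derive_gt0_lt _ (fun x : R => - w x)
        (fun x : R => curvature (al i) x * dot (T i x) u)) => // y yI.
      rewrite -[X in is_derive _ _ _ X]opprK; apply: is_deriveN; apply: wD; lra.
    have yI' : t0 - e < y < t0 + e by lra.
    by apply: mulr_gt0; [exact: kp|rewrite dotC; exact: uT].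
  have : G t < G t'.
    apply: (@is_derive_gt0_lt _ G (fun x : R => - w x)) => // y yI; first by apply: GD; lra.
    by rewrite oppr_gt0; apply: wneg; lra.
  by rewrite -subr_gt0 GE oppr_gt0 pmulr_llt0// uT.
have {}uT (x : R) : t0 - e < x < t0 + e -> dot u (T i x) < 0.
  by move=> /uT; rewrite cE mulN1r oppr_gt0.
have su : s * dot u (T i t0) < 0 by rewrite pmulr_rlt0// uT.
have tt' : t' < t.
  rewrite ltNge; apply/negP; rewrite le_eqVlt => /predU1P[E|t't].
    by move: su; rewrite -dT E subrr dot0l ltxx.
  by have := CH t t' l1 t't l2'; rewrite dT ltNge (ltW su).
have wneg (x : R) : x < t -> t' <= x -> w x < 0.
  move=> tx xt'; apply: lt_le_trans un.
  apply: (@is_derive_gt0_lt _ w (fun x : R => - (curvature (al i) x * dot (T i x) u))) => // y yI.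
    apply: wD; lra.
  have yI' : t0 - e < y < t0 + e by lra.
  by rewrite oppr_gt0 pmulr_rlt0 ?kp// dotC uT.
have : G t' < G t.
  apply: (@is_derive_gt0_lt _ G (fun x : R => - w x)) => // y yI; first by apply: GD; lra.
  by rewrite oppr_gt0; apply: wneg; lra.
by rewrite -subr_lt0 GE oppr_lt0 nmulr_lgt0// uT.
Qed.

(** The tangential counterpart of [cone_inward]: positive curvature replaces transversality, at the
    price of starting on the boundary with a direction that does not point outward. *)
Lemma concave_escape i t0 u0 : a i <= t0 <= b i -> 0 < curvature (al i) t0 ->
  u0 != 0 -> dot u0 (normal Om (al i t0)) = 0 ->
  exists2 r : R, 0 < r & \forall z \near (al i t0, u0), boundary Om z.1 ->
    dot z.2 (normal Om z.1) <= 0 -> forall s, 0 < s < r -> Om (z.1 + s *: z.2).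
Proof.
move=> tI k0 u00 un0.
have [e [d [c [C d0 c1 kp uT]]]] := concave_chart tI k0 u00 un0.
have [_ _ _ _ [B _ /near_planeP[rho rho0 G]]] := C.
have rho20 : 0 < rho / 2 by rewrite divr_gt0.
exists (rho / 2 / (`|u0| + d)); first by rewrite !divr_gt0// ltr_wpDl.
exists ([set z | `|z - al i t0| < rho / 2], [set w | `|w - u0| < d]).
  by split; exact: near_plane.
move=> [q u] /= [qp uu0] bq un s /andP[s0 sr].
have zp : `|q + s *: u - al i t0| < rho by apply: ray_close uu0 _ sr => //; exact: ltW.
have qp' : `|q - al i t0| < rho.
  by apply: lt_trans qp _; rewrite ltr_pdivrMr// ltr_pMr// ltr1n.
have [t [sg [te qE _ [/(_ bq) sg0 _]]]] := G q qp'.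
rewrite sg0 scale0r addr0 in qE.
have [t' [sg' [te' zE Oz _]]] := G _ zp.
have dE : al i t' - al i t = s *: u - sg' *: right_normal (al i) t0.
  have -> : al i t' = q + s *: u - sg' *: right_normal (al i) t0 by rewrite zE addrK.
  by rewrite -qE addrAC [q + _]addrC addrK.
rewrite ltr_distl in te; rewrite ltr_distl in te'.
apply/Oz; apply: (concave_chart_below C c1 kp _ te te' s0 dE).
  by move=> w wI; exact: uT.
by move: un; rewrite qE; have [_ -> _] := B _ te.
Qed.

(** Under negative curvature the arc lies on the inner side of its tangent line, so a point of this
    line has offset [sg >= 0] and is not in the domain. Vanishing curvature remains possible here;
    it is a singular case, excluded by a hypothesis of [bstep_launch]. *)
Lemma tangential_arrival_concave i t0 u0 : a i <= t0 <= b i ->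
  u0 != 0 -> dot u0 (normal Om (al i t0)) = 0 ->
  (exists2 d : R, 0 < d & forall s, 0 < s < d -> Om (al i t0 + s *: u0)) ->
  0 <= curvature (al i) t0.
Proof.
move=> tI u00 un0 [d d0 dP]; rewrite leNgt; apply/negP => k0.
have [CC _ S _] := Hal i.
have [e1 e10 H1] := graph_chart_exists tI.
have kc := curvature_cvg CC S tI.
have [e2 e20 H2] := near_distP (cvgr_dist_lt _ _ kc _ (ltac:(by rewrite oppr_gt0) : 0 < - curvature (al i) t0)).
pose e := Num.min e1 e2.
have [ee1 ee2] : e <= e1 /\ e <= e2 by rewrite /e !ge_min !lexx !orbT.
have e0 : 0 < e by rewrite !lt_min e10 e20.
have C : graph_chart i t0 e by apply: H1; rewrite e0.
have [_ np U0] := chart_center C; rewrite np in un0.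
have [NN TN dec] := frame_facts U0.
have [_ _ _ _ [_ TT /near_planeP[rho rho0 G]]] := C.
have u0p : 0 < `|u0| by rewrite normr_gt0.
pose s := Num.min d (rho / `|u0|) / 2.
have m0 : 0 < Num.min d (rho / `|u0|) by rewrite lt_min d0 divr_gt0.
have [m1 m2] : Num.min d (rho / `|u0|) <= d /\ Num.min d (rho / `|u0|) <= rho / `|u0|.
  by rewrite !ge_min !lexx orbT.
have [s0 [sd sr]] : 0 < s /\ s < d /\ s < rho / `|u0|.
  rewrite /s; move: (Num.min d _) m0 m1 m2 => m *; lra.
have zp : `|al i t0 + s *: u0 - al i t0| < rho.
  by rewrite addrAC subrr add0r normrZ gtr0_norm// -ltr_pdivlMr.
have Oz := dP s ltac:(by rewrite s0).
have [t [sg [te zE [/(_ Oz) sg0 _] _]]] := G _ zp.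
set nu := right_normal (al i) t0 in NN TN un0 zE.
have gt : dot (al i t) nu - dot (al i t0) nu = - sg.
  rewrite -dotBl; have -> : al i t - al i t0 = s *: u0 - sg *: nu.
    have -> : al i t = al i t0 + s *: u0 - sg *: nu by rewrite zE addrK.
    by rewrite addrAC [al i t0 + _]addrC addrK.
  by rewrite dotBl !dotZl un0 NN mulr0 mulr1 sub0r.
suff : dot (al i t) nu <= dot (al i t0) nu by lra.
have tI' : t0 - e < t < t0 + e by move: te; rewrite ltr_distl.
have kn w : t0 - e < w < t0 + e -> curvature (al i) w < 0.
  move=> wI; have := H2 w; rewrite !ltr_distl => /(_ ltac:(lra))/andP[]; lra.
have nn w : t0 - e < w < t0 + e -> 0 < dot (right_normal (al i) w) nu.
  move=> wI; have := TT w t0; rewrite subrr normr0 => /(_ ltac:(by rewrite ltr_distl; lra) e0).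
  rewrite /nu /right_normal /dot/= mulrNN addrC; move: (T i w) (T i t0) => x y; lra.
have Tn w w' : t0 - e < w -> w <= w' -> w' < t0 + e -> dot (T i w') nu <= dot (T i w) nu.
  move=> w1 ww w2; rewrite -lerN2.
  apply: (@is_derive_ge0_le _ (fun x : R => - dot (T i x) nu) (fun x : R => - (curvature (al i) x * dot (right_normal (al i) x) nu))) => // y yI.
    by apply: is_deriveN; have [|_ D _ _] := @chart_derive i t0 e nu y C; [lra|exact: D].
  by rewrite oppr_ge0 nmulr_rle0 ?kn ?ltW ?nn//; lra.
have [tt|tt] := leP t0 t.
  rewrite -lerN2.
  apply: (@is_derive_ge0_le _ (fun x : R => - dot (al i x) nu) (fun x : R => - dot (T i x) nu)) => // y yI.
    by apply: is_deriveN; have [|D _ _ _] := @chart_derive i t0 e nu y C; [lra|exact: D].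
  by rewrite oppr_ge0 -TN; apply: Tn; lra.
apply: (@is_derive_ge0_le _ (fun x : R => dot (al i x) nu) (fun x : R => dot (T i x) nu)); first exact: ltW.
  by move=> y yI; have [|D _ _ _] := @chart_derive i t0 e nu y C; [lra|exact: D].
by move=> y yI; rewrite -TN; apply: Tn; lra.
Qed.

End LocalGraph.

(** * Bounce points do not accumulate *)

Section NoAccumulation.
Context {R : realType}.

Section Frame.
Variables (p T : R -> plane R) (k : R -> R) (sg lo hi : R).
Hypothesis F : arc_frame p T k sg lo hi.
Local Notation N := (frame_normal sg T).

Lemma frame_derive (u : plane R) (s : R) : lo < s < hi ->
  [/\ is_derive s 1 (fun x => dot (p x) u) (dot (T s) u),
      is_derive s 1 (fun x => dot u (T x)) (k s * dot u (N s)),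
      is_derive s 1 (fun x => dot u (N x)) (- (k s * dot u (T s))),
      is_derive s 1 (fun x => sg * (u.1 * (p x).2 - u.2 * (p x).1)) (dot u (N s)) &
      dot u (T s) ^+ 2 + dot u (N s) ^+ 2 = dot u u].
Proof.
move=> sI; have [sg1 /(_ _ sI)[D1 D2 D3 D4 U]] := F.
have c (w : R) := is_derive_cst w s (1 : R).
split.
- apply: (is_derive_eq (is_deriveD (is_deriveM D1 (c u.1)) (is_deriveM D2 (c u.2)))).
  by rewrite /GRing.scale/= /dot; ring.
- apply: (is_derive_eq (is_deriveD (is_deriveM (c u.1) D3) (is_deriveM (c u.2) D4))).
  by rewrite /GRing.scale/= /dot/=; ring.
- apply: (is_derive_eq (is_deriveD (is_deriveM (c u.1) (is_deriveM (c sg) D4))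
    (is_deriveM (c u.2) (is_deriveN (is_deriveM (c sg) D3))))).
  rewrite /GRing.scale/= /dot/=.
  transitivity (- (sg ^+ 2 * k s * (u.1 * (T s).1 + u.2 * (T s).2))); first by ring.
  by rewrite sg1 mul1r.
- apply: (is_derive_eq (is_deriveM (c sg) (is_deriveB (is_deriveM (c u.1) D2) (is_deriveM (c u.2) D1)))).
  by rewrite /GRing.scale/= /dot/=; ring.
transitivity (dot u u * (dot (T s) (T s))); last by rewrite U mulr1.
rewrite /dot/=.
transitivity ((u.1 * (T s).1 + u.2 * (T s).2) ^+ 2 + sg ^+ 2 * (u.1 * (T s).2 - u.2 * (T s).1) ^+ 2); first by ring.
by rewrite sg1; ring.
Qed.

(* On a chord the velocity component [c = u.T] satisfies [c' = kappa w] with [w = u.N] of mean zero.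
   Comparing [kappa] with its values at the ends of the chord gives
   [(1 - c) / mu] nondecreasing along the bounces, while it is at most of the order of the step. *)
Lemma no_accumulation_left (t l : nat -> R) (u : nat -> plane R) (t0 : R) :
  t0 <= hi -> lo < t0 -> left_tame k t0 (t0 - lo) ->
  (forall n, lo < t n < t0) -> (forall n, t n < t n.+1) ->
  (forall n, p (t n.+1) - p (t n) = l n *: u n) ->
  (forall n, dot (u n) (u n) = 1) ->
  (forall n s, t n <= s <= t n.+1 -> 0 < dot (u n) (T s)) ->
  (forall n, dot (u n.+1) (T (t n.+1)) = dot (u n) (T (t n.+1))) ->
  (forall n, dot (u n) (N (t n)) <= 0) ->
  (forall n, dot (u n) (N (t n)) < 0 \/ 0 < k (t n)) ->
  (forall n, 0 <= dot (u n) (N (t n.+1))) ->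
  (forall e, 0 < e -> exists n, t n.+1 - t n < e) -> False.
Proof.
move=> t0hi lot0; rewrite /left_tame subKr => tame tI tt chord u1 uT refl uN0 uN uN1 step.
have inI n s : t n <= s <= t n.+1 -> lo < s < t0.
  by have := tI n; have := tI n.+1; lra.
have inF n s : t n <= s <= t n.+1 -> lo < s < hi.
  by move=> /inI; lra.
have D n s (sI : t n <= s <= t n.+1) := frame_derive (u n) (inF n s sI).
(* Nonnegative curvature fails on the first chord already: [u.N] would be nonincreasing, yet it is
   at most 0 at departure and at least 0 at arrival; strictness comes from the departure or from
   positive curvature. *)
have nneg s : lo < s < t0 -> 0 <= k s -> (forall s, lo < s < t0 -> 0 <= k s) -> False.
  move=> _ _ k0; have [uN00|kt0] := uN 0.
    have : dot (u 0) (N (t 1)) <= dot (u 0) (N (t 0)).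
      rewrite -lerN2; apply: (@is_derive_ge0_le _ (fun x => - dot (u 0) (N x)) (fun x => k x * dot (u 0) (T x))).
      - exact/ltW/tt.
      - move=> s' sI; have [_ _ D3 _ _] := D 0 s' sI.
        by rewrite -[X in is_derive _ _ _ X]opprK; apply: is_deriveN.
      - by move=> s' sI; rewrite mulr_ge0 ?k0 ?ltW ?uT//; exact: inI sI.
    by have := uN1 0; lra.
  case: tame => [kz|[s1 [m [E [B [s1P kE _ _]]]]]].
    by move: kt0; rewrite kz// ltxx.
  have kpos s' : lo < s' < t0 -> 0 < k s'.
    move=> sI; rewrite lt_neqAle eq_sym k0// andbT; apply/eqP => kz.
    have [+ m0 E0 _] := kE _ sI; rewrite kz mulr0 => /eqP; rewrite eq_sym.
    by rewrite gt_eqF// mulr_gt0.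
  have : dot (u 0) (N (t 1)) < dot (u 0) (N (t 0)).
    rewrite -ltrN2; apply: (@is_derive_gt0_lt _ (fun x => - dot (u 0) (N x)) (fun x => k x * dot (u 0) (T x))).
    - exact/tt.
    - move=> s' sI; have [_ _ D3 _ _] := D 0 s' sI.
      by rewrite -[X in is_derive _ _ _ X]opprK; apply: is_deriveN.
    - move=> s' sI; have sI' : t 0 <= s' <= t 1 by lra.
      by rewrite mulr_gt0 ?kpos ?uT//; exact: inI sI'.
  by have := uN1 0; have := uN0 0; lra.
case: tame => [kz|[s1 [m [E [B [s1P kE mmon Emon]]]]]].
  by apply: (nneg (t 0)) => //; rewrite ?kz// => s sI; rewrite kz.
have {s1P}s1P : s1 = -1.
  case: s1P => // s11; exfalso.
  have k0 s : lo < s < t0 -> 0 <= k s.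
    by move=> /kE[]; rewrite s11 mul1r => -> ? ? _; rewrite mulr_ge0// ltW.
  by apply: (nneg (t 0)) => //; apply: k0.
have {}kE s : lo < s < t0 -> [/\ k s = - (m s * E s), 0 < m s, 0 < E s & E s <= B].
  by move=> /kE[+ -> -> ->]; rewrite s1P mulN1r => <-; rewrite opprK.
have kneg s : lo < s < t0 -> k s < 0.
  by move=> /kE[-> ? ? _]; rewrite oppr_lt0 mulr_gt0.
have {}uN n : dot (u n) (N (t n)) < 0.
  by case: (uN n) => // kp; have := kneg _ (tI n); lra.
pose e n := (1 - dot (u n) (T (t n))) / m (t n).
have key n : e n <= e n.+1 /\ e n <= B * (t n.+1 - t n).
  have tn : t n <= t n <= t n.+1 by have := tt n; lra.
  have tn1 : t n <= t n.+1 <= t n.+1 by have := tt n; lra.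
  pose w s := dot (u n) (N s); pose c s := dot (u n) (T s).
  pose W s := sg * ((u n).1 * (p s).2 - (u n).2 * (p s).1).
  have wmono x y : t n <= x -> x <= y -> y <= t n.+1 -> w x <= w y.
    move=> tx xy yt; apply: (@is_derive_ge0_le _ w (fun x => - (k x * dot (u n) (T x)))) => // s sI.
      have sI' : t n <= s <= t n.+1 by lra.
      by have [] := D n s sI'.
    have sI' : t n <= s <= t n.+1 by lra.
    by rewrite oppr_ge0 nmulr_rle0 ?kneg ?ltW ?uT//; exact: inI sI'.
  (* The arc is parallel to the chord at [s0], where [c = 1]. Before [s0], [-k] is at most
     [m (t n) * E s0]; after it, at least [m (t n.+1) * E s0]. Since both halves use the same
     [E s0], the factor [E] costs nothing from bounce to bounce. *)
  have [|||s0 s0I ws0] := @IVT _ w (t n) (t n.+1) 0.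
  - exact/ltW/tt.
  - apply: derivable_within_continuous => s; rewrite in_itv/= => sI.
    by have [_ _ D3 _ _] := D n s sI; case: D3.
  - by rewrite ge_min le_max (ltW (uN n)) uN1 orbT.
  move: s0I; rewrite in_itv/= => s0I.
  have cs0 : c s0 = 1.
    have [_ _ _ _ E1] := D n s0 s0I; move: E1; rewrite -/(w s0) ws0 expr0n addr0 u1 => /eqP.
    rewrite sqrf_eq1 => /orP[/eqP//|/eqP cm]; have := uT n s0 s0I.
    by rewrite cm oppr_gt0 ltr10.
  (* [W] is a primitive of [w]; the endpoints of the chord differ by a multiple of [u n], so [w] has
     mean zero. *)
  have W01 : W (t n.+1) = W (t n).
    apply/eqP; rewrite -subr_eq0; apply/eqP.
    transitivity (sg * ((u n).1 * (p (t n.+1) - p (t n)).2 - (u n).2 * (p (t n.+1) - p (t n)).1)).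
      by rewrite /W -[(_ - _).1]/(_ - _) -[(_ - _).2]/(_ - _); ring.
    by rewrite chord scale_fst scale_snd; ring.
  have [kn1 mn0 En0 EnB] := kE _ (tI n).
  have [kn2 mn1 En1 _] := kE _ (tI n.+1).
  have s0I' := inI n s0 s0I.
  have [_ ms0 Es0 EB] := kE _ s0I'.
  have L : 1 - c (t n) <= m (t n) * E s0 * (W (t n) - W s0).
    have : - (c (t n) + m (t n) * E s0 * W (t n)) <= - (c s0 + m (t n) * E s0 * W s0).
      apply: (@is_derive_ge0_le _ (fun s => - (c s + m (t n) * E s0 * W s))
        (fun s => - (k s * w s + m (t n) * E s0 * w s))); first by lra.
        move=> s sI; have sI' : t n <= s <= t n.+1 by lra.
        have [_ D2 _ D4 _] := D n s sI'.
        apply: is_deriveN; apply: is_deriveD => //.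
      move=> s sI; rewrite -mulrDl oppr_ge0 mulr_ge0_le0//; last by rewrite -ws0; apply: wmono; lra.
      have sI' : lo < s < t0 by apply: (inI n); lra.
      have [-> m0 E0 _] := kE _ sI'.
      rewrite addrC subr_ge0; apply: ler_pM => //; try exact: ltW.
        apply: mmon => //; lra.
      apply: Emon => //; lra.
    rewrite cs0; lra.
  have Rr : m (t n.+1) * E s0 * (W (t n) - W s0) <= 1 - c (t n.+1).
    have : - (c s0 + m (t n.+1) * E s0 * W s0) <= - (c (t n.+1) + m (t n.+1) * E s0 * W (t n.+1)).
      apply: (@is_derive_ge0_le _ (fun s => - (c s + m (t n.+1) * E s0 * W s))
        (fun s => - (k s * w s + m (t n.+1) * E s0 * w s))); first by lra.
        move=> s sI; have sI' : t n <= s <= t n.+1 by lra.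
        have [_ D2 _ D4 _] := D n s sI'.
        apply: is_deriveN; apply: is_deriveD => //.
      move=> s sI; rewrite -mulrDl oppr_ge0 mulr_le0_ge0//; last by rewrite -ws0; apply: wmono; lra.
      have sI' : lo < s < t0 by apply: (inI n); lra.
      have [-> m0 E0 _] := kE _ sI'.
      rewrite addrC subr_le0; apply: ler_pM => //; try exact: ltW.
        apply: mmon => //; lra.
      apply: Emon => //; lra.
    rewrite cs0 W01; lra.
  (* [|w| <= 1] because [u n] is a unit vector. *)
  have A1 : W (t n) - W s0 <= t n.+1 - t n.
    have : W (t n) + t n <= W s0 + s0.
      apply: (@is_derive_ge0_le _ (fun s => W s + s) (fun s => w s + 1)); first by lra.
        move=> s sI; have sI' : t n <= s <= t n.+1 by lra.
        by have [_ _ _ D4 _] := D n s sI'; apply: is_deriveD.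
      move=> s sI; have sI' : t n <= s <= t n.+1 by lra.
      have [_ _ _ _] := D n s sI'; rewrite u1 -/(w s) => E1.
      have : w s ^+ 2 <= 1 by have := sqr_ge0 (dot (u n) (T s)); lra.
      by rewrite -ler_sqrt// sqrtr_sqr sqrtr1 ler_norml; lra.
    lra.
  have [e1 e2] : e n <= E s0 * (W (t n) - W s0) /\ E s0 * (W (t n) - W s0) <= e n.+1.
    rewrite /e ler_pdivrMr// ler_pdivlMr// refl; split.
      by rewrite (le_trans L)//; lra.
    by rewrite (le_trans _ Rr)//; lra.
  split; first exact: le_trans e2.
  apply: (le_trans e1); apply: (le_trans (ler_wpM2l (ltW Es0) A1)).
  by rewrite ler_wpM2r// subr_ge0; exact/ltW/tt.
(* The quantity [e n] never falls below [e 0 > 0], but is at most [B] times a step that can be made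
   arbitrarily small. *)
have e0n n : e 0 <= e n by elim: n => // n /le_trans; apply; exact: (key n).1.
have e00 : 0 < e 0.
  have [_ m0 _ _] := kE _ (tI 0); rewrite divr_gt0// subr_gt0.
  have tn : t 0 <= t 0 <= t 1 by have := tt 0; lra.
  have [_ _ _ _] := D 0 _ tn; rewrite u1 => E1.
  have : 0 < dot (u 0) (N (t 0)) ^+ 2 by rewrite exprn_even_gt0//= lt_eqF.
  have := uT 0 _ tn; move: (dot (u 0) (T (t 0))) E1 => x E1; nra.
have B0 : 0 < B by have [_ _ E0 EB] := kE _ (tI 0); lra.
have [n hn] := step (e 0 / B) (divr_gt0 e00 B0).
have [_ en] := key n; have := e0n n.
rewrite ltr_pdivlMr// mulrC in hn; lra.
Qed.

End Frame.
End NoAccumulation.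

(** * The bounce map and its departing states *)

Section Dynamics.
Context {R : realType} (M : nat).
Variables (Om : set (plane R)) (Omi : 'I_M.+1 -> set (plane R)).
Variables (a b : 'I_M.+1 -> R) (al : 'I_M.+1 -> R -> plane R).
Hypothesis HOm : analytic_nonconvex_domain Om Omi.
Hypothesis Hal : arclength_boundary Om Omi a b al.
Implicit Types (x y u v w : plane R) (p : plane R * plane R) (i : 'I_M.+1) (t s : R).

Let oOm := open_domain HOm.
Let bOm := bounded_domain HOm.
Local Notation n := (normal Om).

Definition bstep p : plane R * plane R :=
  (p.1 - t_b Om p.1 p.2 *: p.2, Defs.reflect Om (p.1 - t_b Om p.1 p.2 *: p.2) p.2).

(** All parameters of the point are tested, since a point can have several, as at the two ends of a
    closed curve. *)
Definition concave x := forall i t, a i <= t <= b i -> x = al i t -> 0 < curvature (al i) t.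

(** Parameter endpoints are included because the closure of {kappa > 0} is formed inside [[a, b]]
    and can end there with nonzero curvature. *)
Definition singular x := exists i t, [/\ a i <= t <= b i, x = al i t &
  [\/ curvature (al i) t = 0, t = a i | t = b i]].

(* [launch p]: the backward flight [x - s v] leaves the boundary point x and enters the domain. *)
Definition launch p := [/\ boundary Om p.1, p.2 != 0 &
  0 < dot p.2 (n p.1) \/ (dot p.2 (n p.1) = 0 /\ concave p.1)].

Lemma reflect_dot x v : boundary Om x -> dot (Defs.reflect Om x v) (n x) = - dot v (n x).
Proof.
move=> bx; rewrite /Defs.reflect dotBl dotZl (normal_unit HOm Hal bx) (dotC (n x)); ring.
Qed.

Lemma reflect_tangent x v w : dot (n x) w = 0 -> dot (Defs.reflect Om x v) w = dot v w.
Proof. by move=> nw; rewrite /Defs.reflect dotBl dotZl nw mulr0 subr0. Qed.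

Lemma reflect_grazing x v : dot v (n x) = 0 -> Defs.reflect Om x v = v.
Proof. by move=> vn; rewrite /Defs.reflect dotC vn mulr0 scale0r subr0. Qed.

Lemma reflect_sqr x v : boundary Om x -> dot (Defs.reflect Om x v) (Defs.reflect Om x v) = dot v v.
Proof.
move=> bx; rewrite {2}/Defs.reflect dotBr dotZr reflect_dot// {1}/Defs.reflect dotBl dotZl (dotC (n x)); ring.
Qed.

Lemma reflect_neq0 x v : boundary Om x -> v != 0 -> Defs.reflect Om x v != 0.
Proof. by move=> bx; rewrite -!dotvv_eq0 reflect_sqr. Qed.

Lemma t_b_outward x v : boundary Om x -> v != 0 -> dot v (n x) < 0 -> t_b Om x v = 0.
Proof.
move=> bx v0 vn; apply/eqP; rewrite eq_le t_b_ge0// andbT leNgt; apply/negP => t0.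
have [|d d0 dP] := normal_out HOm Hal (u := - v) bx; first by rewrite dotNl oppr_gt0.
have [s s0 [sd st]] := pos_lt2 d0 t0.
apply: (dP s); first by rewrite s0.
by apply: subset_closure; rewrite scalerN; apply: t_b_in => //; rewrite s0.
Qed.

Lemma t_b_interior x v : Om x -> v != 0 -> 0 < t_b Om x v.
Proof.
move=> Ox v0; have : \forall s \near (0 : R), Om (x - s *: v).
  by apply: ray_near; rewrite scale0r subr0; exact: open_nbhs_nbhs (conj oOm Ox).
move=> /near_distP[e e0 eP]; have e20 : 0 < e / 2 by rewrite divr_gt0.
apply: (lt_le_trans e20); apply: t_b_ge => //; first exact: ltW.
move=> tau /andP[t1 t2]; apply: eP; rewrite subr0 gtr0_norm//.
by rewrite (lt_trans t2)// ltr_pdivrMr// ltr_pMr// ltr1n.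
Qed.

Lemma launch_t_b p : launch p -> 0 < t_b Om p.1 p.2.
Proof.
move=> [bx v0 vn].
suff [d d0 dP] : exists2 d : R, 0 < d & forall s, 0 < s < d -> Om (p.1 + s *: - p.2).
  apply: (lt_le_trans d0); apply: t_b_ge => //; first exact: ltW.
  by move=> s /dP; rewrite scalerN.
case: vn => [vn|[vn cx]].
  by apply: (normal_in HOm Hal) => //; rewrite dotNl oppr_lt0.
have [i [t [tI xE]]] := (boundaryP HOm Hal p.1).1 bx.
have [|||r r0 /nbhs_singleton/= H] := concave_escape HOm Hal (i := i) (t0 := t) (u0 := - p.2) tI.
- exact: cx tI xE.
- by rewrite oppr_eq0.
- by rewrite -xE dotNl vn oppr0.
by exists r => //; rewrite xE; apply: H; rewrite -?xE// dotNl vn oppr0.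
Qed.

Lemma bstep_boundary p : closure Om p.1 -> p.2 != 0 -> boundary Om (bstep p).1.
Proof. by move=> clx v0; exact: t_b_boundary. Qed.

Lemma arrival p : closure Om p.1 -> p.2 != 0 -> 0 < t_b Om p.1 p.2 ->
  dot p.2 (n (bstep p).1) <= 0 /\
  exists2 d : R, 0 < d & forall s, 0 < s < d -> Om ((bstep p).1 + s *: p.2).
Proof.
move=> clx v0 t0; have bx := bstep_boundary clx v0.
have H s : 0 < s < t_b Om p.1 p.2 -> Om ((bstep p).1 + s *: p.2).
  move=> /andP[s0 st]; rewrite /bstep/= -addrA -scaleNr -scalerDl.
  rewrite (_ : - _ + s = - (t_b Om p.1 p.2 - s)); last by rewrite opprB addrC.
  by rewrite scaleNr; apply: t_b_in => //; rewrite subr_gt0 st gtrBl.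
split; last by exists (t_b Om p.1 p.2).
rewrite leNgt; apply/negP => /(normal_out HOm Hal bx)[d d0 dP].
have [s s0 [sd st]] := pos_lt2 d0 t0.
apply: (dP s); first by rewrite s0.
by apply: subset_closure; apply: H; rewrite s0.
Qed.

(** A transversal arrival is turned inward by the reflection. A grazing arrival through the domain
    forces nonnegative curvature, and nonsingularity excludes zero. An outward velocity on the
    boundary is reflected after a flight of zero duration. *)
Lemma bstep_launch p : closure Om p.1 -> p.2 != 0 ->
  0 < t_b Om p.1 p.2 \/ (boundary Om p.1 /\ dot p.2 (n p.1) < 0) ->
  ~ (singular (bstep p).1 /\ dot (bstep p).2 (n (bstep p).1) = 0) ->
  launch (bstep p).
Proof.
move=> clx v0 H nS; have bx := bstep_boundary clx v0.
split; [by []|exact: reflect_neq0|].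
have rd : dot (bstep p).2 (n (bstep p).1) = - dot p.2 (n (bstep p).1) by exact: reflect_dot.
case: H => [t0|[bp vn]]; last first.
  left; rewrite rd oppr_gt0; have t0 := t_b_outward bp v0 vn.
  by rewrite /bstep t0 scale0r subr0.
have [] := arrival clx v0 t0; rewrite le_eqVlt => /predU1P[vn|vn] ar; last first.
  by left; rewrite rd oppr_gt0.
right; split; first by rewrite rd vn oppr0.
move=> i t tI xE; rewrite lt_neqAle eq_sym; apply/andP; split.
  apply/eqP => k0; apply: nS; split; last by rewrite rd vn oppr0.
  by exists i, t; split; [exact: tI|exact: xE|exact: Or31].
have vn' : dot p.2 (n (al i t)) = 0 by rewrite -xE.
by rewrite xE in ar; exact: (tangential_arrival_concave HOm Hal tI v0 vn' ar).
Qed.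

Definition start p := [/\ closure Om p.1, p.2 != 0 &
  0 < t_b Om p.1 p.2 \/ (boundary Om p.1 /\ dot p.2 (n p.1) < 0)].

Lemma launch_start p : launch p -> start p.
Proof.
by move=> lp; have [bp v0 _] := lp; split; [case: bp|exact: v0|left; exact: launch_t_b].
Qed.

Lemma bstep_speed p : closure Om p.1 -> p.2 != 0 -> enorm (bstep p).2 = enorm p.2.
Proof.
by move=> clp p0; apply: enorm_eq; apply: reflect_sqr; exact: bstep_boundary.
Qed.

Lemma bstep_length p : p.2 != 0 -> enorm (p.1 - (bstep p).1) = t_b Om p.1 p.2 * enorm p.2.
Proof.
by move=> p0; rewrite /bstep/= subKr enormZ ger0_norm// t_b_ge0.
Qed.

End Dynamics.

Section BoundedVariation.
Context {R : realType}.

Lemma summable_variation_cvg (r d : nat -> R) : cvgn (series d) ->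
  (forall j, `|r j.+1 - r j| <= d j) -> cvgn r.
Proof.
move=> cd H; have d0 j : 0 <= d j by rewrite (le_trans _ (H j)).
have C : cvgn (series (fun j => r j.+1 - r j)).
  by apply: normed_cvg; apply: series_le_cvg cd => // j; exact: normr_ge0.
have -> : r = (fun j => r 0%N + series (fun j => r j.+1 - r j) j).
  apply/funext => j; rewrite /series/= telescope_sumr// addrC subrK//.
by apply: is_cvgD C; exact: is_cvg_cst.
Qed.

Lemma bounded_length_cvg (q : nat -> plane R) (L : R) :
  (forall m, \sum_(0 <= j < m) enorm (q j - q j.+1) <= L) -> exists p : plane R, q @ \oo --> p.
Proof.
move=> H; have cd : cvgn (series (fun j => enorm (q j - q j.+1))).
  apply: nondecreasing_is_cvgn.
    by apply: nondecreasing_series => j _ _; exact: enorm_ge0.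
  by exists L => _ [m _ <-]; exact: H.
have le x : `|x.1| <= enorm (x : plane R) /\ `|x.2| <= enorm x.
  by split; apply: le_trans (normr_le_enorm x); rewrite prod_normE/= le_max lexx ?orbT.
have [c1 c2] : cvgn (fun j => (q j).1) /\ cvgn (fun j => (q j).2).
  by split; apply: (summable_variation_cvg cd) => j; rewrite distrC;
    have [] := le (q j - q j.+1).
by exists (limn (fun j => (q j).1), limn (fun j => (q j).2)); exact: cvg_plane.
Qed.

End BoundedVariation.

(** * Trajectories of departing states have infinite length *)

Section NoAccumulationDomain.
Context {R : realType} (M : nat).
Variables (Om : set (plane R)) (Omi : 'I_M.+1 -> set (plane R)).
Variables (a b : 'I_M.+1 -> R) (al : 'I_M.+1 -> R -> plane R).
Implicit Types (i : 'I_M.+1).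
Local Notation T i t := (nderiv 1 (al i) t).
Local Notation rn i t := (right_normal (al i) t).

Section Chart.
Variables (i : 'I_M.+1) (t0 e : R) (t l : nat -> R) (u : nat -> plane R).
Hypothesis C : graph_chart Om a b al i t0 e.
Hypothesis tI : forall k, t0 - e < t k < t0 + e.
Hypothesis chord : forall k, al i (t k.+1) - al i (t k) = l k *: u k.
Hypothesis l0 : forall k, 0 < l k.
Hypothesis u1 : forall k, dot (u k) (u k) = 1.
Hypothesis refl : forall k, dot (u k.+1) (T i (t k.+1)) = dot (u k) (T i (t k.+1)).
Hypothesis un0 : forall k, dot (u k) (rn i (t k)) <= 0.
Hypothesis un : forall k, dot (u k) (rn i (t k)) < 0 \/ 0 < curvature (al i) (t k).
Hypothesis un1 : forall k, 0 <= dot (u k) (rn i (t k.+1)).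
Hypothesis lim : al i (t k) @[k --> \oo] --> al i t0.

Let chord_dot k v : dot (al i (t k.+1) - al i (t k)) v = l k * dot (u k) v.
Proof. by rewrite chord dotZl. Qed.

Let up_dot k s : t k < t k.+1 -> t0 - e < s < t0 + e -> 0 < dot (u k) (T i s).
Proof.
move=> tt sI; rewrite -(pmulr_rgt0 _ (l0 k)) -chord_dot.
have [l1 _] := andP (tI k); have [_ l2] := andP (tI k.+1).
by apply: lt_trans (chart_chord C l1 tt l2 sI); rewrite divr_gt0// subr_gt0.
Qed.

Let down_dot k s : t k.+1 < t k -> t0 - e < s < t0 + e -> dot (u k) (T i s) < 0.
Proof.
move=> tt sI; rewrite -(pmulr_rlt0 _ (l0 k)) -chord_dot -opprB dotNl oppr_lt0.
have [l1 _] := andP (tI k.+1); have [_ l2] := andP (tI k).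
by apply: lt_trans (chart_chord C l1 tt l2 sI); rewrite divr_gt0// subr_gt0.
Qed.

Let t_neq k : t k != t k.+1.
Proof.
apply/eqP => E; have := chord_dot k (u k); rewrite E subrr dot0l u1 mulr1 => /esym l00.
by have := l0 k; rewrite l00 ltxx.
Qed.

(** Reflection preserves the tangential component of the velocity, whose sign is the direction of
    travel along the arc. *)
Let monotone : (forall k, t k < t k.+1) \/ (forall k, t k.+1 < t k).
Proof.
have := t_neq 0; rewrite neq_lt => /orP[t01|t01]; [left|right]; elim=> // k IH.
  have := t_neq k.+1; rewrite neq_lt => /orP[//|tt].
  have := down_dot tt (tI k.+1); rewrite refl => /lt_trans/(_ (up_dot IH (tI k.+1))).
  by rewrite ltxx.
have := t_neq k.+1; rewrite neq_lt => /orP[tt|//].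
have := up_dot tt (tI k.+1); rewrite refl => /lt_trans/(_ (down_dot IH (tI k.+1))).
by rewrite ltxx.
Qed.

Let t0I : t0 - e < t0 < t0 + e.
Proof. by have [e0 _ _ _ _] := C; rewrite ltrBlDr ltrDl e0. Qed.

Let height k := dot (al i (t k) - al i t0) (T i t0).

Let height_cvg (d : R) : 0 < d -> exists K, forall k, (K <= k)%N -> `|height k| < d.
Proof.
move=> d0; have H : height k @[k --> \oo] --> 0.
  rewrite -(dot0l (T i t0)) -(subrr (al i t0)); apply: cvg_dot; last exact: cvg_cst.
  by apply: cvgB => //; exact: cvg_cst.
have := cvgr_dist_lt _ _ H _ d0; case=> K _ KP; exists K => k /KP/=.
by rewrite sub0r normrN.
Qed.

(** In the chart a parameter step is less than twice the step in [height], and the latter is below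
    [d / 2] once both heights are below [d / 4]. *)
Let small_step (d : R) : 0 < d -> exists k, `|t k.+1 - t k| < d.
Proof.
move=> d0; have d40 : 0 < d / 4 by rewrite divr_gt0.
have [K KP] := height_cvg d40; exists K.
have := KP K (leqnn _); have := KP K.+1 (leqnSn _).
have hE : dot (al i (t K.+1) - al i (t K)) (T i t0) = height K.+1 - height K.
  by rewrite /height -dotBl opprB addrA subrK.
have [l1 l2] := andP (tI K); have [l1' l2'] := andP (tI K.+1).
have aux (x y z w : R) : (z - w) / 2 < x - y -> `|x| < d / 4 -> `|y| < d / 4 -> z - w < d.
  by rewrite !ltr_norml => H /andP[? ?] /andP[? ?]; lra.
have := t_neq K; rewrite neq_lt => /orP[tt|tt] h1 h2.
  rewrite gtr0_norm ?subr_gt0//; apply: aux h1 h2.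
  by rewrite -hE; exact: (chart_chord C l1 tt l2' t0I).
rewrite distrC gtr0_norm ?subr_gt0//; apply: aux h2 h1.
by rewrite -[ltRHS]opprB -hE -dotNl opprB; exact: (chart_chord C l1' tt l2 t0I).
Qed.

(** Beyond [t0] increasing parameters would keep the heights above a positive constant, against
    convergence. *)
Let up_below : (forall k, t k < t k.+1) -> forall k, t k < t0.
Proof.
move=> tt k; rewrite ltNge; apply/negP => t0k.
have t0k1 : t0 < t k.+1 := le_lt_trans t0k (tt k).
have H j : (k.+1 <= j)%N -> height k.+1 <= height j.
  elim: j => // j IH; rewrite leq_eqVlt => /predU1P[->//|/IH/le_trans]; apply.
  rewrite -subr_ge0 /height -dotBl opprB addrA subrK chord_dot.
  by apply: mulr_ge0; apply: ltW; [exact: l0|exact: up_dot].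
have [l1 l2] := andP t0I; have [l1' l2'] := andP (tI k.+1).
have h0 : 0 < height k.+1.
  by apply: lt_trans (chart_chord C l1 t0k1 l2' t0I); rewrite divr_gt0// subr_gt0.
have [K KP] := height_cvg h0.
have := KP (maxn K k.+1) (leq_maxl _ _); have := H _ (leq_maxr K k.+1) => h1.
by rewrite ltNge (le_trans h1)// ler_norm.
Qed.

Let down_above : (forall k, t k.+1 < t k) -> forall k, t0 < t k.
Proof.
move=> tt k; rewrite ltNge; apply/negP => t0k.
have t0k1 : t k.+1 < t0 := lt_le_trans (tt k) t0k.
have H j : (k.+1 <= j)%N -> height j <= height k.+1.
  elim: j => // j IH; rewrite leq_eqVlt => /predU1P[->//|/IH]; apply: le_trans.
  rewrite -subr_le0 /height -dotBl opprB addrA subrK chord_dot.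
  by apply: mulr_ge0_le0; apply: ltW; [exact: l0|exact: down_dot].
have [l1 l2] := andP t0I; have [l1' l2'] := andP (tI k.+1).
have h0 : 0 < - height k.+1.
  rewrite /height -dotNl opprB.
  by apply: lt_trans (chart_chord C l1' t0k1 l2 t0I); rewrite divr_gt0// subr_gt0.
have [K KP] := height_cvg h0.
have := KP (maxn K k.+1) (leq_maxl _ _); have := H _ (leq_maxr K k.+1) => h1.
rewrite ltNge => /negP; apply.
by rewrite -normrN (le_trans _ (ler_norm _))// lerN2.
Qed.

Lemma no_accumulation_chart : False.
Proof.
have [_ F L1 L2 _] := C.
have nE s : frame_normal 1 (nderiv 1 (al i)) s = rn i s by rewrite /frame_normal !mul1r.
have [tt|tt] := monotone.
  apply: (@no_accumulation_left _ _ _ _ _ _ _ F t l u t0) => //.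
  - by case/andP: t0I => _ /ltW.
  - by case/andP: t0I.
  - by rewrite subKr.
  - by move=> k; rewrite up_below// andbT; case/andP: (tI k).
  - move=> k s /andP[s1 s2]; apply: up_dot => //.
    have [l1 _] := andP (tI k); have [_ l2] := andP (tI k.+1).
    by rewrite (lt_le_trans l1)// (le_lt_trans s2).
  - by move=> k; rewrite nE.
  - by move=> k; rewrite nE.
  - by move=> k; rewrite nE.
  - by move=> d /small_step[k]; rewrite gtr0_norm ?subr_gt0//; exists k.
(* For decreasing parameters the arc is reversed; the normals stay the same, and tameness on the
   right of [t0] becomes tameness on the left of [- t0]. *)
have nE' s : frame_normal (- 1) (fun s => - nderiv 1 (al i) (- s)) s = rn i (- s).
  by rewrite /frame_normal/= !mulNr !mul1r !opprK; congr (_, _).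
apply: (@no_accumulation_left _ _ _ _ _ _ _ (arc_frame_reverse F) (fun k => - t k) l u (- t0)).
- by rewrite lerN2; case/andP: t0I => /ltW.
- by rewrite ltrN2; case/andP: t0I.
- by rewrite opprK addKr.
- by move=> k; rewrite ltrN2 ltrN2 down_above// andbT; case/andP: (tI k).
- by move=> k; rewrite ltrN2.
- by move=> k; rewrite !opprK.
- exact: u1.
- move=> k s /andP[s1 s2]; rewrite dotNr oppr_gt0; apply: down_dot => //.
  have [_ l2] := andP (tI k); have [l1 _] := andP (tI k.+1).
  by rewrite (lt_le_trans l1) ?(le_lt_trans _ l2)// 1?lerNl 1?lerNr.
- by move=> k; rewrite !opprK !dotNr refl.
- by move=> k; rewrite nE' opprK.
- by move=> k; rewrite nE' opprK.
- by move=> k; rewrite nE' opprK.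
- by move=> d /small_step[k]; rewrite distrC gtr0_norm ?subr_gt0// => H; exists k; rewrite opprK addrC.
Qed.

End Chart.
Hypothesis HOm : analytic_nonconvex_domain Om Omi.
Hypothesis Hal : arclength_boundary Om Omi a b al.

Lemma boundary_closed : closed (boundary Om).
Proof.
have -> : boundary Om = closure Om `&` ~` Om.
  by apply/seteqP; split=> x /(boundaryE (open_domain HOm)).
by apply: closedI; [exact: closed_closure|exact/open_closedC/(open_domain HOm)].
Qed.

Lemma launch_trajectory_length (Y : nat -> plane R * plane R) :
  (forall k, Y k.+1 = bstep Om (Y k)) -> (forall k, launch Om a b al (Y k)) ->
  forall L, exists m, L < \sum_(0 <= j < m) enorm ((Y j).1 - (Y j.+1).1).
Proof.
move=> YS lY L; apply: contrapT => nL.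
have [p qp] : exists p : plane R, (fun k => (Y k).1) @ \oo --> p.
  apply: (@bounded_length_cvg _ _ L) => m; rewrite leNgt; apply/negP => Lm.
  by apply: nL; exists m.
have bp : boundary Om p.
  apply: (closed_cvg _ boundary_closed _ _ qp); exists 0%N => // k _.
  by case: (lY k).
have [i [t0 [tI pE]]] := (boundaryP HOm Hal p).1 bp.
have [e e0 /(_ e)] := graph_chart_exists HOm Hal tI.
rewrite e0 lexx => /(_ isT) C; have [_ _ _ _ [B _ G]] := C.
rewrite pE in qp; have [K _ KP] := qp _ G.
have /choice[t tP] k : exists t, t0 - e < t < t0 + e /\ (Y (K + k)%N).1 = al i t.
  have [t [sg [te qE _ [bsg _]]]] := KP _ (leq_addr k K).
  exists t; split; first by rewrite -ltr_distl.
  have [bq _ _] := lY (K + k)%N.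
  by rewrite qE bsg// scale0r addr0.
have tk k : t0 - e < t k < t0 + e := (tP k).1.
have qE k : (Y (K + k)%N).1 = al i (t k) := (tP k).2.
have nE k : normal Om (al i (t k)) = right_normal (al i) (t k) by have [_ -> _] := B _ (tk k).
have cl k : closure Om (Y k).1 by case: (lY k) => -[].
have v0 k : (Y k).2 != 0 by case: (lY k).
pose sp := enorm (Y 0).2.
have spE k : enorm (Y k).2 = sp.
  by elim: k => // k <-; rewrite YS (bstep_speed HOm Hal).
have sp0 : 0 < sp by rewrite lt_neqAle eq_sym enorm_eq0 v0 enorm_ge0.
(* The unit direction of the backward flight, which runs along minus the velocity; the tail from [K]
   on stays in the chart. *)
pose u k := - (sp^-1 *: (Y (K + k)%N).2).
pose l k := t_b Om (Y (K + k)%N).1 (Y (K + k)%N).2 * sp.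
have lim : al i (t k) @[k --> \oo] --> al i t0.
  have -> : (fun k => al i (t k)) = (fun k => (Y (k + K)%N).1).
    by apply/funext => k; rewrite -qE addnC.
  by apply: cvg_comp qp; exact: cvg_addnr.
have dn k : 0 <= dot (Y k).2 (normal Om (Y k).1).
  by have [_ _ [/ltW//|[->]]] := lY k.
have uE k w : dot (u k) w = - (sp^-1 * dot (Y (K + k)%N).2 w) by rewrite dotNl dotZl.
have isp : 0 < sp^-1 by rewrite invr_gt0.
apply: (no_accumulation_chart C tk (l := l) (u := u) _ _ _ _ _ _ _ lim) => k.
- rewrite -!qE addnS YS /bstep/= addrAC subrr sub0r /u /l.
  by rewrite scalerN scalerA -mulrA mulfV ?gt_eqF// mulr1.
- by rewrite mulr_gt0// (launch_t_b HOm Hal (lY _)).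
- by rewrite /u dotNl dotNr opprK dotZl dotZr -enorm_sqr spE mulrA -expr2 -exprMn mulVf ?gt_eqF// expr1n.
- rewrite !uE addnS YS reflect_tangent// -[(_ - _)]/((bstep Om (Y (K + k)%N)).1) -YS -addnS qE nE.
  have [_ _ _ U] := chart_derive 0 C (tk k.+1).
  by have [_ + _] := frame_facts U; rewrite dotC.
- by rewrite uE oppr_le0 pmulr_rge0// -nE -qE dn.
- have [_ _ [vn|[vn cc]]] := lY (K + k)%N.
    by left; rewrite uE oppr_lt0 mulr_gt0// -nE -qE.
  right; have [_ _ [t' t'I [aE kE]]] := B _ (tk k).
  by rewrite kE; apply: (cc _ _ t'I); rewrite qE.
- have [an _] := arrival HOm Hal (cl _) (v0 _) (launch_t_b HOm Hal (lY (K + k)%N)).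
  by rewrite uE oppr_ge0 pmulr_rle0// -nE -qE addnS YS.
Qed.

End NoAccumulationDomain.

(** * Local bound for the number of bounces *)

Section Rays.
Context {R : realType}.
Implicit Types (p q : plane R * plane R) (s : R).

Lemma enormD (u v : plane R) : enorm (u + v) <= enorm u + enorm v.
Proof.
have nn := addr_ge0 (enorm_ge0 u) (enorm_ge0 v).
rewrite -(ger0_norm nn) -sqrtr_sqr ler_wsqrtr//.
have := dot_le_enorm u v; rewrite sqrrD !enorm_sqr ler_norml => /andP[_ H].
rewrite dotDl (dotC u) (dotC v) !dotDl (dotC v u); lra.
Qed.

Lemma near_fst (V W : normedModType R) (p : V * W) (e : R) : 0 < e ->
  \forall q \near p, `|q.1 - p.1| < e /\ `|q.2 - p.2| < e.
Proof.
move=> e0; apply: filterS (near_norm p e0) => q.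
by rewrite prod_normE/= gt_max => /andP[].
Qed.

Lemma ray_joint p s (P : plane R -> Prop) : (\forall y \near p.1 - s *: p.2, P y) ->
  exists2 e : R, 0 < e & \forall q \near p, forall s', `|s' - s| < e -> P (q.1 - s' *: q.2).
Proof.
move=> H; pose F := filter_prod (nbhs s) (nbhs p).
have : (fun z : R * (plane R * plane R) => z.2.1 - z.1 *: z.2.2) @ F --> p.1 - s *: p.2.
  apply: cvg_ray; last 2 first.
  - exact: cvg_fst.
  - by apply: (cvg_comp (fun z : R * (plane R * plane R) => z.2) snd); [exact: cvg_snd|exact: cvg_snd].
  - by apply: (cvg_comp (fun z : R * (plane R * plane R) => z.2) fst); [exact: cvg_snd|exact: cvg_fst].
move=> /(_ _ H)[[A B] /= [/near_distP[e e0 eA] nB] AB].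
exists e => //; apply: filterS nB => q Bq s' /eA As'.
exact: (AB (s', q)).
Qed.

Lemma segment_near p (s1 s2 : R) (O : set (plane R)) : open O ->
  (forall s, s1 <= s <= s2 -> O (p.1 - s *: p.2)) ->
  \forall q \near p, forall s, s1 <= s <= s2 -> O (q.1 - s *: q.2).
Proof.
move=> oO H; have /compact_near_coveringP/(_ _ (nbhs p) (fun q s => O (q.1 - s *: q.2)) _) K := @segment_compact R s1 s2.
have {}K : \forall q \near p, `[s1, s2]%classic `<=` (fun s => O (q.1 - s *: q.2)).
  apply: K => s; rewrite /= in_itv/= => /H Os.
  have [e e0 N] := ray_joint (open_nbhs_nbhs (conj oO Os)).
  exists ([set s' | `|s' - s| < e], [set q | forall s', `|s' - s| < e -> O (q.1 - s' *: q.2)]).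
    by split=> //=; exact: near_dist.
  by move=> [s' q] /= [? ]; apply.
by apply: filterS K => q Kq s sI; apply: Kq; rewrite /= in_itv.
Qed.

End Rays.

Section LocalBound.
Context {R : realType} (M : nat).
Variables (Om : set (plane R)) (Omi : 'I_M.+1 -> set (plane R)).
Variables (a b : 'I_M.+1 -> R) (al : 'I_M.+1 -> R -> plane R).
Hypothesis HOm : analytic_nonconvex_domain Om Omi.
Hypothesis Hal : arclength_boundary Om Omi a b al.
Implicit Types (x y u v w : plane R) (p q z : plane R * plane R) (s t : R).

Let oOm := open_domain HOm.
Let bOm := bounded_domain HOm.
Local Notation n := (normal Om).
Local Notation launch := (launch Om a b al).
Local Notation bstep := (bstep Om).

Lemma reflect_near x v (W : plane R * plane R -> Prop) : boundary Om x ->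
  (\forall z \near (x, Defs.reflect Om x v), W z) ->
  \forall z \near (x, v), boundary Om z.1 -> W (z.1, Defs.reflect Om z.1 z.2).
Proof.
move=> bx [[A B] /= [nA nB] AB].
pose F := filter_prod (within (boundary Om) (nbhs x)) (nbhs v).
have c1 : (fun z : plane R * plane R => n z.1) @ F --> n x.
  exact: (cvg_comp _ _ (@cvg_fst _ _ _ _ _) (normal_cvg HOm Hal bx)).
have c2 : (fun z : plane R * plane R => z.2) @ F --> v by exact: cvg_snd.
have : (fun z => Defs.reflect Om z.1 z.2) @ F --> Defs.reflect Om x v.
  by apply: cvg_ray => //; apply: cvgM; [exact: cvg_cst|exact: cvg_dot].
move=> /(_ _ nB)[[A1 B1] /= [nA1 nB1] AB1].
exists ((fun y => A y /\ (boundary Om y -> A1 y)), B1).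
  by split=> //; exact: filterI.
move=> [y w] /= [[Ay A1y] B1w] by_; apply: AB; split=> //=.
by apply: (AB1 (y, w)); split=> //; exact: A1y.
Qed.

Definition reaches (W : plane R * plane R -> Prop) q := W (bstep q) \/
  exists2 tau : R, 0 < tau < t_b Om q.1 q.2 & W (q.1 - tau *: q.2, q.2).

(* A backward flight that is not interrupted early either hits the boundary near the limit point,
   or, when the limit hit is grazing, may miss the boundary and pass near the limit point. *)
Lemma flight_end p (W : plane R * plane R -> Prop) : closure Om p.1 -> p.2 != 0 ->
  0 < t_b Om p.1 p.2 \/ (boundary Om p.1 /\ dot p.2 (n p.1) < 0) ->
  (\forall z \near bstep p, W z) ->
  exists2 e : R, 0 < e & \forall q \near p, closure Om q.1 -> q.2 != 0 ->
    t_b Om p.1 p.2 - e < t_b Om q.1 q.2 -> reaches W q.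
Proof.
move=> clp p0 H nW; set tp := t_b Om p.1 p.2 in H *.
pose x1 := p.1 - tp *: p.2.
have bx1 : boundary Om x1 by exact: t_b_boundary.
have vn : dot p.2 (n x1) <= 0.
  case: H => [t0|[bp vn]]; first by have [] := arrival HOm Hal clp p0 t0.
  by rewrite /x1 /tp (t_b_outward HOm Hal bp p0 vn) scale0r subr0 ltW.
have [[A1 B1] /= [nA1 nB1] R1] := reflect_near bx1 nW.
have [e1 e10 N1] := ray_joint (p := p) nA1.
have nB1' : \forall q \near p, B1 q.2.
  by have := cvg_snd nB1; exact.
have hit q : (forall s', `|s' - tp| < e1 -> A1 (q.1 - s' *: q.2)) -> B1 q.2 ->
    closure Om q.1 -> q.2 != 0 -> `|t_b Om q.1 q.2 - tp| < e1 -> reaches W q.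
  move=> Aq Bq clq q0 tq; left.
  by apply: (R1 (_, q.2)) => /=; [split=> //=; exact: Aq|exact: t_b_boundary].
have [vn0|vn0] := eqVneq (dot p.2 (n x1)) 0.
  have t0 : 0 < tp.
    case: H => // -[bp vnp]; move: vn0.
    by rewrite /x1 /tp (t_b_outward HOm Hal bp p0 vnp) scale0r subr0 => vn0; rewrite vn0 ltxx in vnp.
  have nW' : \forall z \near (x1, p.2), W z by move: nW; rewrite /bstep/= reflect_grazing.
  case: nW' => -[A2 B2] /= [nA2 nB2] R2.
  have [e2 e20 N2] := ray_joint (p := p) nA2.
  have nB2' : \forall q \near p, B2 q.2 by have := cvg_snd nB2; exact.
  exists e1 => //; near=> q => clq q0 tq.
  have [tq'|tq'] := ltP (t_b Om q.1 q.2) (tp + e1).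
    by apply: hit => //; [near: q|near: q|rewrite ltr_distl tq tq'].
  (* The flight misses the grazing point. A grazing reflection is the identity, so the state in
     mid-flight at time [tp], with its velocity unchanged, is close to [bstep p]. *)
  right; exists tp; first by rewrite t0 (lt_le_trans _ tq')// ltrDl.
  apply: R2; split=> /=; last by near: q.
  have : forall s', `|s' - tp| < e2 -> A2 (q.1 - s' *: q.2) by near: q.
  by apply; rewrite subrr normr0.
have {vn0}vn : dot p.2 (n x1) < 0 by rewrite lt_neqAle vn0.
(* At a transversal hit the prolonged limit ray is outside the closure shortly after [tp], which
   stops nearby flights as well. *)
have [|d d0 dP] := normal_out HOm Hal (u := - p.2) bx1; first by rewrite dotNl oppr_gt0.
have [s s0 [sd se]] := pos_lt2 d0 e10.
have tp0 : 0 <= tp by exact: t_b_ge0.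
have out : ~ closure Om (p.1 - (tp + s) *: p.2).
  by have := dP s; rewrite s0 => /(_ sd); rewrite /x1 scalerN -addrA -opprD -scalerDl.
have nout : \forall y \near p.1 - (tp + s) *: p.2, ~ closure Om y.
  by apply: open_nbhs_nbhs; split=> //; apply: closed_openC; exact: closed_closure.
have [e2 e20 N2] := ray_joint (p := p) nout.
exists e1 => //; near=> q => clq q0 tq.
have tq' : t_b Om q.1 q.2 <= tp + s.
  apply: t_b_le => //; first by rewrite (lt_le_trans s0)// lerDr.
  move=> /subset_closure; have : forall s', `|s' - (tp + s)| < e2 -> ~ closure Om (q.1 - s' *: q.2) by near: q.
  by apply; rewrite subrr normr0.
apply: hit => //; [by near: q|by near: q|].
by rewrite ltr_distl tq (le_lt_trans tq')// ltrD2l.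
Unshelve. all: by end_near. Qed.

Definition regular p := [/\ closure Om p.1, p.2 != 0 &
  [\/ Om p.1, launch p | boundary Om p.1 /\ dot p.2 (n p.1) < 0]].

Lemma regular_start p : regular p -> start Om p.
Proof.
move=> [clp p0 H]; split=> //; case: H => [Op|lp|]; [left|left|by right].
  exact: (t_b_interior HOm).
exact: (launch_t_b HOm Hal lp).
Qed.

(** Lower semicontinuity of the flight time. Away from its two ends the limit flight is a compact
    segment in the open domain, hence stable; only the first [r] units of time need the extra
    condition [D]. *)
Lemma not_early p (D : plane R * plane R -> Prop) r e : p.2 != 0 -> 0 < r -> 0 < e ->
  (\forall q \near p, D q -> forall s, 0 < s < r -> Om (q.1 - s *: q.2)) ->
  \forall q \near p, q.2 != 0 -> D q -> t_b Om p.1 p.2 - e < t_b Om q.1 q.2.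
Proof.
move=> p0 r0 e0 N; set tp := t_b Om p.1 p.2.
have e20 : 0 < e / 2 by rewrite divr_gt0.
have r20 : 0 < r / 2 by rewrite divr_gt0.
have S : \forall q \near p, forall s, r / 2 <= s <= tp - e / 2 -> Om (q.1 - s *: q.2).
  apply: segment_near => // s /andP[s1 s2]; apply: t_b_in => //.
  by rewrite (lt_le_trans r20)//= (le_lt_trans s2)// gtrBl.
apply: filterS2 N S => q Nq Sq q0 Dq.
have [tpe|etp] := ltP tp e.
  by rewrite (lt_le_trans (_ : tp - e < 0)) ?subr_lt0// t_b_ge0.
have lt1 : tp - e < tp - e / 2 by rewrite ltrD2l ltrN2 ltr_pdivrMr// ltr_pMr// ltr1n.
apply: (lt_le_trans lt1); apply: t_b_ge => //.
  by rewrite (le_trans _ (ltW lt1))// subr_ge0.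
move=> s /andP[s1 s2]; have [sr|rs] := ltP s r; first by apply: Nq => //; rewrite s1.
apply: Sq; rewrite (ltW s2) andbT (le_trans _ rs)//.
by rewrite ler_pdivrMr// ler_pMr// ler1n.
Qed.

Lemma near_opp x v (P : plane R * plane R -> Prop) :
  (\forall z \near (x, - v), P z) -> \forall z \near (x, v), P (z.1, - z.2).
Proof.
case=> -[A B] /= [nA nB] AB; exists (A, fun w => B (- w)).
  by split=> //; apply: (cvgN (@cvg_id _ (nbhs v)) nB).
by move=> [y w] /= [Ay Bw]; apply: AB; split.
Qed.

Lemma clear_start p : p.2 != 0 -> Om p.1 \/ (boundary Om p.1 /\ 0 < dot p.2 (n p.1)) ->
  exists2 r : R, 0 < r & \forall q \near p, closure Om q.1 ->
    forall s, 0 < s < r -> Om (q.1 - s *: q.2).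
Proof.
move=> p0 [Op|[bp vn]].
  have nO : \forall y \near p.1 - 0 *: p.2, Om y.
    by rewrite scale0r subr0; exact: open_nbhs_nbhs (conj oOm Op).
  have [e e0 N] := ray_joint nO; exists e => //.
  apply: filterS N => q Nq _ s /andP[s0 se]; apply: Nq.
  by rewrite subr0 gtr0_norm.
have [|r r0 N] := cone_inward HOm Hal (u0 := - p.2) bp; first by rewrite dotNl oppr_lt0.
exists r => //; have := near_opp N; rewrite -surjective_pairing.
by apply: filterS => q Nq clq s sI; rewrite -scalerN; exact: Nq.
Qed.

Lemma grazing_start p : launch p -> dot p.2 (n p.1) = 0 ->
  exists2 r : R, 0 < r & \forall q \near p, boundary Om q.1 /\ 0 <= dot q.2 (n q.1) ->
    forall s, 0 < s < r -> Om (q.1 - s *: q.2).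
Proof.
move=> [bp p0 [vp|[_ cp]]] vn; first by rewrite vn ltxx in vp.
have [i [t [tI pE]]] := (boundaryP HOm Hal p.1).1 bp.
have mv0 : - p.2 != 0 by rewrite oppr_eq0.
have mvn : dot (- p.2) (n (al i t)) = 0 by rewrite -pE dotNl vn oppr0.
have [r r0 N] := concave_escape HOm Hal tI (cp i t tI pE) mv0 mvn.
exists r => //; rewrite -pE in N; have := near_opp N; rewrite -surjective_pairing.
apply: filterS => q Nq [bq qn] s sI; rewrite -scalerN; apply: Nq => //.
by rewrite /= dotNl oppr_le0.
Qed.

(** Near a grazing departure a state [q] may hit the boundary once more close to [p], at a bounce
    absent from the limit. Then [bstep q] is again close to [p] and starts on the boundary without
    pointing outward, so [grazing_start] protects its flight; this is why [q'] is [q] or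
    [bstep q]. *)
Lemma step_continuity p (W W1 : plane R * plane R -> Prop) : regular p ->
  (\forall z \near p, W z) -> (\forall z \near bstep p, W1 z) ->
  \forall q \near p, closure Om q.1 -> q.2 != 0 ->
    exists q', [/\ q' = q \/ q' = bstep q, closure Om q'.1, q'.2 != 0, W q' & reaches W1 q'].
Proof.
move=> rp nW nW1; have [clp p0 sp] := regular_start rp; have [_ _ kind] := rp.
have [e e0 E] := flight_end clp p0 sp nW1.
have simple : (\forall q \near p, q.2 != 0 -> closure Om q.1 -> t_b Om p.1 p.2 - e < t_b Om q.1 q.2) ->
    \forall q \near p, closure Om q.1 -> q.2 != 0 ->
    exists q', [/\ q' = q \/ q' = bstep q, closure Om q'.1, q'.2 != 0, W q' & reaches W1 q'].
  move=> N; apply: filterS3 nW E N => q Wq Eq Nq clq q0.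
  by exists q; split=> //; [by left|apply: Eq => //; exact: Nq].
have clear : Om p.1 \/ (boundary Om p.1 /\ 0 < dot p.2 (n p.1)) ->
    \forall q \near p, closure Om q.1 -> q.2 != 0 ->
    exists q', [/\ q' = q \/ q' = bstep q, closure Om q'.1, q'.2 != 0, W q' & reaches W1 q'].
  move=> H; have [r r0 N] := clear_start p0 H.
  by apply: simple; exact: (not_early p0 r0 e0 N).
case: kind => [Op|lp|[bp vn]]; first by apply: clear; left.
  have [bp _ [vn|[vn cp]]] := lp; first by apply: clear; right.
  have [r r0 N] := grazing_start lp vn.
  have NE := not_early p0 r0 e0 N.
  have nV : \forall z \near p, W z /\ ((closure Om z.1 -> z.2 != 0 ->
     t_b Om p.1 p.2 - e < t_b Om z.1 z.2 -> reaches W1 z) /\ (z.2 != 0 ->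
      boundary Om z.1 /\ 0 <= dot z.2 (n z.1) -> t_b Om p.1 p.2 - e < t_b Om z.1 z.2)).
    by apply: filterS3 nW E NE.
  have [[A B] /= [nA nB] AB] : \forall z \near (p.1, p.2), boundary Om z.1 ->
      W (z.1, Defs.reflect Om z.1 z.2) /\ ((closure Om z.1 -> Defs.reflect Om z.1 z.2 != 0 ->
     t_b Om p.1 p.2 - e < t_b Om z.1 (Defs.reflect Om z.1 z.2) -> reaches W1 (z.1, Defs.reflect Om z.1 z.2)) /\
      (Defs.reflect Om z.1 z.2 != 0 ->
      boundary Om z.1 /\ 0 <= dot (Defs.reflect Om z.1 z.2) (n z.1) ->
      t_b Om p.1 p.2 - e < t_b Om z.1 (Defs.reflect Om z.1 z.2))).
    have nV' : \forall z \near (p.1, Defs.reflect Om p.1 p.2), W z /\ ((closure Om z.1 -> z.2 != 0 ->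
     t_b Om p.1 p.2 - e < t_b Om z.1 z.2 -> reaches W1 z) /\ (z.2 != 0 ->
      boundary Om z.1 /\ 0 <= dot z.2 (n z.1) -> t_b Om p.1 p.2 - e < t_b Om z.1 z.2)).
      by rewrite reflect_grazing// -surjective_pairing.
    exact: (reflect_near bp nV').
  have nA' : \forall y \near p.1 - 0 *: p.2, A y by rewrite scale0r subr0.
  have [e1 e10 NA] := ray_joint nA'.
  have nB' : \forall q \near p, B q.2 by have := cvg_snd nB; exact.
  have S : \forall q \near p, forall s, e1 / 2 <= s <= t_b Om p.1 p.2 - e / 2 -> Om (q.1 - s *: q.2).
    apply: segment_near => // s /andP[s1 s2]; apply: t_b_in => //.
    by rewrite (lt_le_trans _ s1) ?divr_gt0//= (le_lt_trans s2)// gtrBl divr_gt0.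
  near=> q => clq q0.
  have bq : boundary Om (q.1 - t_b Om q.1 q.2 *: q.2) by exact: t_b_boundary.
  have tq0 : 0 <= t_b Om q.1 q.2 by exact: t_b_ge0.
  (* A flight lasting at least [e1] cannot end on the stable part of the limit flight, by [S]; a
     shorter one ends at an additional bounce near [p]. *)
  have [te1|te1] := ltP (t_b Om q.1 q.2) e1; last first.
    exists q; split=> //; [by left|by near: q|].
    have Eq : closure Om q.1 -> q.2 != 0 -> t_b Om p.1 p.2 - e < t_b Om q.1 q.2 -> reaches W1 q by near: q.
    apply: Eq => //; rewrite ltNge; apply/negP => tle.
    have Sq : forall s, e1 / 2 <= s <= t_b Om p.1 p.2 - e / 2 -> Om (q.1 - s *: q.2) by near: q.
    have [_ nOq] := (boundaryE oOm _).1 bq; apply: nOq; apply: Sq.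
    rewrite (le_trans _ te1) ?ler_pdivrMr ?ler_pMr ?ler1n//= (le_trans tle)//.
    by rewrite lerD2l lerN2 ler_pdivrMr// ler_pMr// ler1n.
  have Aq : A (q.1 - t_b Om q.1 q.2 *: q.2).
    have Aq : forall s', `|s' - 0| < e1 -> A (q.1 - s' *: q.2) by near: q.
    by apply: Aq; rewrite subr0 ger0_norm.
  have Bq : B q.2 by near: q.
  have [Wq [Eq Nq]] := AB (_, q.2) (conj Aq Bq) bq.
  have cq : closure Om (bstep q).1 by case: bq.
  have q'0 : (bstep q).2 != 0 by exact: (reflect_neq0 HOm Hal).
  exists (bstep q); split=> //; first by right.
  apply: Eq => //; apply: Nq => //; split=> //=.
  rewrite (reflect_dot HOm Hal)// oppr_ge0.
  move: tq0; rewrite le_eqVlt => /predU1P[tq0|tq0]; last first.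
    by have [] := arrival HOm Hal clq q0 tq0.
  (* If the flight time is zero, the backward ray cannot enter the domain, as it would then last at
     least [r]. *)
  rewrite leNgt; apply/negP; rewrite -tq0 scale0r subr0 => qn.
  have Gq : boundary Om q.1 /\ 0 <= dot q.2 (n q.1) -> forall s, 0 < s < r -> Om (q.1 - s *: q.2) by near: q.
  have : r <= t_b Om q.1 q.2.
    apply: t_b_ge => //; [exact: ltW|apply: Gq; split; last exact: ltW].
    by move: bq; rewrite -tq0 scale0r subr0.
  by rewrite -tq0 leNgt r0.
apply: simple; near=> q => q0 _; rewrite (t_b_outward HOm Hal bp p0 vn) sub0r.
by rewrite (lt_le_trans (_ : - e < 0)) ?oppr_lt0// t_b_ge0.
Unshelve. all: by end_near. Qed.

Definition length_upto p k := \sum_(0 <= j < k) enorm ((iter j bstep p).1 - (iter j.+1 bstep p).1).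

Lemma length_recl p k : length_upto p k.+1 = enorm (p.1 - (bstep p).1) + length_upto (bstep p) k.
Proof.
rewrite /length_upto big_nat_recl//=; congr (_ + _); apply: eq_bigr => j _.
by rewrite -!iterSr.
Qed.

Lemma length_le p j k : (j <= k)%N -> length_upto p j <= length_upto p k.
Proof.
move=> jk; rewrite /length_upto (big_cat_nat (leq0n j) jk)//= lerDl.
by apply: sumr_ge0 => i _; exact: enorm_ge0.
Qed.

Lemma midflight p tau : closure Om p.1 -> p.2 != 0 -> 0 < tau < t_b Om p.1 p.2 ->
  [/\ Om (p.1 - tau *: p.2), bstep (p.1 - tau *: p.2, p.2) = bstep p &
   forall k, length_upto p k.+1 =
     enorm (p.1 - (p.1 - tau *: p.2)) + length_upto (p.1 - tau *: p.2, p.2) k.+1].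
Proof.
move=> clp p0 tauI; have [tau0 taut] := andP tauI.
have Oz : Om (p.1 - tau *: p.2) by exact: t_b_in.
have sh s : p.1 - tau *: p.2 - s *: p.2 = p.1 - (tau + s) *: p.2.
  by rewrite -addrA -opprD -scalerDl.
have tz : t_b Om (p.1 - tau *: p.2) p.2 = t_b Om p.1 p.2 - tau.
  apply/eqP; rewrite eq_le; apply/andP; split.
    apply: t_b_le => //; first by rewrite subr_gt0.
    rewrite sh subrKC; have /(boundaryE oOm)[] := t_b_boundary oOm bOm clp p0; by [].
  apply: t_b_ge => //; first by rewrite subr_ge0 ltW.
  move=> s /andP[s0 st]; rewrite sh; apply: t_b_in => //.
  by rewrite addr_gt0//= -ltrBrDl.
have bz : bstep (p.1 - tau *: p.2, p.2) = bstep p.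
  by rewrite /bstep/= tz sh subrKC.
split; [exact: Oz|exact: bz|move=> k].
rewrite (length_recl p) (length_recl (p.1 - tau *: p.2, p.2)) bz.
have -> : enorm (p.1 - (bstep p).1) = t_b Om p.1 p.2 * enorm p.2 by exact: (bstep_length HOm).
have -> : enorm (p.1 - tau *: p.2 - (bstep p).1) = (t_b Om p.1 p.2 - tau) * enorm p.2.
  by rewrite -tz -bz; exact: (bstep_length HOm (p := (p.1 - tau *: p.2, p.2))).
have -> : enorm (p.1 - (p.1 - tau *: p.2)) = tau * enorm p.2.
  by rewrite subKr enormZ gtr0_norm.
by rewrite addrA -mulrDl subrKC.
Qed.

Definition locally_bounded p (l : R) := exists K, \forall q \near p,
  closure Om q.1 -> q.2 != 0 -> exists2 k, (k <= K)%N & l < length_upto q k.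

Lemma locally_bounded_step p l d : regular p -> 0 < d -> locally_bounded (bstep p) l ->
  locally_bounded p (enorm (p.1 - (bstep p).1) - d + l).
Proof.
move=> rp d0 [K NK].
have d20 : 0 < d / 2 by rewrite divr_gt0.
have near_enorm (z : plane R * plane R) : \forall q \near z, enorm (q.1 - z.1) < d / 2.
  have d40 : 0 < d / 4 by rewrite divr_gt0.
  apply: filterS (near_fst z d40) => q [q1 _].
  rewrite (le_lt_trans (enorm_le_normr _))// mulrC -ltr_pdivlMr//; lra.
have nW1 : \forall z \near bstep p, enorm (z.1 - (bstep p).1) < d / 2 /\
   (closure Om z.1 -> z.2 != 0 -> exists2 k, (k <= K)%N & l < length_upto z k).
  by apply: filterS2 (near_enorm (bstep p)) NK.
have close (q z : plane R) : enorm (q - p.1) < d / 2 -> enorm (z - (bstep p).1) < d / 2 ->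
    enorm (p.1 - (bstep p).1) - d < enorm (q - z).
  have E (x y : plane R) : x - y = (q - z) + ((z - y) - (q - x)).
    by rewrite opprB (addrA (q - z)) subrKA addrC subrKA.
  move=> qp zp; rewrite ltrBlDr (E p.1).
  rewrite (le_lt_trans (enormD _ _))// ltrD2l (le_lt_trans (enormD _ _))// enormN.
  by rewrite (splitr d) ltrD.
(* One bounce for the step itself and one for the additional bounce allowed by [step_continuity].
   The loss [d] in length is shared by the displacements of the two ends of the step. *)
exists K.+2; apply: filterS (step_continuity rp (near_enorm p) nW1) => q Sq clq q0.
suff H : forall q', closure Om q'.1 -> q'.2 != 0 -> enorm (q'.1 - p.1) < d / 2 ->
   reaches (fun z => enorm (z.1 - (bstep p).1) < d / 2 /\
   (closure Om z.1 -> z.2 != 0 -> exists2 k, (k <= K)%N & l < length_upto z k)) q' ->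
   exists2 k, (k <= K.+1)%N & enorm (p.1 - (bstep p).1) - d + l < length_upto q' k.
  have [q' [q'E clq' q'0 q'p rq']] := Sq clq q0.
  have [k kK kl] := H q' clq' q'0 q'p rq'; case: q'E kl => -> kl.
    by exists k; [exact: leqW|exact: kl].
  exists k.+1; first by [].
  by rewrite length_recl (lt_le_trans kl)// lerDr enorm_ge0.
move=> q' clq' q'0 q'p [[xb B]|[tau tauI [xb B]]].
  have bq' : boundary Om (bstep q').1 by exact: t_b_boundary.
  have [k kK kl] := B (boundary_closure bq') (reflect_neq0 HOm Hal bq' q'0).
  exists k.+1; first by [].
  by rewrite length_recl; apply: ltrD kl; exact: close.
have [Oz _ lz] := midflight clq' q'0 tauI.
have [k kK kl] := B (subset_closure Oz) q'0.
exists k.+1; first by [].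
rewrite lz; apply: ltrD; first exact: close.
by apply: (lt_le_trans kl); apply: length_le.
Qed.

Lemma locally_bounded_length m p l : regular p -> (forall k, launch (iter k.+1 bstep p)) ->
  l < length_upto p m -> locally_bounded p l.
Proof.
elim: m p l => [|m IH] p l rp lp.
  rewrite /length_upto big_nil => l0; exists 0%N.
  by apply: filterE => q _ _; exists 0%N => //; rewrite /length_upto big_nil.
rewrite length_recl => Hl.
(* Half of the excess length is given up in this step, so that a strict inequality remains for the
   following ones. *)
pose d := (enorm (p.1 - (bstep p).1) + length_upto (bstep p) m - l) / 2.
have d0 : 0 < d by rewrite divr_gt0// subr_gt0.
have -> : l = enorm (p.1 - (bstep p).1) - d + (l - enorm (p.1 - (bstep p).1) + d) by ring.
apply: locally_bounded_step => //; apply: IH.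
- have l0 := lp 0; have [cl v0 _] := launch_start HOm Hal l0.
  by split=> //; exact: Or32.
- by move=> k; have := lp k.+1; rewrite iterSr.
- by rewrite /d; lra.
Qed.

End LocalBound.

(** * Discarded directions *)

Section StripMeasure.
Context {R : realType}.
Implicit Types (A : set (plane R)) (m v : plane R) (l N d : R).

Let mu := @lebesgue_measure R.

Lemma leb2_swap A : measurable A ->
  leb2 A = (mu \x^ mu)%E A.
Proof.
move=> mA; rewrite /leb2.
apply: product_measure_unique => // B1 B2 mB1 mB2.
exact: product_measure2E.
Qed.

Lemma integral_bounded_support (f : R -> \bar R) l N : 0 <= l -> 0 <= N ->
  measurable_fun setT f ->
  (forall x, 0%E <= f x)%E -> (forall x, (f x <= l%:E)%E) -> (forall x, N < `|x| -> f x = 0%E) ->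
  (\int[mu]_x f x <= (l * (2 * N))%:E)%E.
Proof.
move=> l0 N0 mf f0 fl fN; pose I : set R := `[- N, N]%classic.
have -> : (\int[mu]_x f x = \int[mu]_(x in I) f x)%E.
  rewrite [RHS]integral_mkcond; apply: eq_integral => x _.
  rewrite patchE; case: ifPn => // /negP xN; apply: fN.
  rewrite ltNge; apply/negP => xN'; apply: xN.
  by rewrite inE/I/= in_itv/= -ler_norml.
have -> : ((l * (2 * N))%:E = \int[mu]_(x in I) (cst l%:E) x)%E.
  rewrite integral_cst; last exact: measurable_itv.
  have E : mu I = (2 * N)%:E.
    rewrite /mu /I (lebesgue_measure_itv `[- N, N])/= lte_fin.
    case: ltP => NN; first by rewrite -EFinB; congr (_%:E); ring.
    have -> : N = 0 by lra.
    by rewrite mulr0.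
  by rewrite EFinM -E.
apply: ge0_le_integral.
- exact: measurable_itv.
- by move=> x _; exact: f0.
- exact: measurable_funTS mf.
- exact: measurable_cst.
- by move=> x _; exact: fl.
Qed.

Lemma leb2_strip_sections A l N : 0 <= l -> 0 <= N ->
  measurable A ->
  (exists c : R -> R, forall x y, A (x, y) -> `|x| <= N /\ `|y - c x| <= l) ->
  (leb2 A <= (2 * l * (2 * N))%:E)%E.
Proof.
move=> l0 N0 mA [c cP]; apply: integral_bounded_support => //.
- by rewrite mulr_ge0.
- exact: measurable_fun_xsection.
- move=> x; apply: (@le_trans _ _ (mu `[c x - l, c x + l]%classic)).
    apply: le_measure; rewrite ?inE//; first exact: measurable_xsection.
    move=> y; rewrite /xsection/= inE => /cP[_]; rewrite in_itv/= ler_distl//.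
  rewrite /mu (lebesgue_measure_itv `[c x - l, c x + l])/= lte_fin; case: ifPn => _; rewrite ?lee_fin ?mulr_ge0//.
  lra.
- move=> x Nx; rewrite /= (_ : xsection A x = set0) ?measure0//.
  apply/seteqP; split=> // y; rewrite /xsection/= inE => /cP[xN _].
  by move: Nx; rewrite ltNge xN.
Qed.

Lemma leb2_strip_ysections A l N : 0 <= l -> 0 <= N -> measurable A ->
  (exists c : R -> R, forall x y, A (x, y) -> `|y| <= N /\ `|x - c y| <= l) ->
  (leb2 A <= (2 * l * (2 * N))%:E)%E.
Proof.
move=> l0 N0 mA [c cP]; rewrite leb2_swap//; apply: integral_bounded_support => //.
- by rewrite mulr_ge0.
- exact: measurable_fun_ysection.
- move=> y; apply: (@le_trans _ _ (mu `[c y - l, c y + l]%classic)).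
    apply: le_measure; rewrite ?inE//; first exact: measurable_ysection.
    move=> x; rewrite /ysection/= inE => /cP[_]; rewrite in_itv/= ler_distl//.
  rewrite /mu (lebesgue_measure_itv `[c y - l, c y + l])/= lte_fin; case: ifPn => _; rewrite ?lee_fin ?mulr_ge0//.
  lra.
- move=> y Ny; rewrite /= (_ : ysection A y = set0) ?measure0//.
  apply/seteqP; split=> // x; rewrite /ysection/= inE => /cP[yN _].
  by move: Ny; rewrite ltNge yN.
Qed.

Definition strip m d : set (plane R) := [set v | `|dot v m| < d].

Lemma open_strip m d : open (strip m d).
Proof.
have -> : strip m d = (fun v => dot v m) @^-1` [set x | `|x| < d] by [].
apply: open_comp; last first.
  have -> : [set x : R | `|x| < d] = [set` `]- d, d[].
    by apply/seteqP; split=> x /=; rewrite in_itv/= ltr_norml.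
  exact: interval_open.
by move=> v _; apply: cvg_dot; [exact: cvg_id|exact: cvg_cst].
Qed.

Lemma measurable_dot m : measurable_fun setT (fun v : plane R => dot v m).
Proof.
apply: measurable_funD; apply: measurable_funM => //.
Qed.

Lemma measurable_strip m d : measurable (strip m d).
Proof.
have -> : strip m d = setT `&` (fun v => dot v m) @^-1` [set` `]- d, d[].
  by apply/seteqP; split=> x; rewrite /strip/= in_itv/= ltr_norml; [split|case].
apply: measurable_dot => //; exact: measurable_itv.
Qed.

Lemma measurable_VN N : 0 < N -> measurable (VN N).
Proof.
move=> N0; have -> : VN N = setT `&` (fun v : plane R => dot v v) @^-1` [set` `[(2 / N) ^+ 2, (N / 2) ^+ 2]].
  have E v : (2 / N <= enorm v <= N / 2) = ((2 / N) ^+ 2 <= dot v v <= (N / 2) ^+ 2).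
    by rewrite -enorm_sqr !ler_pXn2r// nnegrE ?enorm_ge0// ltW// divr_gt0.
  by apply/seteqP; split=> v; rewrite /VN/= in_itv/= E; [split|case].
have mdd : measurable_fun setT (fun v : plane R => dot v v).
  by apply: measurable_funD; apply: measurable_funM.
by apply: mdd => //; exact: measurable_itv.
Qed.

Lemma VN_box N v : VN N v -> `|v.1| <= N / 2 /\ `|v.2| <= N / 2.
Proof.
move=> /andP[_ vN]; split; apply: le_trans vN; apply: le_trans (normr_le_enorm v);
  by rewrite prod_normE/= le_max lexx ?orbT.
Qed.

Lemma half_abs (a b d x y : R) : 2^-1 <= `|b| -> `|x * a + y * b| < d ->
  `|y - (- (a / b) * x)| <= 2 * d.
Proof.
move=> b2 xyd; have b0 : 0 < `|b| by apply: lt_le_trans b2.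
have bn0 : b != 0 by rewrite -normr_gt0.
have -> : y - (- (a / b) * x) = (x * a + y * b) / b by field.
rewrite normrM normfV ler_pdivrMr// (le_trans (ltW xyd))//.
by rewrite mulrAC ler_peMl// ?(le_trans _ (ltW xyd))//; lra.
Qed.

(** A unit vector has a coordinate of absolute value at least 1/2. Sections of the strip in that
    coordinate lie in intervals of length [4 * d], and the other coordinate ranges over an interval
    of length [N]. *)
Lemma leb2_strip m d N : dot m m = 1 -> 0 <= d -> 0 < N ->
  (leb2 (strip m d `&` VN N) <= (4 * d * N)%:E)%E.
Proof.
move=> m1 d0 N0; have N20 : 0 <= N / 2 by rewrite divr_ge0// ltW.
have mS : measurable (strip m d `&` VN N) by apply: measurableI; [exact: measurable_strip|exact: measurable_VN].
have -> : 4 * d * N = 2 * (2 * d) * (2 * (N / 2)) by field.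
have d20 : 0 <= 2 * d by rewrite mulr_ge0.
have [m2|m2] := leP 2^-1 `|m.2|.
  apply: leb2_strip_sections => //; exists (fun x => - (m.1 / m.2) * x) => x y [/= s /VN_box[xN _]].
  by split=> //; exact: half_abs.
have {}m2 : 2^-1 <= `|m.1|.
  rewrite leNgt; apply/negP => m1'.
  move: m1; rewrite /dot -!expr2 -(real_normK (num_real m.1)) -(real_normK (num_real m.2)).
  have := normr_ge0 m.1; have := normr_ge0 m.2.
  move: (`|m.1|) (`|m.2|) m1' m2 => p q; nra.
apply: leb2_strip_ysections => //; exists (fun y => - (m.2 / m.1) * y) => x y [/= s /VN_box[_ yN]].
by split=> //; apply: half_abs => //; rewrite addrC.
Qed.

(** The widths are chosen so that the strip of index [k] has measure at most [e / 2 ^ k.+1], whence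
    a geometric series with sum [e]. *)
Lemma leb2_strips m0 d0 (m : nat -> plane R) e N : 0 < N -> 0 <= d0 -> 0 <= e -> dot m0 m0 = 1 ->
  (forall k, dot (m k) (m k) = 1) ->
  (leb2 ((strip m0 d0 `|` \bigcup_k strip (m k) (e / (4 * N) / (2 ^ k.+1)%:R)) `&` VN N)
     <= (4 * d0 * N + e)%:E)%E.
Proof.
move=> N0 d00 e0 m01 m1; rewrite setIUl setI_bigcupl.
have mV := measurable_VN N0.
have mS k : measurable (strip (m k) (e / (4 * N) / (2 ^ k.+1)%:R) `&` VN N).
  by apply: measurableI => //; exact: measurable_strip.
have mS0 : measurable (strip m0 d0 `&` VN N) by apply: measurableI => //; exact: measurable_strip.
pose nu : {measure set (measurableTypeR R * measurableTypeR R) -> \bar R} :=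
  (@lebesgue_measure R \x @lebesgue_measure R)%E.
have mU := bigcupT_measurable _ mS.
apply: le_trans (measureU2 nu mS0 mU) _.
rewrite EFinD; apply: leeD; first exact: leb2_strip.
apply: le_trans (measure_sigma_subadditive nu mS mU (@subset_refl _ _)) _.
apply: le_trans (epsilon_trick0 _ e0); apply: lee_nneseries => // k _.
apply: le_trans (leb2_strip _ _ _) _ => //; first by rewrite !divr_ge0// mulr_ge0// ltW.
rewrite lee_fin le_eqVlt; apply/orP; left; apply/eqP; field.
by rewrite !gt_eqF// ltr0n expn_gt0.
Qed.

End StripMeasure.

(** * Time reversal and the directions of singular grazing *)

Section BadDirections.
Context {R : realType} (M : nat).
Variables (Om : set (plane R)) (Omi : 'I_M.+1 -> set (plane R)).
Variables (a b : 'I_M.+1 -> R) (al : 'I_M.+1 -> R -> plane R).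
Hypothesis HOm : analytic_nonconvex_domain Om Omi.
Hypothesis Hal : arclength_boundary Om Omi a b al.
Implicit Types (x y u v w : plane R) (p q : plane R * plane R) (i : 'I_M.+1) (t s c : R).

Let oOm := open_domain HOm.
Let bOm := bounded_domain HOm.
Local Notation n := (normal Om).
Local Notation bstep := (bstep Om).
Local Notation launch := (launch Om a b al).
Local Notation singular := (singular a b al).

(* Time reversal of [bstep]. *)
Definition rstep q : plane R * plane R :=
  (q.1 - t_b Om q.1 (- Defs.reflect Om q.1 q.2) *: - Defs.reflect Om q.1 q.2, Defs.reflect Om q.1 q.2).

Lemma t_bZ c x v : 0 < c -> v != 0 -> t_b Om x (c *: v) = t_b Om x v / c.
Proof.
have H c' v' : 0 < c' -> v' != 0 -> t_b Om x v' / c' <= t_b Om x (c' *: v').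
  move=> c0 v0; apply: t_b_ge => //.
  - by rewrite scaler_eq0 negb_or v0 gt_eqF.
  - by rewrite divr_ge0 ?t_b_ge0// ltW.
  move=> tau /andP[t0 t1]; rewrite scalerA; apply: t_b_in => //.
  by rewrite mulr_gt0//= -ltr_pdivlMr.
move=> c0 v0; apply/eqP; rewrite eq_le H// andbT ler_pdivlMr//.
have := H c^-1 (c *: v); rewrite invrK scalerA mulVf ?gt_eqF// scale1r; apply; first by rewrite invr_gt0.
by rewrite scaler_eq0 negb_or v0 gt_eqF.
Qed.

Lemma reflectK x v : boundary Om x -> Defs.reflect Om x (Defs.reflect Om x v) = v.
Proof.
move=> bx; rewrite {1}/Defs.reflect (dotC (n x)) (reflect_dot HOm Hal _ bx) /Defs.reflect (dotC v).
by rewrite mulrN scaleNr opprK subrK.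
Qed.

Lemma reflectZ x c v : Defs.reflect Om x (c *: v) = c *: Defs.reflect Om x v.
Proof. by rewrite /Defs.reflect dotZr scalerBr scalerA; congr (_ - _ *: _); ring. Qed.

Lemma rstep_boundary q : boundary Om q.1 -> q.2 != 0 ->
  boundary Om (rstep q).1 /\ (rstep q).2 != 0.
Proof.
move=> bq q0; have r0 := reflect_neq0 HOm Hal bq q0.
by split=> //; apply: t_b_boundary => //; rewrite ?oppr_eq0//; case: bq.
Qed.

Lemma iter_rstep_boundary q k : boundary Om q.1 -> q.2 != 0 ->
  boundary Om (iter k rstep q).1 /\ (iter k rstep q).2 != 0.
Proof. by move=> bq q0; elim: k => //= k [? ?]; exact: rstep_boundary. Qed.

Lemma iter_rstep_sqr q k : boundary Om q.1 -> q.2 != 0 ->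
  dot (iter k rstep q).2 (iter k rstep q).2 = dot q.2 q.2.
Proof.
move=> bq q0; elim: k => //= k IH; rewrite -IH.
by apply: (reflect_sqr HOm Hal); have [] := iter_rstep_boundary k bq q0.
Qed.

Lemma rstepZ c x v : 0 < c -> boundary Om x -> v != 0 ->
  rstep (x, c *: v) = ((rstep (x, v)).1, c *: (rstep (x, v)).2).
Proof.
move=> c0 bx v0; rewrite /rstep/= !reflectZ -(scalerN c) t_bZ ?oppr_eq0 ?(reflect_neq0 HOm Hal)//.
by rewrite scalerA divfK// gt_eqF.
Qed.

(** Speed does not affect the path, so at each singular parameter it suffices to reverse from the
    two unit tangents; this is what makes the exceptional directions countable. *)
Lemma iter_rstepZ c x v k : 0 < c -> boundary Om x -> v != 0 ->
  iter k rstep (x, c *: v) = ((iter k rstep (x, v)).1, c *: (iter k rstep (x, v)).2).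
Proof.
move=> c0 bx v0; elim: k => //= k ->.
have [bk k0] := @iter_rstep_boundary (x, v) k bx v0.
by rewrite rstepZ// -(surjective_pairing (iter k rstep (x, v))).
Qed.

Lemma rstep_bstep_velocity p : closure Om p.1 -> p.2 != 0 -> (rstep (bstep p)).2 = p.2.
Proof. by move=> clp p0; rewrite /rstep/= reflectK//; exact: (bstep_boundary HOm clp p0). Qed.

Lemma rstep_bstep p : launch p -> rstep (bstep p) = p.
Proof.
move=> lp; have [bp p0 _] := lp; have t0 := launch_t_b HOm Hal lp.
have clp : closure Om p.1 by case: bp.
rewrite /rstep /= reflectK; last exact: (bstep_boundary HOm clp p0).
have E s : p.1 - t_b Om p.1 p.2 *: p.2 - s *: - p.2 = p.1 - (t_b Om p.1 p.2 - s) *: p.2.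
  by rewrite scalerN opprK scalerBl opprB -addrA (addrC (- _)).
suff -> : t_b Om (p.1 - t_b Om p.1 p.2 *: p.2) (- p.2) = t_b Om p.1 p.2.
  by rewrite E subrr scale0r subr0 -surjective_pairing.
apply/eqP; rewrite eq_le; apply/andP; split.
  apply: t_b_le => //; first by rewrite oppr_eq0.
  by rewrite E subrr scale0r subr0; case/(boundaryE oOm): bp.
apply: t_b_ge => //; first by rewrite oppr_eq0.
  exact: ltW.
by move=> s /andP[s0 st]; rewrite E; apply: t_b_in => //; rewrite subr_gt0 st gtrBl.
Qed.

Lemma iter_rstep_bstep p k : (forall j, (j < k)%N -> launch (iter j.+1 bstep p)) ->
  iter k rstep (iter k.+1 bstep p) = bstep p.
Proof.
elim: k => [//|k IH] H; rewrite iterSr (iterS k.+1) rstep_bstep; last exact: H.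
by apply: IH => j jk; apply: H; rewrite ltnS ltnW.
Qed.

(** An interior initial position is not recovered, since the reversed flight runs on to the
    boundary; its velocity is, and only the direction matters. *)
Lemma initial_velocity p k : closure Om p.1 -> p.2 != 0 ->
  (forall j, (j < k)%N -> launch (iter j.+1 bstep p)) ->
  (iter k.+1 rstep (iter k.+1 bstep p)).2 = p.2.
Proof. by move=> clp p0 H; rewrite iterS iter_rstep_bstep// rstep_bstep_velocity. Qed.

Lemma unit_tangent i t : a i <= t <= b i -> dot (nderiv 1 (al i) t) (nderiv 1 (al i) t) = 1.
Proof. by move=> tI; have [_ _ T1 _] := Hal i; rewrite -enorm_sqr T1// expr1n. Qed.

Lemma grazing_tangent i t v : a i <= t <= b i -> v != 0 -> dot v (n (al i t)) = 0 ->
  exists sg : bool, exists2 c, 0 < c & v = c *: ((-1) ^+ sg *: nderiv 1 (al i) t).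
Proof.
move=> tI v0; rewrite (normal_arc Hal tI) => vn.
have T1 := unit_tangent tI.
have vE := frame_decomposition v T1; rewrite -/(right_normal (al i) t) vn scale0r addr0 in vE.
set c := dot v _ in vE.
have c0 : c != 0 by apply/eqP => c0; move: v0; rewrite vE c0 scale0r eqxx.
exists (c < 0)%R; exists `|c|; first by rewrite normr_gt0.
by rewrite scalerA mulrC -numEsign.
Qed.

(* A grazing hit of one of the finitely many singular points determines the
   initial direction by time reversal, up to the number of bounces. *)
Lemma countable_singular_directions : exists m : nat -> plane R, (forall k, dot (m k) (m k) = 1) /\
  forall p k, closure Om p.1 -> p.2 != 0 ->
    (forall j, (j < k)%N -> launch (iter j.+1 bstep p)) ->
    singular (iter k.+1 bstep p).1 ->
    dot (iter k.+1 bstep p).2 (n (iter k.+1 bstep p).1) = 0 ->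
    exists j, dot p.2 (m j) = 0.
Proof.
have [zs zsP] : {zs : 'I_M.+1 -> seq R & forall i t, a i <= t <= b i ->
    [\/ curvature (al i) t = 0, t = a i | t = b i] -> t \in zs i}.
  suff H i : exists z : seq R, forall t, a i <= t <= b i ->
    [\/ curvature (al i) t = 0, t = a i | t = b i] -> t \in z by exact: (choice H).
  have [ci _ ui _] := Hal i; have [z zP] := finite_curvature_zeros ci ui.
  exists [:: a i, b i & z] => t tI; rewrite !inE; case=> [k0|->|->]; rewrite ?eqxx ?orbT//.
  by rewrite zP ?orbT.
pose d (z : nat * 'I_M.+1 * nat * bool) : plane R := let: (k, i, j, sg) := z in
  (iter k.+1 rstep (al i (nth 0 (zs i) j), (-1) ^+ sg *: nderiv 1 (al i) (nth 0 (zs i) j))).2.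
(* Rotation by a right angle expresses parallelism to [d z] as [dot p.2 (m j) = 0]; meaningless
   indices receive an arbitrary unit vector. *)
pose perp z : plane R := if dot (d z) (d z) == 1 then ((d z).2, - (d z).1) else (1, 0).
pose m j := if unpickle j is Some z then perp z else (1, 0) : plane R.
exists m; split=> [j|p k clp p0 H [i [t [tI xE tS]]] gr].
  rewrite /m; case: (unpickle j) => [z|]; rewrite /perp /dot/= ?mulr1 ?mulr0 ?addr0//.
  by case: ifP => [/eqP <-|]; rewrite /= ?mulr1 ?mulr0 ?addr0//; rewrite /dot; ring.
have v0 : (iter k.+1 bstep p).2 != 0.
  case: k H {xE gr} => [|k] H; first exact: (reflect_neq0 HOm Hal (bstep_boundary HOm clp p0) p0).
  have [bq q0 _] := H k (ltnSn k).
  by apply: (reflect_neq0 HOm Hal (bstep_boundary HOm _ q0) q0); case: bq.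
have [sg [c c0 vE]] := grazing_tangent tI v0 (etrans (congr1 (fun y => dot _ (n y)) (esym xE)) gr).
have tz := zsP i t tI tS.
pose z := (k, i, index t (zs i), sg); exists (pickle z); rewrite /m pickleK.
have bt : boundary Om (al i t) by apply/(boundaryP HOm Hal); exists i, t.
set T := _ *: nderiv _ _ _ in vE.
have T0 : T != 0 by apply/eqP => T0; move: v0; rewrite vE T0 scaler0 eqxx.
have dE : d z = (iter k.+1 rstep (al i t, T)).2 by rewrite /d /z nth_index.
have pE : p.2 = c *: d z.
  have aux q : q.1 = al i t -> q.2 = c *: T -> (iter k.+1 rstep q).2 = c *: d z.
    by move=> q1 q2; rewrite dE (surjective_pairing q) q1 q2 iter_rstepZ.
  exact: etrans (esym (initial_velocity clp p0 H)) (aux _ xE vE).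
have d1 : dot (d z) (d z) = 1.
  rewrite dE (iter_rstep_sqr k.+1 (q := (al i t, T)) bt T0) /T dotZl dotZr mulrA -expr2 sqrr_sign mul1r.
  exact: unit_tangent.
by rewrite /perp d1 eqxx pE dotZl /dot/= mulrN (mulrC (d z).2) subrr mulr0.
Qed.

End BadDirections.

(** * Endpoints of the set of positive curvature *)

Section Inflection.
Context {R : realType}.
Implicit Types (t s c d : R).

Lemma segment_endpoint_nbhs c d t : c <= d -> t = c \/ t = d ->
  ~ \forall s \near t, c <= s <= d.
Proof.
move=> cd tE /near_distP[e e0 eP]; have e20 : 0 < e / 2 by rewrite divr_gt0.
have e2e : e / 2 < e by rewrite ltr_pdivrMr// ltr_pMr// ltr1n.
case: tE => tE.
  have /andP[] : c <= t - e / 2 <= d by apply: eP; rewrite addrAC subrr sub0r normrN gtr0_norm.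
  by rewrite tE lerBrDr gerDl leNgt e20.
have /andP[_] : c <= t + e / 2 <= d by apply: eP; rewrite addrAC subrr add0r gtr0_norm.
by rewrite tE gerDl leNgt e20.
Qed.

(** A negative value at [t] keeps the closure away. At an interior [t] with positive value the
    closure contains a neighbourhood; the other finitely many closed intervals stay away from [t],
    so a single interval contains a neighbourhood of its own endpoint. *)
Lemma interval_endpoint_zero (f : R -> R) a b k (cd : 'I_k -> R * R) j t :
  finite_disjoint_intervals (closure [set t | a <= t <= b /\ 0 < f t]) cd ->
  (forall t, a <= t <= b -> {for t, continuous f}) ->
  t = (cd j).1 \/ t = (cd j).2 ->
  a <= t <= b /\ [\/ f t = 0, t = a | t = b].
Proof.
move=> [cdle dis KE] fc tE.
have tj : `[(cd j).1, (cd j).2]%classic t.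
  by rewrite /= in_itv/=; case: tE => ->; rewrite lexx ?andbT; exact: cdle.
have Kt : closure [set t | a <= t <= b /\ 0 < f t] t by rewrite KE; exists j.
have tI : a <= t <= b.
  have : `[a, b]%classic t.
    rewrite (closure_id `[a, b]%classic).1; last exact: itv_closed.
    by apply: closure_subset Kt => s [sI _]; rewrite /= in_itv.
  by rewrite /= in_itv.
split=> //; apply: contrapT => nS.
have f0 : f t != 0 by apply/eqP => f0; apply: nS; exact: Or31.
have at_ : a < t.
  by rewrite lt_neqAle; have /andP[-> _] := tI; rewrite andbT; apply/eqP => E; apply: nS; exact: Or32.
have tb : t < b.
  by rewrite lt_neqAle; have /andP[_ ->] := tI; rewrite andbT; apply/eqP => E; apply: nS; exact: Or33.
move: f0; rewrite neq_lt => /orP[fn|fp].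
  have [s [[_ fs] fs']] := Kt _ (cvgr_lt _ (fc t tI) _ fn).
  by have := lt_trans fs fs'; rewrite ltxx.
have NK : \forall s \near t, closure [set t | a <= t <= b /\ 0 < f t] s.
  near=> s; apply: subset_closure; split; last by near: s; exact: cvgr_gt _ (fc t tI) _ fp.
  apply/andP; split; apply: ltW; near: s; [exact: lt_nbhsr|exact: lt_nbhsl].
have ND : \forall s \near t, forall j', j' != j -> ~ `[(cd j').1, (cd j').2]%classic s.
  apply: (@filter_forall _ _ (fun j' s => j' != j -> ~ `[(cd j').1, (cd j').2]%classic s) _ (nbhs_filter t)) => j'.
  have [->|jj] := eqVneq j' j; first by near=> s.
  have : \forall s \near t, (~` `[(cd j').1, (cd j').2]%classic) s.
    apply: open_nbhs_nbhs; split; first by apply: closed_openC; exact: itv_closed.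
    move=> tj'; have : set0 t by rewrite -(dis _ _ jj).
    by [].
  by apply: filterS => s ns _.
apply: (segment_endpoint_nbhs (cdle j) tE).
near=> s; have : closure [set t | a <= t <= b /\ 0 < f t] s by near: s.
rewrite KE => -[j' _]; have [->|jj] := eqVneq j' j; first by rewrite /= in_itv.
by move=> H; exfalso; move: j' jj H; near: s.
Unshelve. all: by end_near. Qed.

End Inflection.

(** * Generic trajectories and compactness of the state space *)

Section Cover.
Context {R : realType} (M : nat).
Variables (Om : set (plane R)) (Omi : 'I_M.+1 -> set (plane R)).
Variables (a b : 'I_M.+1 -> R) (al : 'I_M.+1 -> R -> plane R).
Hypothesis HOm : analytic_nonconvex_domain Om Omi.
Hypothesis Hal : arclength_boundary Om Omi a b al.
Implicit Types (x y u v w : plane R) (p q : plane R * plane R) (i : 'I_M.+1) (t s c : R).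

Let oOm := open_domain HOm.
Let bOm := bounded_domain HOm.
Local Notation n := (normal Om).
Local Notation bstep := (bstep Om).
Local Notation launch := (launch Om a b al).
Local Notation singular := (singular a b al).
Local Notation regular := (regular Om a b al).

Lemma inflection_singular x : inflection_boundary a b al x -> singular x.
Proof.
move=> [i [k [cd [H [j xE]]]]]; have [ci _ ui _] := Hal i.
have [t [tE ->]] : exists t, (t = (cd j).1 \/ t = (cd j).2) /\ x = al i t.
  by case: xE => ->; [exists (cd j).1|exists (cd j).2]; split=> //; [left|right].
have [tI S] := interval_endpoint_zero H (curvature_cvg ci ui) tE.
by exists i, t.
Qed.

Lemma cycle_bstep t x v k : ((Defs.cycle Om t x v k).1.2, (Defs.cycle Om t x v k).2) = iter k bstep (x, v).
Proof.
elim: k => //= k <-; rewrite /Defs.cycle/=.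
by case: (iter k (bounce Om) _) => -[t' x'] v'.
Qed.

Lemma tcS t x v k : tc Om t x v k.+1 =
  tc Om t x v k - t_b Om (iter k bstep (x, v)).1 (iter k bstep (x, v)).2.
Proof.
rewrite -(cycle_bstep t) /tc /Defs.cycle/=.
by case: (iter k (bounce Om) _) => -[t' x'] v'.
Qed.

(** From the first bounce on all flights have positive duration, so the bounce times decrease
    strictly and a single index is selected. The index 0 is left out because the first flight may
    have zero duration. *)
Lemma char_bounce t x v k : v != 0 -> (forall j, launch (iter j.+1 bstep (x, v))) ->
  (0 < k)%N ->
  (Xchar Om (tc Om t x v k) t x v, Vchar Om (tc Om t x v k) t x v) = iter k bstep (x, v).
Proof.
move=> v0 H k0.
have dec j : (0 < j)%N -> tc Om t x v j.+1 < tc Om t x v j.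
  by case: j => // j _; rewrite tcS ltrBlDr ltrDl (launch_t_b HOm Hal).
have mono l j : (l <= j)%N -> tc Om t x v j <= tc Om t x v l.
  elim: j => [|j IH]; first by rewrite leqn0 => /eqP ->.
  rewrite leq_eqVlt => /predU1P[->//|lj]; apply: le_trans (IH lj).
  by case: j {IH lj} => [|j]; [rewrite tcS gerBl t_b_ge0|apply/ltW/dec].
suff E : char_index Om (tc Om t x v k) t x v = k.
  rewrite /Xchar /Vchar E subrr scale0r addr0; exact: cycle_bstep.
rewrite /char_index; set S := [set j | _].
have Sk : S k by left; rewrite dec//=.
have [/andP[j1 j2]|[_ st]] : S (xget 0%N S) := xgetPex _ (ex_intro _ k Sk); last first.
  by have := dec _ (ltn0Sn (xget 0%N S)); rewrite (st _ (leqW (leqnSn _))) (st _ (leqnSn _)) ltxx.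
set j := xget 0%N S in j1 j2 *; apply/eqP; rewrite eqn_leq; apply/andP; split.
  rewrite leqNgt; apply/negP => kj; have := lt_le_trans (dec k k0) j2.
  by rewrite ltNge mono.
by rewrite leqNgt; apply/negP => jk; move: j1; rewrite ltNge mono.
Qed.

Lemma generic_launch (m : nat -> plane R) p :
  (forall p k, closure Om p.1 -> p.2 != 0 ->
    (forall j, (j < k)%N -> launch (iter j.+1 bstep p)) ->
    singular (iter k.+1 bstep p).1 ->
    dot (iter k.+1 bstep p).2 (n (iter k.+1 bstep p).1) = 0 ->
    exists j, dot p.2 (m j) = 0) ->
  start Om p -> (forall j, dot p.2 (m j) != 0) ->
  (forall k, launch (iter k.+1 bstep p)) /\
  (forall k, ~ (singular (iter k.+1 bstep p).1 /\
     dot (iter k.+1 bstep p).2 (n (iter k.+1 bstep p).1) = 0)).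
Proof.
move=> mP sp pm; have [clp p0 _] := sp.
have NS k : (forall j, (j < k)%N -> launch (iter j.+1 bstep p)) ->
    ~ (singular (iter k.+1 bstep p).1 /\
     dot (iter k.+1 bstep p).2 (n (iter k.+1 bstep p).1) = 0).
  by move=> H [S G]; have [j /eqP] := mP p k clp p0 H S G; apply/negP.
have L k : launch (iter k.+1 bstep p).
  elim/ltn_ind: k => k IH.
  have [clk k0 tk] : start Om (iter k bstep p).
    by case: k IH => [//|k] IH; apply: (launch_start HOm Hal); exact: IH.
  exact: (bstep_launch HOm Hal clk k0 tk (NS k IH)).
by split=> // k; apply: NS.
Qed.

Lemma eball_open x (r : R) : open (eball x r).
Proof.
rewrite /eball (_ : mkset _ = (fun y => enorm (y - x)) @^-1` [set s | s < r])//.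
apply: open_comp; last exact: open_lt.
by move=> y _; apply: cvg_enorm; apply: cvgB; [exact: cvg_id|exact: cvg_cst].
Qed.

Lemma eball_center x (r : R) : 0 < r -> eball x r x.
Proof. by rewrite /eball/= subrr enorm0. Qed.

Lemma normal_nearly_constant x (eta : R) : closure Om x -> 0 < eta ->
  exists r : R, 0 < r /\ exists m : plane R, dot m m = 1 /\
    forall y, boundary Om y -> eball x r y -> enorm (n y - m) < eta.
Proof.
move=> clx e0; have [Ox|nOx] := pselect (Om x).
  have /near_normP[r r0 rP] : \forall y \near x, Om y by exact: open_nbhs_nbhs (conj oOm Ox).
  (* The ball misses the boundary, and any unit vector serves. *)
  exists r; split=> //; exists (1, 0); split; first by rewrite /dot/= mulr1 mulr0 addr0.
  move=> y /(boundaryE oOm)[_ nOy] xy; case: nOy; apply: rP.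
  exact: le_lt_trans (normr_le_enorm _) xy.
have bx : boundary Om x by apply/(boundaryE oOm).
have e40 : 0 < eta / 4 by rewrite divr_gt0.
have /near_normP[r r0 rP] : \forall y \near x, boundary Om y -> `|n x - n y| < eta / 4.
  exact: (cvgr_dist_lt _ _ (normal_cvg HOm Hal bx) _ e40).
exists r; split=> //; exists (n x); split; first exact: (normal_unit HOm Hal bx).
move=> y bY xy; have := rP y (le_lt_trans (normr_le_enorm _) xy) bY.
rewrite distrC => H; apply: (le_lt_trans (enorm_le_normr _)).
apply: (@lt_trans _ _ (2 * (eta / 4))); first by rewrite ltr_pM2l.
by rewrite mulrCA gtr_pMr// ltr_pdivrMr// mul1r ltr_nat.
Qed.

Lemma closure_compact : compact (closure Om).
Proof.
have [K [_ KP]] := bOm; have {}KP := KP (`|K| + 1).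
pose B : set (plane R) := `[- (`|K| + 1), `|K| + 1]%classic `*` `[- (`|K| + 1), `|K| + 1]%classic.
have cB : compact B by apply: compact_setX; exact: segment_compact.
apply: (subclosed_compact _ cB); first exact: closed_closure.
have clB : closed B by apply: compact_closed.
rewrite (closure_id B).1//; apply: closure_subset => y Oy.
have : `|y| <= `|K| + 1 by apply: KP => //; rewrite (le_lt_trans (ler_norm K))// ltrDl.
by rewrite prod_normE/= ge_max !ler_norml /B/= !in_itv/= => /andP[].
Qed.

Lemma VN_compact (N : R) : compact (VN N).
Proof.
pose B : set (plane R) := `[- (N / 2), N / 2]%classic `*` `[- (N / 2), N / 2]%classic.
have cB : compact B by apply: compact_setX; exact: segment_compact.
apply: (subclosed_compact _ cB).
  rewrite (_ : VN N = @enorm R @^-1` `[2 / N, N / 2]%classic); last first.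
    by apply/seteqP; split=> v /=; rewrite in_itv.
  apply: preimage_closed; last exact: itv_closed.
  by move=> v _; apply: cvg_enorm; exact: cvg_id.
by move=> v /VN_box[v1 v2]; rewrite /B/= !in_itv/= -!ler_norml.
Qed.

End Cover.

(* [compact_cover] needs the join of the pointed and the topological structure. *)
HB.instance Definition _ (R : realType) := Pointed.on (plane R).

(** * Uniform bound *)

Section Main.
Context {R : realType} (M : nat).
Variables (Om : set (plane R)) (Omi : 'I_M.+1 -> set (plane R)).
Variables (a b : 'I_M.+1 -> R) (al : 'I_M.+1 -> R -> plane R).
Hypothesis HOm : analytic_nonconvex_domain Om Omi.
Hypothesis Hal : arclength_boundary Om Omi a b al.
Implicit Types (x y u v w : plane R) (p q : plane R * plane R) (t s c : R).

Let oOm := open_domain HOm.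
Let bOm := bounded_domain HOm.
Local Notation n := (normal Om).
Local Notation bstep := (bstep Om).
Local Notation launch := (launch Om a b al).
Local Notation singular := (singular a b al).
Local Notation regular := (regular Om a b al).
Local Notation length_upto := (length_upto Om).

Lemma transversal_regular x v : closure Om x -> v != 0 ->
  (boundary Om x -> dot v (n x) != 0) -> regular (x, v).
Proof.
move=> clx v0 H; split=> //; have [Ox|nOx] := pselect (Om x); first exact: Or31.
have bx : boundary Om x by apply/(boundaryE oOm).
have := H bx; rewrite neq_lt => /orP[vn|vn]; first exact: Or33.
by apply: Or32; split=> //; left.
Qed.

(** At speed at most [N / 2], a change of the normal by [q / N] alters the normal component by at
    most [q / 2]; this is the reason for the half-width [2 * q] of the tangential strips. *)
Lemma transversal_normal v (mu nu : plane R) (N q : R) : 0 < N -> 0 < q ->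
  enorm v <= N / 2 -> 2 * q <= `|dot v mu| -> enorm (nu - mu) < q / N ->
  q < `|dot v nu|.
Proof.
move=> N0 q0 vN vmu d.
have H : `|dot v (nu - mu)| <= q / 2.
  apply: (le_trans (dot_le_enorm _ _)); apply: (@le_trans _ _ (N / 2 * (q / N))).
    by apply: ler_pM; rewrite ?enorm_ge0// ltW.
  by rewrite le_eqVlt; apply/orP; left; apply/eqP; field; rewrite gt_eqF.
have -> : dot v nu = dot v mu + dot v (nu - mu) by rewrite dotBr addrC subrK.
have := lerB_normD (dot v mu) (dot v (nu - mu)).
move: (`|dot v mu|) (`|dot v (nu - mu)|) (`|_ + _|) H vmu => A B C; lra.
Qed.

Lemma VN_neq0 (N : R) v : 0 < N -> VN N v -> v != 0.
Proof.
move=> N0 /andP[v1 _]; apply/eqP => v0; move: v1; rewrite v0 enorm0.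
by rewrite leNgt divr_gt0.
Qed.

(** Covering the length [N * T0] at speed at most [N / 2] takes at least the time [2 * T0], so the
    condition on bouncing times in [[0, T0]] recorded by [is_IB_data] does not reach far enough. The
    second conclusion concerns all bounces. *)
Lemma infinite_bounces_data (T0 eps N : R) : 0 < eps -> 2 < N ->
  exists2 D : IB_data, is_IB_data Om (inflection_boundary a b al) 20 T0 eps N D &
    forall p, closure Om p.1 -> VN N p.2 -> ~ IB Om N D p ->
      regular p /\ forall k, launch (iter k.+1 bstep p).
Proof.
move=> e0 N2; have N0 : 0 < N by apply: lt_trans N2.
have [m [m1 mP]] := countable_singular_directions HOm Hal.
(* The transversality threshold prescribed in [is_IB_data]. *)
pose q := eps / N ^+ 4; have q0 : 0 < q by rewrite divr_gt0// exprn_gt0.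
have qN0 : 0 < q / N by rewrite divr_gt0.
have [f fP] : {f : plane R -> R * plane R & forall x, closure Om x ->
    [/\ 0 < (f x).1, dot (f x).2 (f x).2 = 1 &
      forall y, boundary Om y -> eball x (f x).1 y -> enorm (n y - (f x).2) < q / N]}.
  suff H x : exists z : R * plane R, closure Om x -> [/\ 0 < z.1, dot z.2 z.2 = 1 &
      forall y, boundary Om y -> eball x z.1 y -> enorm (n y - z.2) < q / N] by exact: (choice H).
  have [clx|nclx] := pselect (closure Om x); last by exists 0.
  by have [r [r0 [mu [mu1 muP]]]] := normal_nearly_constant HOm Hal clx qN0; exists (r, mu).
have cc : cover_compact (closure Om).
  by rewrite -compact_cover; exact: (closure_compact HOm).
have [||s sD sP] := cc (plane R) (closure Om) (fun x => eball x (f x).1).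
- by move=> x _; exact: eball_open.
- by move=> x clx; exists x => //; apply: eball_center; have [] := fP x clx.
pose w k : R := eps / (4 * N) / (2 ^ k.+1)%:R.
have w0 k : 0 < w k by rewrite !divr_gt0 ?mulr_gt0// ltr0n expn_gt0.
pose U x := strip (f x).2 (2 * q) `|` \bigcup_k strip (m k) (w k).
pose z := finmap.enum_fset s.
pose D := @IBData R (size z) (fun i => nth 0 z i) (fun i => (f (nth 0 z i)).1)
  (fun i => U (nth 0 z i) `&` VN N).
have clz (i : 'I_(size z)) : closure Om (nth 0 z i).
  by apply/set_mem/sD; apply: mem_nth.
have cover x : closure Om x -> exists i : 'I_(ib_num D), ib_ball i x.
  move=> /sP[y ys xy]; have yz : (index y z < size z)%N by rewrite index_mem.
  by exists (Ordinal yz); rewrite /ib_ball/= nth_index.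
have transv x y v : closure Om x -> VN N v -> ~ U x v -> boundary Om y -> eball x (f x).1 y ->
    q < `|dot v (n y)|.
  move=> clx /andP[_ vN] nU yb xy; have [_ _ fx] := fP x clx.
  apply: (transversal_normal N0 q0 vN _ (fx y yb xy)).
  by rewrite leNgt; apply/negP => H; apply: nU; left.
have good x v (i : 'I_(ib_num D)) : closure Om x -> VN N v -> ib_ball i x -> ~ ib_dir i v ->
    regular (x, v) /\ (forall k, launch (iter k.+1 bstep (x, v))) /\
    (forall k, ~ (singular (iter k.+1 bstep (x, v)).1 /\
     dot (iter k.+1 bstep (x, v)).2 (n (iter k.+1 bstep (x, v)).1) = 0)).
  move=> clx vN xi nv; have nU : ~ U (nth 0 z i) v by move=> H; apply: nv.
  have v0 := VN_neq0 N0 vN.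
  have rg : regular (x, v).
    apply: transversal_regular clx v0 _ => bx; rewrite -normr_gt0; apply: lt_trans q0 _.
    exact: transv (clz i) vN nU bx xi.
  split=> //; apply: (generic_launch HOm Hal mP (regular_start HOm Hal rg)) => j; apply/eqP => vm.
  by apply: nU; right; exists j => //; rewrite /strip/= vm normr0.
exists D; last first.
  move=> [x v] /= clx vN nIB; have [i xi] := cover x clx.
  have [|? [? _]] := good x v i clx vN xi; last by [].
  by move=> vi; apply: nIB; split=> //; exists i.
split.
- by move=> i; split; [exact: clz|have [] := fP _ (clz i)].
- move=> i; exists (U (nth 0 z i)) => //; apply: openU; first exact: open_strip.
  by apply: bigcup_open => k _; exact: open_strip.
- move=> i; have [_ mu1 _] := fP _ (clz i).
  apply: le_lt_trans (leb2_strips N0 _ (ltW e0) mu1 m1) _; first by rewrite mulr_ge0// ltW.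
  (* The tangential strip costs [eps * (2 / N) ^+ 3], at most [eps] because [N > 2], and the
     countable family another [eps]; the sum [2 * eps] is below [20 * eps]. *)
  rewrite lte_fin; suff : 4 * (2 * q) * N <= eps by lra.
  have -> : 4 * (2 * q) * N = eps * (2 / N) ^+ 3 by rewrite /q; field; rewrite gt_eqF.
  rewrite ler_piMr ?(ltW e0)// exprn_ile1// ?divr_ge0 ?(ltW N0)//.
  by rewrite ler_pdivrMr// mul1r ltW.
move=> x clx; have [i xi] := cover x clx; exists i; split=> // v vN nv.
have [_ [L NS]] := good x v i clx vN xi nv; split.
  move=> y yb yi; apply: (transv _ _ _ (clz i) vN _ yb yi).
  by move=> H; apply: nv.
move=> k k0 tk _; rewrite /tk (char_bounce HOm Hal _ _ L k0); last exact: (VN_neq0 N0 vN).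
case: k k0 {tk} => // k _ [[_ G] dI]; apply: (NS k); split; last by rewrite dotC.
exact: inflection_singular Hal _ dI.
Qed.

(** Once the length is exceeded, the first branch of the definition applies and the trapped
    alternative does not arise. *)
Lemma bounce_number_le p k (L : R) : L < length_upto p k ->
  (bounce_number Om p.1 p.2 L <= k%:R%:E)%E.
Proof.
move=> Lk; have kL : longer_than Om p.1 p.2 L k.
  have E j : xc Om 0 p.1 p.2 j = (iter j bstep p).1.
    by case: p {Lk} => x v; exact: (congr1 fst (cycle_bstep Om 0 x v j)).
  rewrite /longer_than/= big_add1/=; apply: (lt_le_trans Lk); rewrite le_eqVlt; apply/orP; left; apply/eqP.
  by apply: eq_bigr => j _; rewrite !E.
rewrite /bounce_number; case: asboolP => [_|[]]; last by exists k.
by apply: ereal_inf_lbound; exists k.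
Qed.

(** Compactness is applied to the full product of closure and annulus. Around a state of [IB] the
    claim is vacuous, because the balls are open and the direction sets relatively open, so nearby
    states belong to [IB] too. *)
Lemma uniform_length (D : IB_data) (N l : R) : 0 < N ->
  (forall i : 'I_(ib_num D), exists2 U : set (plane R), open U & ib_dir i = U `&` VN N) ->
  (forall p, closure Om p.1 -> VN N p.2 -> ~ IB Om N D p -> locally_bounded Om p l) ->
  exists K, forall p, closure Om p.1 -> VN N p.2 -> ~ IB Om N D p ->
    exists2 k, (k <= K)%N & l < length_upto p k.
Proof.
move=> N0 oD lb.
have := compact_setX (closure_compact HOm) (@VN_compact R N).
move=> /compact_near_coveringP/(_ nat \oo (fun K p => closure Om p.1 -> VN N p.2 -> ~ IB Om N D p ->
    exists2 k, (k <= K)%N & l < length_upto p k) _) H.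
have [|K _ KP] := H; last by exists K => p clp pN; exact: (KP K (leqnn K) p).
move=> p [/= clp pN]; have [[_ _ [i [pi xi]]]|nIB] := pselect (IB Om N D p).
  have [U oU UE] := oD i.
  have Up : U p.2 by move: pi; rewrite UE => -[].
  exists ([set q | ib_ball i q.1 /\ U q.2], setT).
    split; last exact: filterT.
    apply: filterI.
      by apply: (@cvg_fst _ _ (nbhs p.1) (nbhs p.2)); exact: open_nbhs_nbhs (conj (@eball_open R _ _) xi).
    by apply: (@cvg_snd _ _ (nbhs p.1) (nbhs p.2)); exact: open_nbhs_nbhs (conj oU Up).
  case=> q K [[/= qi qU] _] clq qN []; split=> //; exists i; split=> //.
  by rewrite UE.
have [K KP] := lb p clp pN nIB.
exists ([set q | VN N q.2 -> closure Om q.1 -> exists2 k, (k <= K)%N & l < length_upto q k], [set k | (K <= k)%N]).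
  split; last by exists K.
  apply: filterS KP => q qP qN clq; exact: (qP clq (VN_neq0 N0 qN)).
case=> q k [/= qP Kk] clq qN _; have [j jK lj] := qP qN clq.
by exists j => //; exact: leq_trans Kk.
Qed.

End Main.

Theorem lemma6 (R : realType) (M : nat) (Om : set (plane R))
    (Omi : 'I_M.+1 -> set (plane R))
    (HOm : analytic_nonconvex_domain Om Omi)
    (a b : 'I_M.+1 -> R) (al : 'I_M.+1 -> R -> plane R)
    (Hal : arclength_boundary Om Omi a b al) :
  exists2 C : R, 0 < C &
  forall T0 : R, 0 < T0 ->
  exists eps0 N0 : R, 0 < eps0 /\ 0 < N0 /\
  forall eps N : R, 0 < eps < eps0 -> N0 < N ->
  exists2 D : @IB_data R,
    is_IB_data Om (inflection_boundary a b al) C T0 eps N D &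
    exists K : R, (bounce_sup Om T0 N D <= K%:E)%E.
Proof.
exists 20 => // T0 T00; exists 1, 2; split=> //; split=> // eps N /andP[e0 _] N2.
have [D DP good] := infinite_bounces_data HOm Hal T0 e0 N2; exists D => //.
have [_ oD _ _] := DP.
have [|K KP] := uniform_length HOm (l := N * T0) (lt_trans (ltr0Sn R 1) N2) oD.
  move=> p clp pN nIB; have [rp lp] := good p clp pN nIB.
  (* The trajectory is taken from its first bounce on, since the initial state itself may be
     interior or point outward; the first flight only adds length. *)
  have [m mL] := launch_trajectory_length HOm Hal (Y := fun k => iter k.+1 (bstep Om) p) (fun k => erefl) lp (N * T0).
  apply: (locally_bounded_length HOm Hal (m := m.+1) rp lp).
  rewrite length_recl; apply: (lt_le_trans mL); apply: ler_wpDl; first exact: enorm_ge0.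
  by rewrite le_eqVlt; apply/orP; left; apply/eqP; apply: eq_bigr => j _; rewrite -!iterSr.
exists K%:R; apply: ub_ereal_sup => _ [p [[clp pN] nIB] <-].
have [k kK lk] := KP p clp pN nIB.
apply: le_trans (bounce_number_le lk) _.
by rewrite lee_fin ler_nat.
Qed.
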